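(* Let $M$ be a smooth manifold of dimension $n$ with a Riemannian metric $g$ and an affine connection $D$ (not assumed torsion-free or compatible with $g$), and let $(J^D,\widetilde g^D)$ be the natural almost Hermitian structure on the tangent bundle $TM$ induced by $(g,D)$. Let $D^*$ be the dual connection of $D$ with respect to $g$. Then: (i) $(J^D,\widetilde g^D)$ is almost Kähler if and only if $D^*$ is torsion-free. (ii) $(J^D,\widetilde g^D)$ is Kähler if and only if $(M,g,D)$ is a Hessian manifold, i.e. $D$ and $D^*$ are both flat, where ''flat'' means that both the torsion and the curvature vanish. (iii) If the metric $\widetilde g^D$ on $TM$ is Einstein, then the curvature tensor $R^D$ of $D$ vanishes.
   Context: Let $\pi:TM\to M$ be the tangent bundle, $(x^1,\dots,x^n)$ local coordinates on $M$, $(x^i,y^i)$ the induced coordinates on $TM$ with $y^j(\xi)=\xi^j$ for $\xi=\sum_i\xi^i\frac{\partial}{\partial x^i}$, and $D_{\partial/\partial x^i}\frac{\partial}{\partial x^j}=\sum_k\Gamma^k_{ij}\frac{\partial}{\partial x^k}$. For $X=\sum_i X^i\frac{\partial}{\partial x^i},\ \xi\in T_xM$, the horizontal and vertical lifts of $X$ at $\xi$ are the vectors in $T_\xi(TM)$ $$X^H_\xi=\sum_i X^i\frac{\partial}{\partial x^i}-\sum_{i,j,k}\Gamma^k_{ij}X^iy^j(\xi)\frac{\partial}{\partial y^k},\qquad X^V_\xi=\sum_i X^i\frac{\partial}{\partial y^i}.$$ Then $T_\xi(TM)$ is the direct sum of the spaces of horizontal and vertical lifts. The natural almost Hermitian structure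 $(J^D,\widetilde g^D)$ is defined by $$J^DX^H_\xi=X^V_\xi,\quad J^DX^V_\xi=-X^H_\xi,\quad \widetilde g^D(X^H_\xi,Y^H_\xi)=\widetilde g^D(X^V_\xi,Y^V_\xi)=g(X,Y),\quad \widetilde g^D(X^H_\xi,Y^V_\xi)=0$$ for $X,Y,\xi\in T_xM$ ($\widetilde g^D$ is called the Sasaki metric). The dual connection $D^*$ of $D$ with respect to $g$ is the affine connection defined by $Z(g(X,Y))=g(D^*_ZX,Y)+g(X,D_ZY)$ for all vector fields $X,Y,Z$ on $M$. Torsion and curvature: $T^D(X,Y)=D_XY-D_YX-[X,Y]$, $R^D(X,Y)Z=D_XD_YZ-D_YD_XZ-D_{[X,Y]}Z$. An almost Hermitian structure $(J,h)$ is almost Kähler if its Kähler form $\Omega=h(J\cdot,\cdot)$ is closed, and Kähler if $d\Omega=0$ and $J$ is integrable. *)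

(* Defs.v *)
From HB Require Import structures.
From mathcomp Require Import all_boot all_order all_algebra.
From mathcomp Require Import all_classical all_reals all_analysis.
Set Implicit Arguments. Unset Strict Implicit. Unset Printing Implicit Defensive.
Import Order.TTheory GRing.Theory Num.Theory.
Import numFieldNormedType.Exports.
Local Open Scope classical_set_scope.
Local Open Scope ring_scope.

Section Calculus.
Context {R : realType}.

Definition iter_derive {V W : normedModType R} (s : seq V) (f : V -> W) : V -> W :=
  foldr (fun v h => 'D_v h) f s.

(* $C^\infty$ on the open set [U]: every iterated directional derivative exists
   and is (Frechet) differentiable, hence continuous, at every point of [U]. *)
Definition smooth {V W : normedModType R} (U : set V) (f : V -> W) : Prop :=
  forall s x, U x -> differentiable (iter_derive s f) x.

Section Basic.
Context {V W : normedModType R}.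
Implicit Types (f g : V -> W) (U : set V).

Lemma near_eq_differentiable f g x :
  (\near x, f x = g x) -> differentiable f x -> differentiable g x.
Proof.
move=> fg df.
have fgx : f x = g x := nbhs_singleton fg.
have E : g \o shift x = cst (g x) + 'd f x +o_ (0 : V) id.
  have /diff_locallyP[_ /eqaddoP fo] := df.
  apply/eqaddoP => e e0; near=> y.
  have fgy : f (y + x) = g (y + x).
    near: y; have := fg; rewrite (near_shift 0 x); apply: filterS => y /=.
    by rewrite subr0.
  suff -> : (g \o shift x - (cst (g x) + 'd f x)) y =
    (f \o shift x - (cst (f x) + 'd f x)) y by near: y; exact: fo.
  rewrite -[LHS]/(g (y + x) - (g x + 'd f x y)).
  by rewrite -[RHS]/(f (y + x) - (f x + 'd f x y)) fgy fgx.
have cdf : continuous ('d f x) by exact: diff_continuous.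
apply/diff_locallyP; rewrite (diff_unique cdf E); split => //.
Unshelve. all: by end_near. Qed.

Lemma iter_derive_rcons s v f : iter_derive (rcons s v) f = iter_derive s ('D_v f).
Proof. by rewrite /iter_derive foldr_rcons. Qed.

Lemma eq_iter_derive U f g s : open U -> (forall x, U x -> f x = g x) ->
  forall x, U x -> iter_derive s f x = iter_derive s g x.
Proof.
move=> oU fg; elim: s => [|v s IH] //= x Ux.
apply: near_eq_derive; near do apply: IH.
exact: open_nbhs_nbhs.
Unshelve. all: by end_near. Qed.

Lemma smooth_eq U f g : open U -> (forall x, U x -> f x = g x) ->
  smooth U f -> smooth U g.
Proof.
move=> oU fg sf s x Ux; apply: (near_eq_differentiable _ (sf s x Ux)).
near do apply: (eq_iter_derive s oU fg).
exact: open_nbhs_nbhs.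
Unshelve. all: by end_near. Qed.

Lemma smooth_sub U U' f : U' `<=` U -> smooth U f -> smooth U' f.
Proof. by move=> UU sf s x /UU; apply: sf. Qed.

Lemma smooth_differentiable U f x : smooth U f -> U x -> differentiable f x.
Proof. by move=> sf Ux; apply: (sf [::]). Qed.

Lemma smooth_derive U f v : smooth U f -> smooth U ('D_v f).
Proof. by move=> sf s x Ux; rewrite -iter_derive_rcons; apply: sf. Qed.

Lemma iter_deriveD U f g s : open U ->
  (forall t x, (size t < size s)%N -> U x ->
     differentiable (iter_derive t f) x /\ differentiable (iter_derive t g) x) ->
  forall x, U x -> iter_derive s (f + g) x = iter_derive s f x + iter_derive s g x.
Proof.
move=> oU; elim: s => [//|v s IH] dfg x Ux /=.
have [? ?] := dfg s x (ltnSn _) Ux.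
rewrite -deriveD; [|exact/diff_derivable..].
apply: near_eq_derive; near=> y.
apply: IH; last by near: y; exact: open_nbhs_nbhs.
by move=> t z ts; apply: dfg; rewrite ltnS ltnW.
Unshelve. all: by end_near. Qed.

Lemma smoothD U f g : open U -> smooth U f -> smooth U g -> smooth U (f + g).
Proof.
move=> oU sf sg s x Ux.
apply: (@near_eq_differentiable (iter_derive s f + iter_derive s g)); last first.
  by apply: differentiableD; [exact: sf | exact: sg].
near=> y; apply/esym/(iter_deriveD oU); last by near: y; exact: open_nbhs_nbhs.
by move=> t z _ Uz; split; [exact: sf | exact: sg].
Unshelve. all: by end_near. Qed.

Lemma smooth_cst U (c : W) : smooth U (cst c).
Proof.
have H s : exists c', iter_derive s (cst c : V -> W) = cst c'.
  elim: s => [|v s [c' IH]]; first by exists c.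
  exists 0; rewrite /= IH; apply/funext => x; exact: derive_cst.
by move=> s x _; have [c' ->] := H s; apply: differentiable_cst.
Qed.

Lemma smooth_sum U n (F : 'I_n -> V -> W) : open U ->
  (forall i, smooth U (F i)) -> smooth U (fun x => \sum_(i < n) F i x).
Proof.
move=> oU; elim: n F => [|n IH] F sF.
  rewrite (_ : (fun x => _) = cst 0); first exact: smooth_cst.
  by apply/funext => x; rewrite big_ord0.
rewrite (_ : (fun x => _) = (fun x => \sum_(i < n) F (widen_ord (leqnSn n) i) x) + F ord_max).
  by apply: smoothD => //; exact: IH.
by apply/funext => x; rewrite big_ord_recr.
Qed.

End Basic.


Lemma smoothM {V : normedModType R} (U : set V) (f g : V -> R) :
  open U -> smooth U f -> smooth U g -> smooth U (f * g).
Proof.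
move=> oU sf sg s; have [k sk] := ubnP (size s).
elim: k s sk f g sf sg => // k IH s sk f g sf sg x Ux.
have [s0|] := posnP (size s).
  rewrite (size0nil s0) /=.
  by apply: differentiableM; [exact: smooth_differentiable sf Ux |
    exact: smooth_differentiable sg Ux].
case/lastP: s sk => // s v; rewrite size_rcons ltnS => sk _.
rewrite iter_derive_rcons.
have E y : U y -> (f * 'D_v g + g * 'D_v f) y = 'D_v (f * g) y.
  move=> Uy; rewrite deriveM //.
  - by apply/diff_derivable; exact: smooth_differentiable sf Uy.
  - by apply/diff_derivable; exact: smooth_differentiable sg Uy.
apply: (@near_eq_differentiable _ _
  (iter_derive s (f * 'D_v g) + iter_derive s (g * 'D_v f))); last first.
  by apply: differentiableD; apply: IH => //; exact: smooth_derive.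
near=> y.
have Uy : U y by near: y; exact: open_nbhs_nbhs.
rewrite -(eq_iter_derive s oU E Uy); apply/esym/(iter_deriveD oU) => // t z ts Uz.
have tk : (size t < k)%N by apply: ltn_trans sk.
by split; apply: IH => //; exact: smooth_derive.
Unshelve. all: by end_near. Qed.

Lemma iter_derive_comp {V V' W : normedModType R} (L : V -> V') (f : V' -> W) s :
  linear L -> iter_derive s (f \o L) = iter_derive (map L s) f \o L.
Proof.
move=> lL; elim: s => [//|v s IH] /=; rewrite IH; apply/funext => x.
rewrite /= /derive; set F := fun h => _; set G := fun h => _.
suff -> : F = G by [].
by apply/funext => h; rewrite /F /G /= lL.
Qed.

Lemma smooth_comp_linear {V V' W : normedModType R} (L : {linear V -> V'})
    (U : set V') (f : V' -> W) :
  continuous L -> smooth U f -> smooth (L @^-1` U) (f \o L).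
Proof.
move=> cL sf s x Ux; rewrite iter_derive_comp; last exact: linearP.
by apply: differentiable_comp; [exact: linear_differentiable | exact: sf].
Qed.

Lemma smooth_linear {V V' : normedModType R} (L : {linear V -> V'}) (U : set V) :
  continuous L -> smooth U L.
Proof.
move=> cL; case/lastP => [|s v] x Ux; first exact: linear_differentiable.
rewrite iter_derive_rcons (_ : 'D_v _ = cst (L v)); first exact: (@smooth_cst _ _ setT).
apply/funext => y; rewrite deriveE; last exact: linear_differentiable.
by rewrite diff_lin.
Qed.

Lemma rV_differentiable {V : normedModType R} k (f : V -> 'rV[R]_k) x :
  (forall j, differentiable (fun y => f y 0 j : R) x) -> differentiable f x.
Proof.
move=> df.
have -> : f = \sum_(j < k) (fun y => f y 0 j *: delta_mx 0 j : 'rV[R]_k).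
  by apply/funext => y; rewrite [LHS]row_sum_delta fct_sumE.
apply: differentiable_sum => j.
exact: (@differentiableZl R V _ (fun y => f y 0 j)).
Qed.

Lemma smooth_rV {V : normedModType R} k (U : set V) (f : V -> 'rV[R]_k) :
  open U -> (forall j, smooth U (fun y => f y 0 j : R)) -> smooth U f.
Proof.
move=> oU sf.
have E s j x : U x -> iter_derive s (fun y => f y 0 j : R) x = iter_derive s f x 0 j.
  elim: s j x => [//|v s IH] j x Ux /=.
  rewrite derive_mx ?mxE.
    by apply: near_eq_derive; near do apply: IH; exact: open_nbhs_nbhs.
  apply/diff_derivable/rV_differentiable => l.
  apply: (near_eq_differentiable _ (sf l s x Ux)).
  by near do apply: IH; exact: open_nbhs_nbhs.
move=> s x Ux; apply: rV_differentiable => l.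
apply: (near_eq_differentiable _ (sf l s x Ux)).
by near do apply: E; exact: open_nbhs_nbhs.
Unshelve. all: by end_near. Qed.

Lemma smooth_coord {V : normedModType R} k (U : set V) (f : V -> 'rV[R]_k) j :
  open U -> smooth U f -> smooth U (fun y => f y 0 j : R).
Proof.
move=> oU sf.
have E s x : U x -> iter_derive s f x 0 j = iter_derive s (fun y => f y 0 j : R) x.
  elim: s x => [//|v s IH] x Ux /=.
  rewrite derive_mx ?mxE; last exact/diff_derivable/sf.
  by apply: near_eq_derive; near do apply: IH; exact: open_nbhs_nbhs.
move=> s x Ux.
apply: (@near_eq_differentiable _ _ (fun y => iter_derive s f y 0 j)).
  by near do apply: E; exact: open_nbhs_nbhs.
apply: (@differentiable_comp _ _ _ _ (iter_derive s f) (fun u : 'rV[R]_k => u 0 j)).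
  exact: sf.
exact: differentiable_coord.
Unshelve. all: by end_near. Qed.

End Calculus.

(* [chart a] is only meaningful on [chart_dom a] and [chart_inv a] on the image
   [chart a @` chart_dom a]; their values elsewhere are arbitrary.  The carrier
   has no topology of its own: the manifold topology is the one given by the
   atlas, see [mopen].  [chart_at x] is a distinguished chart around [x], used to
   represent the tangent space at [x]. *)
Record atlas (R : realType) (n : nat) := Atlas {
  carrier :> Type;
  chart_index : Type;
  chart_dom : chart_index -> set carrier;
  chart : chart_index -> carrier -> 'rV[R]_n;
  chart_inv : chart_index -> 'rV[R]_n -> carrier;
  chart_at : carrier -> chart_index }.

Arguments Atlas {R n carrier chart_index}.

Section Atlas.
Context {R : realType} {n : nat} {M : atlas R n}.
Implicit Types (a b : chart_index M) (x : M) (U : set M).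

Definition coord_dom a U : set 'rV[R]_n := chart a @` (chart_dom a `&` U).

Definition transition a b : 'rV[R]_n -> 'rV[R]_n := chart b \o chart_inv a.

Definition mopen U : Prop := forall a, open (coord_dom a U).

End Atlas.

Record is_manifold {R : realType} {n : nat} (M : atlas R n) : Prop := IsManifold {
  domain_chart_at : forall x : M, chart_dom (chart_at x) x;
  chartK : forall (a : chart_index M) x, chart_dom a x -> chart_inv a (chart a x) = x;
  domain_open : forall a : chart_index M, mopen (chart_dom a);
  transition_smooth : forall a b : chart_index M,
    smooth (coord_dom a (chart_dom b)) (transition a b);
  manifold_hausdorff : forall x y : M, x <> y -> exists U V : set M,
    [/\ mopen U, mopen V, U x, V y & U `&` V = set0];
  manifold_second_countable : exists A : set (chart_index M),
    countable A /\ \bigcup_(a in A) chart_dom a = setT }.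

Arguments transition_smooth {R n M} _ a b : rename.
Arguments domain_open {R n M} _ a b : rename.

Record manifold (R : realType) (n : nat) := Manifold {
  manifold_atlas :> atlas R n;
  manifoldP : is_manifold manifold_atlas }.

(* A tangent vector at [x] is given by its components in the chart [chart_at x];
   [components] and [tangent_of] convert to and from another chart by means of
   the differential of the transition map. *)
Definition tangent {R : realType} {n : nat} {M : atlas R n} (x : M) : Type := 'rV[R]_n.

Section Tangent.
Context {R : realType} {n : nat} {M : atlas R n}.
Implicit Types (a b : chart_index M) (x : M) (U : set M).

Definition change_frame a b x (u : 'rV[R]_n) : 'rV[R]_n :=
  'D_u (transition a b) (chart a x).

Definition components a x (v : tangent x) : 'rV[R]_n := change_frame (chart_at x) a x v.

Definition tangent_of a x (u : 'rV[R]_n) : tangent x := change_frame a (chart_at x) x u.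

End Tangent.

Section Theory.
Context {R : realType} {n : nat} (M : manifold R n).
Implicit Types (a b c : chart_index M) (x : M) (U : set M).
Let MP := manifoldP M.

Lemma coord_domP a U p : coord_dom a U p ->
  [/\ chart_dom a (chart_inv a p), U (chart_inv a p) & chart a (chart_inv a p) = p].
Proof. by move=> [x [ax Ux] <-]; rewrite (chartK MP). Qed.

Lemma change_frame_differentiable a b x : chart_dom a x -> chart_dom b x ->
  differentiable (transition a b) (chart a x).
Proof.
move=> ax bx; have cx : coord_dom a (chart_dom b) (chart a x) by exists x.
have := smooth_differentiable (transition_smooth MP a b) cx.
by apply.
Qed.

Lemma change_frame_linear a b x : chart_dom a x -> chart_dom b x ->
  linear (change_frame a b x).
Proof.
move=> ax bx k u v; rewrite /change_frame !deriveE ?linearP //;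
  exact: change_frame_differentiable.
Qed.

Lemma change_frame_comp a b c x u : chart_dom a x -> chart_dom b x -> chart_dom c x ->
  change_frame b c x (change_frame a b x u) = change_frame a c x u.
Proof.
move=> ax bx cx; rewrite /change_frame.
have E : chart b x = transition a b (chart a x) by rewrite /transition /= (chartK MP).
have dab := change_frame_differentiable ax bx.
have dbc := change_frame_differentiable bx cx.
rewrite (deriveE _ dab) (deriveE _ dbc) E -[LHS]/(('d _ _ \o 'd _ _) u).
rewrite E in dbc.
rewrite -diff_comp // -deriveE; last exact: differentiable_comp.
apply: near_eq_derive; near=> p.
have : coord_dom a (chart_dom b) p.
  by near: p; apply: open_nbhs_nbhs; split; [exact: domain_open|exists x].
move=> /coord_domP[ap bp cp].
by rewrite /transition /= (chartK MP).
Unshelve. all: by end_near. Qed.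

Lemma change_frame_id a x u : chart_dom a x -> change_frame a a x u = u.
Proof.
move=> ax; rewrite /change_frame -[RHS](derive_id (chart a x)).
apply: near_eq_derive; near=> p.
have : coord_dom a (chart_dom a) p.
  by near: p; apply: open_nbhs_nbhs; split; [exact: domain_open|exists x].
by move=> /coord_domP[].
Unshelve. all: by end_near. Qed.

Lemma componentsK a x (v : tangent x) : chart_dom a x -> tangent_of a x (components a v) = v.
Proof.
move=> ax; have := domain_chart_at MP x => cx.
by rewrite /tangent_of /components change_frame_comp // change_frame_id.
Qed.

Lemma tangent_ofK a x u : chart_dom a x -> components a (tangent_of a x u) = u.
Proof.
move=> ax; have := domain_chart_at MP x => cx.
by rewrite /tangent_of /components change_frame_comp // change_frame_id.
Qed.

Lemma components_tangent_of a b x u : chart_dom a x -> chart_dom b x ->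
  components b (tangent_of a x u) = change_frame a b x u.
Proof.
move=> ax bx; have := domain_chart_at MP x => cx.
by rewrite /tangent_of /components change_frame_comp.
Qed.

(* The induced coordinates $(x^i, y^i)$: the chart of index [a] sends a tangent
   vector at [x] to the row of the coordinates of [x] followed by the components
   of the vector in [a]. *)
Definition tangent_bundle_atlas : atlas R (n + n) :=
  Atlas (carrier := {x : M & tangent x})
    (fun a => [set xi | chart_dom a (projT1 xi)])
    (fun a xi => row_mx (chart a (projT1 xi)) (components a (projT2 xi)))
    (fun a z => let x := chart_inv a (lsubmx z) in existT _ x (tangent_of a x (rsubmx z)))
    (fun xi => chart_at (projT1 xi)).

Let T := tangent_bundle_atlas.

Lemma tangent_bundle_chartK (a : chart_index T) (xi : T) : chart_dom a xi ->
  chart_inv a (chart a xi) = xi.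
Proof.
case: xi => x v /= ax; rewrite row_mxKl row_mxKr (chartK MP) //.
by rewrite componentsK.
Qed.

Lemma tangent_bundle_coord_dom (a : chart_index T) (U : set M) :
  coord_dom a ((fun xi : T => projT1 xi) @^-1` U) = lsubmx @^-1` (coord_dom (a : chart_index M) U).
Proof.
apply/seteqP; split => [z [[x v] [/= ax Ux] <-]|z].
  by rewrite row_mxKl; exists x.
move=> /= [x [ax Ux] xz].
exists (existT _ x (@tangent_of _ _ M a x (rsubmx z))) => //=.
by rewrite tangent_ofK // xz hsubmxK.
Qed.

Lemma tangent_bundle_mopen (U : set M) : mopen U ->
  mopen ((fun xi : T => projT1 xi) @^-1` U).
Proof.
move=> oU a; rewrite tangent_bundle_coord_dom.
by apply: open_comp => // ? _; exact: continuous_lsubmx.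
Qed.

Lemma tangent_bundle_transition_smooth (a b : chart_index T) :
  smooth (coord_dom a (chart_dom b)) (transition a b).
Proof.
have -> : chart_dom b = (fun xi : T => projT1 xi) @^-1` (chart_dom (b : chart_index M)) by [].
set V := coord_dom _ _.
have oV : open V by apply: tangent_bundle_mopen; exact: (domain_open MP b).
have VE : V = _ := tangent_bundle_coord_dom a _.
pose tau := @transition _ _ M a b.
have stau v : smooth V ('D_v tau \o lsubmx).
  rewrite VE; apply: smooth_comp_linear; first exact: continuous_lsubmx.
  exact/smooth_derive/transition_smooth.
have stau0 : smooth V (tau \o lsubmx).
  rewrite VE; apply: smooth_comp_linear; first exact: continuous_lsubmx.
  exact/transition_smooth.
have coord k (j : 'I_k) (f : 'rV[R]_(n + n) -> 'rV[R]_k) : smooth V f ->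
    smooth V (fun z => f z 0 j : R) by move=> sf; exact: smooth_coord.
apply: (@smooth_eq _ _ _ _ (fun z => row_mx (tau (lsubmx z))
   (\sum_(i < n) (rsubmx z) 0 i *: 'D_('e_i) tau (lsubmx z)))) => //.
  move=> z; rewrite VE => /= /coord_domP[az bz cz].
  rewrite /transition /=; congr row_mx.
  rewrite components_tangent_of //.
  rewrite /change_frame cz [in RHS](row_sum_delta (rsubmx z)).
  rewrite -cz deriveE; last exact: change_frame_differentiable.
  rewrite linear_sum; apply: eq_bigr => i _.
  by rewrite linearZ deriveE //; exact: change_frame_differentiable.
apply: smooth_rV => // j.
case: (split_ordP j) => i ->.
  under eq_fun do rewrite row_mxEl.
  exact: coord.
under eq_fun do rewrite row_mxEr summxE.
apply: smooth_sum => // k.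
under eq_fun do rewrite mxE.
apply: (@smoothM _ _ V (fun z => rsubmx z 0 k) (fun z => 'D_('e_k) tau (lsubmx z) 0 i)) => //.
  apply: coord; apply: smooth_linear; exact: continuous_rsubmx.
exact: (coord _ i _ (stau _)).
Qed.

Lemma tangent_bundle_chart_preimage (a : chart_index T) (A : set 'rV[R]_(n + n)) :
  open A -> mopen ([set xi : T | chart_dom a xi /\ A (chart a xi)]).
Proof.
move=> oA b.
have oV : open (coord_dom b (chart_dom a)).
  have -> : chart_dom a = (fun xi : T => projT1 xi) @^-1` (chart_dom (a : chart_index M)) by [].
  by apply: tangent_bundle_mopen; exact: (domain_open MP a).
have -> : coord_dom b [set xi : T | chart_dom a xi /\ A (chart a xi)] =
    coord_dom b (chart_dom a) `&` (transition b a @^-1` A).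
  have E xi : chart_dom b xi -> transition b a (chart b xi) = chart a xi.
    by move=> bxi; rewrite -[RHS](congr1 _ (tangent_bundle_chartK bxi)).
  apply/seteqP; split => [z [xi [bxi [axi Axi]] <-]|z [[xi [bxi axi] <-] Axi]].
    by split; [exists xi|rewrite /preimage /mkset E].
  by exists xi => //; rewrite /preimage /mkset E in Axi.
rewrite openE => z [Vz Az]; apply: filterI; first exact: open_nbhs_nbhs.
have dz : differentiable (transition b a) z.
  exact: smooth_differentiable (@tangent_bundle_transition_smooth b a) Vz.
by apply: (differentiable_continuous dz); exact: open_nbhs_nbhs.
Qed.

Lemma tangent_bundle_is_manifold : is_manifold T.
Proof.
split.
- by move=> xi; exact: (domain_chart_at MP (projT1 xi)).
- exact: tangent_bundle_chartK.
- by move=> a; apply: tangent_bundle_mopen; exact: (domain_open MP a).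
- exact: tangent_bundle_transition_smooth.
- move=> [x v] [y w] xy.
  have [exy|nxy] := pselect (x = y); last first.
    have [U [V [oU oV Ux Vy UV]]] := manifold_hausdorff MP nxy.
    exists ((fun xi : T => projT1 xi) @^-1` U), ((fun xi : T => projT1 xi) @^-1` V).
    split => //; try exact: tangent_bundle_mopen.
    by rewrite -preimage_setI UV preimage_set0.
  subst y.
  have ax := domain_chart_at MP x; set a := chart_at x in ax.
  have vw : chart (a : chart_index T) (existT _ x v : T) != chart (a : chart_index T) (existT _ x w : T).
    apply/eqP => /(congr1 (chart_inv (a : chart_index T))).
    by rewrite !tangent_bundle_chartK.
  have := @norm_hausdorff R 'rV[R]_(n + n).
  rewrite open_hausdorff => /(_ _ _ vw)[[A B] /= [vA wB] [oA oB /eqP AB]].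
  exists [set xi : T | chart_dom (a : chart_index T) xi /\ A (chart (a : chart_index T) xi)].
  exists [set xi : T | chart_dom (a : chart_index T) xi /\ B (chart (a : chart_index T) xi)].
  split; try exact: tangent_bundle_chart_preimage.
  + by split => //; exact: set_mem.
  + by split => //; exact: set_mem.
  apply/seteqP; split => // xi [[_ Axi] [_ Bxi]].
  by have : (A `&` B) (chart (a : chart_index T) xi) by []; rewrite AB.
- have [A [cA covA]] := manifold_second_countable MP.
  exists A; split => //; apply/seteqP; split => // -[x v] _.
  have : (\bigcup_(a in A) chart_dom a) x by rewrite covA.
  by move=> [a Aa ax]; exists a.
Qed.

Definition tangent_bundle : manifold R (n + n) := Manifold tangent_bundle_is_manifold.

End Theory.

Definition vector_field {R : realType} {n : nat} (M : manifold R n) : Type :=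
  forall x : M, tangent x.

Definition covariant_tensor2 {R : realType} {n : nat} (M : manifold R n) : Type :=
  forall x : M, tangent x -> tangent x -> R.

Definition endomorphism_field {R : realType} {n : nat} (M : manifold R n) : Type :=
  forall x : M, tangent x -> tangent x.

(* Affine connections, forms, etc. are stated on vector fields that are smooth
   on an open set [U], at the points of [U]; a [vector_field] that is only
   smooth on [U] has arbitrary values elsewhere, so it represents a local
   section.  This is how coordinate fields, which are only defined on a chart
   domain, are handled. *)

Section Fields.
Context {R : realType} {n : nat} {M : manifold R n}.
Implicit Types (a : chart_index M) (U : set M) (f : M -> R) (X Y Z : vector_field M).

Definition smooth_function U f : Prop :=
  forall a, smooth (coord_dom a U) (f \o chart_inv a).

Definition field_in_chart a X : 'rV[R]_n -> 'rV[R]_n :=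
  fun p => components a (X (chart_inv a p)).

Definition smooth_field U X : Prop :=
  forall a, smooth (coord_dom a U) (field_in_chart a X).

Definition coordinate_field a (i : 'I_n) : vector_field M :=
  fun x => tangent_of a x 'e_i.

Definition field_derive X f : M -> R := fun x =>
  let a := chart_at x in 'D_(X x) (f \o chart_inv a) (chart a x).

Definition lie_bracket X Y : vector_field M := fun x =>
  let a := chart_at x in
  'D_(X x) (field_in_chart a Y) (chart a x) - 'D_(Y x) (field_in_chart a X) (chart a x).

Definition tensor_eval (h : covariant_tensor2 M) X Y : M -> R :=
  fun x => h x (X x) (Y x).

Definition endo_eval (J : endomorphism_field M) X : vector_field M :=
  fun x => J x (X x).

Definition exterior_derivative2 (w : covariant_tensor2 M) X Y Z (x : M) : R :=
  field_derive X (tensor_eval w Y Z) x - field_derive Y (tensor_eval w X Z) x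
  + field_derive Z (tensor_eval w X Y) x
  - tensor_eval w (lie_bracket X Y) Z x + tensor_eval w (lie_bracket X Z) Y x
  - tensor_eval w (lie_bracket Y Z) X x.

Definition closed_form2 (w : covariant_tensor2 M) : Prop :=
  forall U X Y Z, mopen U -> smooth_field U X -> smooth_field U Y -> smooth_field U Z ->
  forall x, U x -> exterior_derivative2 w X Y Z x = 0.

Record riemannian_metric (g : covariant_tensor2 M) : Prop := RiemannianMetric {
  metric_linear : forall (x : M) (k : R) (u v w : tangent x),
    g x (k *: u + v) w = k * g x u w + g x v w;
  metric_sym : forall (x : M) (u v : tangent x), g x u v = g x v u;
  metric_pos : forall (x : M) (u : tangent x), u != 0 -> 0 < g x u u;
  metric_smooth : forall U X Y, mopen U -> smooth_field U X -> smooth_field U Y ->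
    smooth_function U (tensor_eval g X Y) }.

Record affine_connection (D : vector_field M -> vector_field M -> vector_field M) : Prop :=
  AffineConnection {
  connection_linear : forall U f X X' Y, mopen U -> smooth_function U f ->
    smooth_field U X -> smooth_field U X' -> smooth_field U Y ->
    forall x, U x ->
    D (fun y => f y *: X y + X' y) Y x = f x *: D X Y x + D X' Y x;
  connection_additive : forall U X Y Y', mopen U ->
    smooth_field U X -> smooth_field U Y -> smooth_field U Y' ->
    forall x, U x -> D X (fun y => Y y + Y' y) x = D X Y x + D X Y' x;
  connection_leibniz : forall U f X Y, mopen U -> smooth_function U f ->
    smooth_field U X -> smooth_field U Y ->
    forall x, U x ->
    D X (fun y => f y *: Y y) x = field_derive X f x *: Y x + f x *: D X Y x;
  connection_smooth : forall U X Y, mopen U ->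
    smooth_field U X -> smooth_field U Y -> smooth_field U (D X Y) }.

Section Connection.
Variable D : vector_field M -> vector_field M -> vector_field M.

Definition torsion X Y : vector_field M :=
  fun x => D X Y x - D Y X x - lie_bracket X Y x.

Definition curvature X Y Z : vector_field M :=
  fun x => D X (D Y Z) x - D Y (D X Z) x - D (lie_bracket X Y) Z x.

Definition torsion_free : Prop := forall U X Y, mopen U ->
  smooth_field U X -> smooth_field U Y -> forall x, U x -> torsion X Y x = 0.

Definition curvature_free : Prop := forall U X Y Z, mopen U ->
  smooth_field U X -> smooth_field U Y -> smooth_field U Z ->
  forall x, U x -> curvature X Y Z x = 0.

Definition flat_connection : Prop := torsion_free /\ curvature_free.

(* Ric(Y, Z) is the trace of X |-> R(X, Y)Z, taken at [x] in the frame of the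
   chart [chart_at x]. *)
Definition ricci Y Z (x : M) : R :=
  \sum_(i < n) (curvature (coordinate_field (chart_at x) i) Y Z x : 'rV[R]_n) 0 i.

(* [christoffel x i j k] is $\Gamma^k_{ij}(x)$ in the chart [chart_at x]. *)
Definition christoffel (x : M) (i j k : 'I_n) : R :=
  (D (coordinate_field (chart_at x) i) (coordinate_field (chart_at x) j) x : 'rV[R]_n) 0 k.

End Connection.

Definition dual_connection (g : covariant_tensor2 M)
    (D Dstar : vector_field M -> vector_field M -> vector_field M) : Prop :=
  forall U X Y Z, mopen U -> smooth_field U X -> smooth_field U Y -> smooth_field U Z ->
  forall x, U x ->
  field_derive Z (tensor_eval g X Y) x =
    g x (Dstar Z X x) (Y x) + g x (X x) (D Z Y x).

(* A connection is metric exactly when it is its own dual. *)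
Definition levi_civita (h : covariant_tensor2 M)
    (D : vector_field M -> vector_field M -> vector_field M) : Prop :=
  [/\ affine_connection D, torsion_free D & dual_connection h D D].

Definition einstein (h : covariant_tensor2 M) : Prop :=
  exists D, levi_civita h D /\
  exists lambda : R, forall U Y Z, mopen U -> smooth_field U Y -> smooth_field U Z ->
    forall x, U x -> ricci D Y Z x = lambda * h x (Y x) (Z x).

Record almost_hermitian (J : endomorphism_field M) (h : covariant_tensor2 M) : Prop :=
  AlmostHermitian {
  hermitian_metric : riemannian_metric h;
  J_linear : forall (x : M) (k : R) (u v : tangent x),
    J x (k *: u + v) = k *: J x u + J x v;
  J_smooth : forall U X, mopen U -> smooth_field U X -> smooth_field U (endo_eval J X);
  J_square : forall (x : M) (u : tangent x), J x (J x u) = - u;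
  hermitian_compat : forall (x : M) (u v : tangent x), h x (J x u) (J x v) = h x u v }.

Definition kahler_form (J : endomorphism_field M) (h : covariant_tensor2 M) :
  covariant_tensor2 M := fun x u v => h x (J x u) v.

(* An almost complex structure is called integrable when its Nijenhuis tensor
   vanishes (Kobayashi-Nomizu, vol. II, chapter IX). *)
Definition nijenhuis (J : endomorphism_field M) X Y : vector_field M := fun x =>
  lie_bracket (endo_eval J X) (endo_eval J Y) x
  - J x (lie_bracket (endo_eval J X) Y x)
  - J x (lie_bracket X (endo_eval J Y) x)
  - lie_bracket X Y x.

Definition integrable_structure (J : endomorphism_field M) : Prop :=
  forall U X Y, mopen U -> smooth_field U X -> smooth_field U Y ->
  forall x, U x -> nijenhuis J X Y x = 0.

Definition almost_kahler (J : endomorphism_field M) (h : covariant_tensor2 M) : Prop :=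
  almost_hermitian J h /\ closed_form2 (kahler_form J h).

Definition kahler (J : endomorphism_field M) (h : covariant_tensor2 M) : Prop :=
  almost_kahler J h /\ integrable_structure J.

End Fields.

Section NaturalStructure.
Context {R : realType} {n : nat} {M : manifold R n}.
Variables (g : covariant_tensor2 M)
  (D : vector_field M -> vector_field M -> vector_field M).
Implicit Types xi : tangent_bundle M.

(* At [xi] in $T_xM$ the distinguished chart of [TM] is the one induced by
   [chart_at x]; since a tangent vector at [x] is stored through its components
   in [chart_at x], the fibre coordinates $y^j(\xi)$ are the entries of
   [projT2 xi], and [row_mx X Y] is
   $\sum_i X^i\partial/\partial x^i + \sum_i Y^i\partial/\partial y^i$. *)
Definition horizontal_lift xi (X : tangent (projT1 xi)) : tangent xi :=
  let x := projT1 xi in let y : 'rV[R]_n := projT2 xi in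
  row_mx X (- \row_k \sum_(i < n) \sum_(j < n)
    christoffel D x i j k * (X : 'rV[R]_n) 0 i * y 0 j).

Definition vertical_lift xi (X : tangent (projT1 xi)) : tangent xi :=
  row_mx (0 : 'rV[R]_n) X.

Definition horizontal_part xi (z : tangent xi) : tangent (projT1 xi) :=
  lsubmx (z : 'rV[R]_(n + n)).

Definition vertical_part xi (z : tangent xi) : tangent (projT1 xi) :=
  rsubmx (z - horizontal_lift (horizontal_part z) : 'rV[R]_(n + n)).

Lemma lift_decomposition xi (z : tangent xi) :
  z = horizontal_lift (horizontal_part z) + vertical_lift (vertical_part z).
Proof.
apply: (@addrI _ (- horizontal_lift (horizontal_part z))).
rewrite addKr addrC /vertical_part -[LHS]hsubmxK /vertical_lift; congr row_mx.
by rewrite /horizontal_lift linearB /= row_mxKl subrr.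
Qed.

Lemma horizontal_part_lift xi (X Y : tangent (projT1 xi)) :
  horizontal_part (horizontal_lift X + vertical_lift Y) = X.
Proof. by rewrite /horizontal_part linearD /= !row_mxKl addr0. Qed.

Lemma vertical_part_lift xi (X Y : tangent (projT1 xi)) :
  vertical_part (horizontal_lift X + vertical_lift Y) = Y.
Proof. by rewrite /vertical_part horizontal_part_lift addrAC subrr add0r row_mxKr. Qed.

Lemma horizontal_lift0 xi : horizontal_lift (0 : tangent (projT1 xi)) = 0.
Proof.
rewrite /horizontal_lift (_ : \row_k _ = 0) ?oppr0 ?row_mx0 //.
apply/rowP => k; rewrite !mxE big1 // => i _; rewrite big1 // => j _.
by rewrite mxE mulr0 mul0r.
Qed.

Definition natural_J : endomorphism_field (tangent_bundle M) := fun xi z =>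
  vertical_lift (horizontal_part z) - horizontal_lift (vertical_part z).

Definition sasaki_metric : covariant_tensor2 (tangent_bundle M) := fun xi z w =>
  g (horizontal_part z) (horizontal_part w) + g (vertical_part z) (vertical_part w).

Lemma natural_J_horizontal xi (X : tangent (projT1 xi)) :
  @natural_J xi (horizontal_lift X) = vertical_lift X.
Proof.
have v0 : vertical_lift (0 : tangent (projT1 xi)) = 0 by exact: row_mx0.
have := horizontal_part_lift X 0; have := vertical_part_lift X 0.
by rewrite /natural_J v0 addr0 => -> ->; rewrite horizontal_lift0 subr0.
Qed.

Lemma natural_J_vertical xi (X : tangent (projT1 xi)) :
  @natural_J xi (vertical_lift X) = - horizontal_lift X.
Proof.
have v0 : vertical_lift (0 : tangent (projT1 xi)) = 0 by exact: row_mx0.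
have := horizontal_part_lift 0 X; have := vertical_part_lift 0 X.
by rewrite /natural_J horizontal_lift0 add0r => -> ->; rewrite v0 sub0r.
Qed.

Lemma sasaki_metric_lift xi (X X' Y Y' : tangent (projT1 xi)) :
  @sasaki_metric xi (horizontal_lift X + vertical_lift X')
    (horizontal_lift Y + vertical_lift Y') = g X Y + g X' Y'.
Proof. by rewrite /sasaki_metric !horizontal_part_lift !vertical_part_lift. Qed.

End NaturalStructure.

Arguments natural_J {R n M} D xi z : rename.
Arguments sasaki_metric {R n M} g D xi z w : rename.

(* Main.v *)
Require Import Defs.
From HB Require Import structures.
From mathcomp Require Import all_boot all_order all_algebra.
From mathcomp Require Import all_classical all_reals all_analysis.
From mathcomp Require Import ring lra.

Set Implicit Arguments.
Unset Strict Implicit.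
Unset Printing Implicit Defensive.
Import Order.TTheory GRing.Theory Num.Theory.
Import numFieldNormedType.Exports.
Local Open Scope classical_set_scope.
Local Open Scope ring_scope.

(* Everything is computed in a chart [x] of [M] and the induced chart [(x, y)] of
   [TM], where [D] and [Dstar] have Christoffel symbols [B] and [Bs].  Call
   [kap u = u2 + B(u1, y)] the vertical part of [u = (u1, u2)].

   (i) The Kahler form is [G(u1, kap v) - G(kap u, v1)]; its exterior derivative is
   the cyclic sum of [G(Tstar(u1, v1), kap w) + G(v1, R(u1, w1) y)].  At [y = 0] only
   the torsion of [Dstar] remains; conversely, if it vanishes, so does the second
   term, by duality of the curvatures of [D] and [Dstar] and the first Bianchi
   identity for [Dstar].

   (ii) The Nijenhuis tensor on horizontal lifts is [T(a, b)^H + (R(a, b) y)^V].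

   (iii) For a vertical field [V = (0, v)] with constant components,
   [Ric(V, V) = div(nabla_V V) - V(div V) - tr((nabla V)^2)].  All terms are
   constant along the fibres except the horizontal block of the last one, which
   contributes [1/4 sum_ij G(v, R(e_i, e_j) y)^2] for an orthonormal frame [e_i].
   If the metric is Einstein, [Ric(V, V)] is a multiple of [G(v, v)], so this sum,
   which vanishes at [y = 0], vanishes identically. *)

(** [D] acts on arbitrary assignments of vectors to points and obeys its axioms only on open sets
    where the fields are smooth. Each tensor is therefore replaced by a family of multilinear maps
    on the whole coordinate space, obtained by expansion in the coordinate frame: multilinearity
    then holds at every point, and only differentiability is confined to the image of the chart.
    Tensoriality reduces every computation to fields with constant components, whose brackets
    vanish.

    In (iii), [D] may have torsion and need not preserve the metric, so the Levi-Civita connection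
    of TM has many terms; restricting Ric to vertical vectors avoids most of them. There [nabla_V V]
    is the horizontal lift of a field on the base, and [div V = 0] because the density does not
    change along the fibres. The mixed blocks of [nabla V] are kept as they are: only their
    independence of [y] matters. The horizontal block is the antisymmetric form
    [G(v, R(a, b) y) / 2]. The factor 1/2 of the Koszul formula, squared, gives 1/4, and
    antisymmetry turns minus the trace of the square into plus a sum of squares. *)

Section LinearFunctions.
Context {R : pzRingType} {V W : lmodType R} {L : V -> W} (lL : linear L).

(** The linear maps met below are members of families indexed by a point, whose linearity is a
    proposition; hence these rules take it as the hypothesis [lL]. *)
Lemma linear_funD u v : L (u + v) = L u + L v.
Proof. by have := lL 1 u v; rewrite !scale1r. Qed.

Lemma linear_fun0 : L 0 = 0.
Proof. by apply: (@addrI _ (L 0)); rewrite -linear_funD !addr0. Qed.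

Lemma linear_funZ k u : L (k *: u) = k *: L u.
Proof. by have := lL k u 0; rewrite linear_fun0 !addr0. Qed.

Lemma linear_funN u : L (- u) = - L u.
Proof. by rewrite -scaleN1r linear_funZ scaleN1r. Qed.

Lemma linear_fun_sum I (r : seq I) (F : I -> V) :
  L (\sum_(i <- r) F i) = \sum_(i <- r) L (F i).
Proof.
elim: r => [|i r IH]; first by rewrite !big_nil linear_fun0.
by rewrite !big_cons linear_funD IH.
Qed.

End LinearFunctions.

(** * Calculus *)

Section Calculus.
Context {R : realType}.

Section ProductRule.
Context {V W : normedModType R}.

Lemma scale_is_bilinear : bilinear_for
  (GRing.Scale.Law.clone _ _ *:%R _) (GRing.Scale.Law.clone _ _ *:%R _)
  (fun (k : R) (w : W) => k *: w).
Proof.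
split=> [w|k] a x y /=; first by rewrite scalerDl scalerA.
by rewrite scalerDr !scalerA mulrC.
Qed.

(** Scalar multiplication is a continuous bilinear map, so this is the chain rule for it after the
    pair [(k, f)]. *)
Lemma is_diff_scale (k : V -> R) (f : V -> W) x :
  differentiable k x -> differentiable f x ->
  is_diff x (fun y => k y *: f y) (fun v => k x *: 'd f x v + 'd k x v *: f x).
Proof.
move=> dk df.
pose B : {bilinear R -> W -> W} := HB.pack (fun (k : R) (w : W) => k *: w)
  (bilinear_isBilinear.Build R R W W _ _ _ scale_is_bilinear).
have cB : continuous (fun p : R * W => B p.1 p.2) by move=> p; exact: scale_continuous.
have dp : is_diff x (fun y => (k y, f y)) (fun v => ('d k x v, 'd f x v)).
  by apply: is_diff_pair; exact: differentiableP.
have dB : is_diff (k x, f x) (fun p : R * W => B p.1 p.2)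
    (fun q => B (k x) q.2 + B q.1 (f x)).
  by apply: DiffDef; [exact: differentiable_bilin|exact: diff_bilin].
exact: (is_diff_comp dp dB).
Qed.

Lemma derive_scale (k : V -> R) (f : V -> W) x v :
  differentiable k x -> differentiable f x ->
  'D_v (fun y => k y *: f y) x = k x *: 'D_v f x + 'D_v k x *: f x.
Proof.
move=> dk df; have d := is_diff_scale dk df.
rewrite deriveE; last exact: ex_diff.
by rewrite diff_val !deriveE.
Qed.

Lemma differentiable_scale (k : V -> R) (f : V -> W) x :
  differentiable k x -> differentiable f x ->
  differentiable (fun y => k y *: f y) x.
Proof. by move=> dk df; have d := is_diff_scale dk df; exact: ex_diff. Qed.

Lemma linear_row_expand k (A : 'rV[R]_k -> W) (u : 'rV[R]_k) :
  linear A -> A u = \sum_(i < k) u 0 i *: A 'e_i.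
Proof.
move=> lA; pose L : {linear 'rV[R]_k -> W} :=
  HB.pack A (GRing.isLinear.Build _ _ _ _ A lA).
rewrite -[A]/(L : _ -> _) {1}(row_sum_delta u) linear_sum.
by apply: eq_bigr => i _; rewrite linearZ.
Qed.

Lemma differentiable_sumf k (f : 'I_k -> V -> W) x :
  (forall i, differentiable (f i) x) ->
  differentiable (fun y => \sum_(i < k) f i y) x.
Proof.
move=> df; have -> : (fun y => \sum_(i < k) f i y) = \sum_(i < k) f i.
  by apply/funext => y; rewrite fct_sumE.
exact: differentiable_sum.
Qed.

Lemma derive_sumf k (f : 'I_k -> V -> W) x v :
  (forall i, differentiable (f i) x) ->
  'D_v (fun y => \sum_(i < k) f i y) x = \sum_(i < k) 'D_v (f i) x.
Proof.
move=> df; have -> : (fun y => \sum_(i < k) f i y) = \sum_(i < k) f i.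
  by apply/funext => y; rewrite fct_sumE.
by rewrite derive_sum // => i; exact: diff_derivable.
Qed.

Section LinearFamily.
Context {k : nat} (A : V -> 'rV[R]_k -> W) (X : V -> 'rV[R]_k) (x : V).
Hypotheses (lA : forall y, linear (A y))
  (dA : forall u, differentiable (fun y => A y u) x) (dX : differentiable X x).

Let expand : (fun y => A y (X y)) = (fun y => \sum_(i < k) X y 0 i *: A y 'e_i).
Proof. by apply/funext => y; exact: linear_row_expand. Qed.

Let dXi i : differentiable (fun y => X y 0 i : R) x.
Proof.
exact: (differentiable_comp dX (differentiable_coord (X x) 0 i)).
Qed.

Lemma differentiable_linear_family : differentiable (fun y => A y (X y)) x.
Proof.
by rewrite expand; apply: differentiable_sumf => i; exact: differentiable_scale.
Qed.

(** Expanding [X y] in the standard basis turns [A y (X y)] into a finite sum of scalar products, so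
    it suffices that [A] be differentiable at each fixed argument; no norm on a space of linear maps
    enters. *)
Lemma derive_linear_family v :
  'D_v (fun y => A y (X y)) x = 'D_v (fun y => A y (X x)) x + A x ('D_v X x).
Proof.
have E : (fun y => A y (X x)) = (fun y => \sum_(i < k) X x 0 i *: A y 'e_i).
  by apply/funext => y; exact: linear_row_expand.
rewrite expand E !derive_sumf; first last.
- by move=> i; exact: differentiable_scale.
- by move=> i; exact: differentiable_scale (differentiable_cst _ _) (dA _).
rewrite (linear_row_expand ('D_v X x) (lA x)) -big_split /=.
apply: eq_bigr => i _; rewrite derive_scale // derive_scale //.
rewrite derive_cst scale0r addr0; congr (_ + _ *: _).
by rewrite derive_mx ?mxE //; exact: diff_derivable.
Qed.

End LinearFamily.
End ProductRule.

Lemma derive_linear {V V' : normedModType R} (L : {linear V -> V'}) (x v : V) :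
  continuous L -> 'D_v L x = L v.
Proof.
by move=> cL; rewrite deriveE ?diff_lin //; exact: linear_differentiable.
Qed.

Lemma derive_comp {V V' W : normedModType R} (f : V -> V') (h : V' -> W) x v :
  differentiable f x -> differentiable h (f x) ->
  'D_v (h \o f) x = 'D_('D_v f x) h (f x).
Proof.
move=> df dh; rewrite (deriveE _ dh) (deriveE _ df).
by rewrite (deriveE _ (differentiable_comp df dh)) (diff_comp df dh).
Qed.

Lemma derive_dir_linear {V W : normedModType R} (f : V -> W) x :
  differentiable f x -> linear (fun v => 'D_v f x).
Proof. by move=> df k u v; rewrite !(deriveE _ df) linearP. Qed.

End Calculus.

(** * Smoothness of products and compositions *)

Section SmoothComposition.
Context {R : realType}.

(** The finite-order stages of [smooth]. A derivative of a product or a composite is a sum of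
    products in which the original functions reappear, so the inductions run on the order and not on
    a list of directions. *)
Fixpoint cdiff {V W : normedModType R} (k : nat) (U : set V) (f : V -> W) : Prop :=
  (forall x, U x -> differentiable f x) /\
  (if k is k'.+1 then forall v, cdiff k' U ('D_v f) else True).

Lemma cdiff0 {V W : normedModType R} k (U : set V) (f : V -> W) x :
  cdiff k U f -> U x -> differentiable f x.
Proof. by case: k => [|k] [df _]; exact: df. Qed.

Lemma cdiff_smoothP {V W : normedModType R} (U : set V) (f : V -> W) :
  smooth U f <-> forall k, cdiff k U f.
Proof.
split=> [sf k|cf].
  elim: k f sf => [|k IH] f sf; (split=> [x Ux|//]; first exact: smooth_differentiable sf Ux).
  by move=> v; exact/IH/smooth_derive.
move=> s x Ux; move: (cf (size s)) => {cf}.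
elim/last_ind: s f => [|s v IH] f cf.
  exact: (cdiff0 cf Ux).
by rewrite iter_derive_rcons; apply: IH; move: cf; rewrite size_rcons => -[_]; apply.
Qed.

Lemma cdiffW {V W : normedModType R} k (U : set V) (f : V -> W) :
  cdiff k.+1 U f -> cdiff k U f.
Proof.
elim: k f => [|k IH] f; first by case.
by move=> [df cf]; split => // v; exact/IH/cf.
Qed.

Lemma cdiff_eq {V W : normedModType R} k (U : set V) (f g : V -> W) : open U ->
  (forall x, U x -> f x = g x) -> cdiff k U f -> cdiff k U g.
Proof.
move=> oU; elim: k f g => [|k IH] f g fg [df cf];
    (split=> [x Ux|//]; first apply: near_eq_differentiable (df x Ux));
    try by near do apply: fg; exact: open_nbhs_nbhs.
move=> v; apply: IH (cf v) => x Ux; apply: near_eq_derive.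
by near do apply: fg; exact: open_nbhs_nbhs.
Unshelve. all: by end_near. Qed.

Lemma cdiffD {V W : normedModType R} k (U : set V) (f g : V -> W) : open U ->
  cdiff k U f -> cdiff k U g -> cdiff k U (fun x => f x + g x).
Proof.
move=> oU; elim: k f g => [|k IH] f g [df cf] [dg cg]; (split=> [x Ux|//];
  first by apply: (@differentiableD _ _ _ f g); [exact: df|exact: dg]).
move=> v; apply: (cdiff_eq oU _ (IH _ _ (cf v) (cg v))) => x Ux.
by rewrite (@deriveD _ _ _ f g) //; apply: diff_derivable; [exact: df|exact: dg].
Qed.

Lemma cdiff_cst {V W : normedModType R} k (U : set V) (c : W) :
  cdiff k U (fun _ : V => c).
Proof. by move: k; apply/cdiff_smoothP; exact: smooth_cst. Qed.

Lemma cdiff_sum {V W : normedModType R} k (U : set V) m (f : 'I_m -> V -> W) :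
  open U -> (forall i, cdiff k U (f i)) -> cdiff k U (fun x => \sum_(i < m) f i x).
Proof.
move=> oU; elim: m f => [|m IH] f cf.
  by apply: (cdiff_eq oU _ (cdiff_cst k U 0)) => x _; rewrite big_ord0.
apply: (cdiff_eq oU _ (cdiffD oU (IH _ (fun i => cf (widen_ord (leqnSn m) i))) (cf ord_max))).
by move=> x _; rewrite big_ord_recr.
Qed.

Lemma cdiff_scale {V W : normedModType R} k (U : set V) (c : V -> R) (f : V -> W) :
  open U -> cdiff k U c -> cdiff k U f -> cdiff k U (fun x => c x *: f x).
Proof.
move=> oU; elim: k c f => [|k IH] c f cc cf; (split=> [x Ux|//];
  first by apply: differentiable_scale; [exact: cdiff0 cc Ux|exact: cdiff0 cf Ux]).
move=> v; have cc' := cdiffW cc; have cf' := cdiffW cf.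
have [[_ c1] [_ f1]] := (cc, cf).
apply: (cdiff_eq oU _ (cdiffD oU (IH _ _ cc' (f1 v)) (IH _ _ (c1 v) cf'))).
by move=> x Ux; rewrite derive_scale //; [exact: cdiff0 cc Ux|exact: cdiff0 cf Ux].
Qed.

Lemma cdiff_coord {V : normedModType R} k m (U : set V) (f : V -> 'rV[R]_m) j :
  open U -> cdiff k U f -> cdiff k U (fun x => f x 0 j : R).
Proof.
move=> oU; elim: k f => [|k IH] f [df cf]; (split=> [x Ux|//];
  first exact: (differentiable_comp (df x Ux) (differentiable_coord (f x) 0 j))).
move=> v; apply: (cdiff_eq oU _ (IH _ (cf v))) => x Ux.
by rewrite derive_mx ?mxE //; exact/diff_derivable/df.
Qed.

(** By the chain rule the derivative is the sum over [j] of the [j]-th component of ['D_v f] times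
    ['D_('e_j) h \o f]. The second factor is again a composite with [f], one order lower, so the
    induction generalizes over [h]. *)
Lemma cdiff_comp {V W : normedModType R} k m (U : set V) (U' : set 'rV[R]_m)
    (f : V -> 'rV[R]_m) (h : 'rV[R]_m -> W) : open U ->
  (forall x, U x -> U' (f x)) -> cdiff k U f -> cdiff k U' h -> cdiff k U (h \o f).
Proof.
move=> oU fU; elim: k f h fU => [|k IH] f h fU cf ch;
  (have dhf x : U x -> differentiable (h \o f) x by move=> Ux;
    apply: differentiable_comp; [exact: cdiff0 cf Ux|exact: cdiff0 ch (fU _ Ux)]).
  by split.
split=> // v; have cf' := cdiffW cf.
have [[_ f1] [_ h1]] := (cf, ch).
have C : cdiff k U (fun x => \sum_(j < m) ('D_v f x 0 j : R) *: ('D_('e_j) h \o f) x).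
  apply: cdiff_sum => // j; apply: cdiff_scale => //.
  - exact: (cdiff_coord _ oU (f1 v)).
  - exact: (IH _ _ fU cf' (h1 _)).
apply: (cdiff_eq oU _ C) => x Ux.
have dh : differentiable h (f x) by exact: cdiff0 ch (fU _ Ux).
rewrite (derive_comp _ (cdiff0 cf Ux) dh).
exact: (esym (linear_row_expand ('D_v f x) (derive_dir_linear dh))).
Qed.

Lemma smooth_comp {V W : normedModType R} m (U : set V) (U' : set 'rV[R]_m)
    (f : V -> 'rV[R]_m) (h : 'rV[R]_m -> W) : open U ->
  (forall x, U x -> U' (f x)) -> smooth U f -> smooth U' h -> smooth U (h \o f).
Proof.
move=> oU fU /cdiff_smoothP sf /cdiff_smoothP sh; apply/cdiff_smoothP => k.
exact: cdiff_comp (fU) _ _.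
Qed.

Lemma smooth_scale {V W : normedModType R} (U : set V) (c : V -> R) (f : V -> W) :
  open U -> smooth U c -> smooth U f -> smooth U (fun x => c x *: f x).
Proof.
move=> oU /cdiff_smoothP sc /cdiff_smoothP sf; apply/cdiff_smoothP => k.
exact: cdiff_scale.
Qed.

Lemma smooth_linear_family {V W : normedModType R} m (U : set V)
    (A : V -> 'rV[R]_m -> W) (X : V -> 'rV[R]_m) : open U ->
  (forall x, linear (A x)) -> (forall u, smooth U (fun x => A x u)) ->
  smooth U X -> smooth U (fun x => A x (X x)).
Proof.
move=> oU lA sA sX.
rewrite (_ : (fun _ => _) = (fun x => \sum_(j < m) (X x 0 j : R) *: A x 'e_j)).
  by apply: smooth_sum => // j; apply: smooth_scale => //; exact: smooth_coord.
by apply/funext => x; exact: linear_row_expand.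
Qed.

End SmoothComposition.

(** * Symmetry of second derivatives *)

Section Schwarz.
Context {R : realType} {V : normedModType R}.
Implicit Types (f : V -> R) (U : set V) (u v x : V).

Lemma derivable_line f x v t : differentiable f (x + t *: v) ->
  is_derive t 1 (fun s : R => f (x + s *: v)) ('D_v f (x + t *: v)).
Proof.
move=> df.
have ds : differentiable ( *:%R^~ v : R -> V) t by exact: ex_diff.
have dl : differentiable (fun s : R => x + s *: v) t.
  apply: (@differentiableD R R V (cst x) ( *:%R^~ v)) => //.
have E : 'D_1 (fun s : R => x + s *: v) t = v.
  rewrite (@deriveD R R V (cst x) ( *:%R^~ v)) ?derive_cst ?add0r //.
    by rewrite deriveE // diff_val scale1r.
  exact: diff_derivable.
have dc : differentiable (f \o (fun s : R => x + s *: v)) t by exact: differentiable_comp.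
apply: DeriveDef; first exact: diff_derivable.
by rewrite [LHS](@derive_comp _ R _ _ _ _ _ 1 dl df) E.
Qed.

Lemma mvt_line f x v (h : R) : 0 < h ->
  (forall t, 0 <= t <= h -> differentiable f (x + t *: v)) ->
  exists2 t, 0 <= t <= h & f (x + h *: v) - f x = h * 'D_v f (x + t *: v).
Proof.
move=> h0 df.
have [t||t th E] := @MVT _ (fun s : R => f (x + s *: v)) (fun s => 'D_v f (x + s *: v)) 0 h h0.
- by rewrite in_itv /= => /andP[t0 th]; apply/derivable_line/df; rewrite !ltW.
- apply: derivable_within_continuous => t; rewrite in_itv /= => /df dt.
  by have [] := derivable_line dt.
exists t; first by move: th; rewrite in_itv /= => /andP[t0 th]; rewrite !ltW.
by move: E; rewrite scale0r addr0 subr0 mulrC.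
Qed.

(** Two applications of the mean value theorem: to the increment [F y = f (y + h *: v) - f y] along
    [u], and then to ['D_u f] along [v]. *)
Lemma second_difference f U x u v (h : R) : 0 < h ->
  (forall s t, 0 <= s <= h -> 0 <= t <= h -> U (x + s *: u + t *: v)) ->
  (forall y, U y -> differentiable f y) ->
  (forall y, U y -> differentiable ('D_u f) y) ->
  exists s t, [/\ 0 <= s <= h, 0 <= t <= h &
    f (x + h *: u + h *: v) - f (x + h *: u) - (f (x + h *: v) - f x) =
    h * (h * 'D_v ('D_u f) (x + s *: u + t *: v))].
Proof.
move=> h0 Ux df duf.
have hh : 0 <= h <= h by rewrite lexx ltW.
have h00 : (0 : R) <= 0 <= h by rewrite lexx ltW.
pose F y := f (y + h *: v) - f y.
have dshift y : differentiable (fun z : V => z + h *: v) y.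
  by apply: (@differentiableD R V V id (cst (h *: v))).
have shf y : differentiable f (y + h *: v) -> differentiable (fun z => f (z + h *: v)) y.
  move=> dy; apply: (@differentiable_comp _ _ _ _ (fun z => z + h *: v) f); last exact: dy.
  exact: dshift.
have dF y : differentiable f (y + h *: v) -> differentiable f y -> differentiable F y.
  by move=> d1 d2; apply: (@differentiableB R V R (fun z => f (z + h *: v)) f) => //; exact: shf.
have DF y : differentiable f (y + h *: v) -> differentiable f y ->
    'D_u F y = 'D_u f (y + h *: v) - 'D_u f y.
  move=> d1 d2; rewrite (@deriveB R V R (fun z => f (z + h *: v)) f); last 2 first.
  - exact/diff_derivable/shf.
  - exact: diff_derivable.
  congr (_ - _); rewrite [LHS](@derive_comp _ V V R (fun z => z + h *: v) f y u (dshift y) d1).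
  by rewrite (@deriveD R V V id (cst (h *: v))) // derive_id derive_cst addr0.
have Ux0 s : 0 <= s <= h -> U (x + s *: u).
  by move=> sh; have := Ux s 0 sh h00; rewrite scale0r addr0.
have [s sh] : exists2 s, 0 <= s <= h & F (x + h *: u) - F x = h * 'D_u F (x + s *: u).
  by apply: (@mvt_line F x u h h0) => s sh; apply: dF; apply: df; [exact: Ux|exact: Ux0].
rewrite DF; [|by apply/df/Ux|by apply/df/Ux0].
have [t th ->] : exists2 t, 0 <= t <= h &
    'D_u f (x + s *: u + h *: v) - 'D_u f (x + s *: u) =
    h * 'D_v ('D_u f) (x + s *: u + t *: v).
  by apply: (@mvt_line ('D_u f) (x + s *: u) v h h0) => t th; apply/duf/Ux.
by move=> E; exists s, t; split.
Qed.

(** The second difference is symmetric in [u] and [v], and equals [h ^ 2] times either mixed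
    derivative at some point of a small parallelogram; continuity of both mixed derivatives at [x]
    concludes. *)
Theorem schwarz f U x u v : open U -> U x -> smooth U f ->
  'D_v ('D_u f) x = 'D_u ('D_v f) x.
Proof.
move=> oU Ux sf.
have close (a b : V) (e : R) : 0 < e -> exists2 d : R, 0 < d &
    forall s t, 0 <= s <= d -> 0 <= t <= d ->
    U (x + s *: a + t *: b) /\
    `|'D_b ('D_a f) x - 'D_b ('D_a f) (x + s *: a + t *: b)| < e.
  move=> e0.
  have c : {for x, continuous ('D_b ('D_a f))}.
    by apply/differentiable_continuous/smooth_differentiable/Ux; do 2 apply: smooth_derive.
  have [r /= r0 Hr] : nbhs_ball x (fun y => U y /\ `|'D_b ('D_a f) x - 'D_b ('D_a f) y| < e).
    apply/nbhs_ballP; apply: filterI; first exact: open_nbhs_nbhs.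
    by move/cvgrPdist_lt : c; apply.
  (* The summand 1 keeps [k] positive when both directions vanish; with [d = r / (2 k)] every
     displacement has norm at most [d k = r / 2]. *)
  pose k := `|a| + `|b| + 1.
  have k0 : 0 < k by rewrite ltr_wpDl // addr_ge0.
  have [d d0 dE] : exists2 d : R, 0 < d & d * k < r.
    exists (r / (2 * k)); first by rewrite divr_gt0 // mulr_gt0.
    by rewrite invfM mulrA mulfVK ?gt_eqF // ltr_pdivrMr // mulr_natr mulr2n ltrDl.
  exists d => // s t /andP[s0 sd] /andP[t0 td]; apply: Hr.
  rewrite -ball_normE /= -addrA opprD addNKr normrN (le_lt_trans _ dE) //.
  rewrite (le_trans (ler_normD _ _)) // !normrZ !ger0_norm //.
  rewrite (@le_trans _ _ (d * `|a| + d * `|b|)) ?lerD ?ler_wpM2r //.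
  by rewrite /k !mulrDr mulr1 lerDl ltW.
apply/eqP; rewrite -subr_eq0 -normr_eq0 eq_le normr_ge0 andbT.
apply/ler_addgt0Pl => e e0; rewrite addr0.
have e2 : 0 < e / 2 by rewrite divr_gt0.
have [d1 d10 H1] := close u v _ e2; have [d2 d20 H2] := close v u _ e2.
pose h := Num.min d1 d2.
have h0 : 0 < h by rewrite lt_min d10.
have hd1 s : 0 <= s <= h -> 0 <= s <= d1.
  by move=> /andP[-> sh]; rewrite (le_trans sh) // ge_min lexx.
have hd2 s : 0 <= s <= h -> 0 <= s <= d2.
  by move=> /andP[-> sh]; rewrite (le_trans sh) // ge_min lexx orbT.
have [|y Uy|y Uy|s [t [sh th E1]]] := @second_difference f U x u v h h0.
- by move=> s t sh th; have [] := H1 s t (hd1 _ sh) (hd1 _ th).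
- exact: smooth_differentiable sf Uy.
- exact: smooth_differentiable (smooth_derive _ sf) Uy.
have [|y Uy|y Uy|s' [t' [sh' th' E2]]] := @second_difference f U x v u h h0.
- by move=> a b ah bh; have [] := H2 a b (hd2 _ ah) (hd2 _ bh).
- exact: smooth_differentiable sf Uy.
- exact: smooth_differentiable (smooth_derive _ sf) Uy.
(* Both sides multiplied by [h] twice are the same second difference, because its far corner does
   not depend on the order of [u] and [v]. *)
have E : 'D_v ('D_u f) (x + s *: u + t *: v) = 'D_u ('D_v f) (x + s' *: v + t' *: u).
  have hN : h != 0 by rewrite gt_eqF.
  have P : x + h *: u + h *: v = x + h *: v + h *: u by rewrite addrAC.
  rewrite P in E1; move: E1 E2.
  move: (f (x + h *: v + h *: u)) (f (x + h *: v)) (f (x + h *: u)) (f x).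
  move: ('D_v _ _) ('D_u _ _) => A B a b c d E1 E2.
  by apply: (mulfI hN); apply: (mulfI hN); rewrite -E1 -E2; ring.
have [_ n1] := H1 s t (hd1 _ sh) (hd1 _ th).
have [_ n2] := H2 s' t' (hd2 _ sh') (hd2 _ th').
rewrite E in n1; rewrite distrC in n2.
move: n1 n2; move: ('D_v _ _) ('D_u _ _) ('D_u _ _) => A B C n1 n2.
rewrite -(subrKA C); apply: le_trans (ler_normD _ _) _.
by rewrite [leRHS](splitr e); apply: lerD; [exact: (ltW n1)|exact: (ltW n2)].
Qed.

End Schwarz.

Lemma schwarz_row {R : realType} {V : normedModType R} {k : nat}
    (f : V -> 'rV[R]_k) (U : set V) (x u v : V) : open U -> U x -> smooth U f ->
  'D_v ('D_u f) x = 'D_u ('D_v f) x.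
Proof.
move=> oU Ux sf; apply/rowP => j.
have E (a b : V) : 'D_b ('D_a f) x 0 j = 'D_b ('D_a (fun y => f y 0 j : R)) x.
  rewrite derive_mx ?mxE; last first.
    by apply/diff_derivable/smooth_differentiable/Ux; exact: smooth_derive.
  apply: near_eq_derive; near=> y.
  rewrite derive_mx ?mxE //; apply/diff_derivable/(smooth_differentiable sf).
  by near: y; exact: open_nbhs_nbhs.
have S := @schwarz R V (fun y => f y 0 j) U x u v oU Ux (smooth_coord j oU sf).
exact: (etrans (E u v) (etrans S (esym (E v u)))).
Unshelve. all: by end_near. Qed.

(** * Bilinear maps and families of bilinear maps *)

Section BilinearMaps.
Context {R : pzRingType} {U U' W : lmodType R}.
Implicit Types (b : U -> U' -> W).

Definition bilin b : Prop := (forall v, linear (b^~ v)) /\ (forall u, linear (b u)).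

Context {b} (hb : bilin b).

Lemma bilin_Pl k u u' v : b (k *: u + u') v = k *: b u v + b u' v.
Proof. exact: hb.1. Qed.

Lemma bilin_Pr k u v v' : b u (k *: v + v') = k *: b u v + b u v'.
Proof. exact: hb.2. Qed.

Lemma bilin_Dl u u' v : b (u + u') v = b u v + b u' v.
Proof. by have := bilin_Pl 1 u u' v; rewrite !scale1r. Qed.

Lemma bilin_Dr u v v' : b u (v + v') = b u v + b u v'.
Proof. by have := bilin_Pr 1 u v v'; rewrite !scale1r. Qed.

Lemma bilin_0l v : b 0 v = 0.
Proof. by apply: (@addrI _ (b 0 v)); rewrite -bilin_Dl !addr0. Qed.

Lemma bilin_0r u : b u 0 = 0.
Proof. by apply: (@addrI _ (b u 0)); rewrite -bilin_Dr !addr0. Qed.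

Lemma bilin_Zl k u v : b (k *: u) v = k *: b u v.
Proof. by have := bilin_Pl k u 0 v; rewrite bilin_0l !addr0. Qed.

Lemma bilin_Zr k u v : b u (k *: v) = k *: b u v.
Proof. by have := bilin_Pr k u v 0; rewrite bilin_0r !addr0. Qed.

Lemma bilin_Nl u v : b (- u) v = - b u v.
Proof. by rewrite -scaleN1r bilin_Zl scaleN1r. Qed.

Lemma bilin_Nr u v : b u (- v) = - b u v.
Proof. by rewrite -scaleN1r bilin_Zr scaleN1r. Qed.

Lemma bilin_suml I (r : seq I) (F : I -> U) v :
  b (\sum_(i <- r) F i) v = \sum_(i <- r) b (F i) v.
Proof.
elim: r => [|i r IH]; first by rewrite !big_nil bilin_0l.
by rewrite !big_cons bilin_Dl IH.
Qed.

Lemma bilin_sumr I (r : seq I) u (F : I -> U') :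
  b u (\sum_(i <- r) F i) = \sum_(i <- r) b u (F i).
Proof.
elim: r => [|i r IH]; first by rewrite !big_nil bilin_0r.
by rewrite !big_cons bilin_Dr IH.
Qed.

Definition bilinE := (bilin_Dl, bilin_Dr, bilin_Nl, bilin_Nr, bilin_0l, bilin_0r).

End BilinearMaps.

Section Families.
Context {R : realType} {V W : normedModType R} {k l : nat}.
Context (B : V -> 'rV[R]_k -> 'rV[R]_l -> W) (bB : forall p, bilin (B p)).

(** The arguments [u] and [v] are frozen and only the base point moves in the direction [w]: for the
    coordinate expression of a tensor, these are the partial derivatives of its coefficients. *)
Definition dfam (p w : V) (u : 'rV[R]_k) (v : 'rV[R]_l) : W :=
  'D_w (fun q => B q u v) p.

Section Point.
Context (p : V) (dB : forall u v, differentiable (fun q => B q u v) p).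

Lemma differentiable_bilin_family (X : V -> 'rV[R]_k) (Y : V -> 'rV[R]_l) :
  differentiable X p -> differentiable Y p -> differentiable (fun q => B q (X q) (Y q)) p.
Proof.
move=> dX dY; apply: (@differentiable_linear_family _ _ _ _ (fun q u => B q u (Y q)) X) => //.
  by move=> q; exact: (bB q).1.
move=> u; apply: (@differentiable_linear_family _ _ _ _ (fun q v => B q u v) Y) => //.
by move=> q; exact: (bB q).2.
Qed.

Lemma derive_bilin_family (X : V -> 'rV[R]_k) (Y : V -> 'rV[R]_l) w :
  differentiable X p -> differentiable Y p ->
  'D_w (fun q => B q (X q) (Y q)) p =
  dfam p w (X p) (Y p) + B p ('D_w X p) (Y p) + B p (X p) ('D_w Y p).
Proof.
move=> dX dY.
have dBY u : differentiable (fun q => B q u (Y q)) p.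
  apply: (@differentiable_linear_family _ _ _ _ (fun q v => B q u v) Y) => //.
  by move=> q; exact: (bB q).2.
rewrite (@derive_linear_family _ _ _ _ (fun q u => B q u (Y q)) X p _ dBY dX); last first.
  by move=> q; exact: (bB q).1.
rewrite (@derive_linear_family _ _ _ _ (fun q v => B q (X p) v) Y p _ _ dY) //; last first.
  by move=> q; exact: (bB q).2.
by rewrite addrAC.
Qed.

Lemma dfam_bilin w : bilin (dfam p w).
Proof.
split=> [v|u] c a a'; rewrite /dfam.
  have -> : (fun q => B q (c *: a + a') v) = (c \*: (fun q => B q a v)) + (fun q => B q a' v).
    by apply/funext => q; rewrite (bilin_Pl (bB q)).
  rewrite deriveD ?deriveZ //; try exact: diff_derivable.
  exact/derivableZ/diff_derivable.
have -> : (fun q => B q u (c *: a + a')) = (c \*: (fun q => B q u a)) + (fun q => B q u a').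
  by apply/funext => q; rewrite (bilin_Pr (bB q)).
rewrite deriveD ?deriveZ //; try exact: diff_derivable.
exact/derivableZ/diff_derivable.
Qed.

Lemma dfam_linear u v : linear (fun w => dfam p w u v).
Proof. exact: derive_dir_linear. Qed.

End Point.

Lemma smooth_bilin_family (U : set V) (X : V -> 'rV[R]_k) (Y : V -> 'rV[R]_l) :
  open U -> (forall u v, smooth U (fun q => B q u v)) -> smooth U X -> smooth U Y ->
  smooth U (fun q => B q (X q) (Y q)).
Proof.
move=> oU sB sX sY; apply: (@smooth_linear_family _ _ _ _ _ (fun q u => B q u (Y q))) => //.
  by move=> q; exact: (bB q).1.
move=> u; apply: (@smooth_linear_family _ _ _ _ _ (fun q v => B q u v)) => //.
by move=> q; exact: (bB q).2.
Qed.

End Families.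

Lemma differentiable_row_mx {R : realType} {V : normedModType R} k l
    (f : V -> 'rV[R]_k) (h : V -> 'rV[R]_l) x :
  differentiable f x -> differentiable h x ->
  differentiable (fun y => row_mx (f y) (h y)) x.
Proof.
move=> df dh.
have dc j (F : V -> 'rV[R]_j) i : differentiable F x -> differentiable (fun y => F y 0 i : R) x.
  by move=> dF; exact: (differentiable_comp dF (differentiable_coord (F x) 0 i)).
apply: rV_differentiable => j; case: (split_ordP j) => i ->.
  by under eq_fun do rewrite row_mxEl; exact: dc.
by under eq_fun do rewrite row_mxEr; exact: dc.
Qed.

Lemma derive_row_mx {R : realType} {V : normedModType R} k l
    (f : V -> 'rV[R]_k) (h : V -> 'rV[R]_l) x v :
  differentiable f x -> differentiable h x ->
  'D_v (fun y => row_mx (f y) (h y)) x = row_mx ('D_v f x) ('D_v h x).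
Proof.
move=> df dh.
have dr := differentiable_row_mx df dh.
apply/rowP => j; rewrite (derive_mx (diff_derivable dr)) mxE.
case: (split_ordP j) => i ->.
  under eq_fun do rewrite row_mxEl.
  by rewrite row_mxEl (derive_mx (diff_derivable df)) mxE.
under eq_fun do rewrite row_mxEr.
by rewrite row_mxEr (derive_mx (diff_derivable dh)) mxE.
Qed.

Lemma smooth_row_mx {R : realType} {V : normedModType R} k l (U : set V)
    (f : V -> 'rV[R]_k) (h : V -> 'rV[R]_l) : open U ->
  smooth U f -> smooth U h -> smooth U (fun y => row_mx (f y) (h y)).
Proof.
move=> oU sf sh; apply: smooth_rV => // j; case: (split_ordP j) => i ->.
  by under eq_fun do rewrite row_mxEl; exact: (smooth_coord i oU sf).
by under eq_fun do rewrite row_mxEr; exact: (smooth_coord i oU sh).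
Qed.

(** * Tensors in one chart *)

Section CoordinateCurvature.
Context {R : realType} {n : nat}.
Implicit Types (B : 'rV[R]_n -> 'rV[R]_n -> 'rV[R]_n -> 'rV[R]_n) (p u v w y : 'rV[R]_n).

(** Torsion and curvature evaluated on fields with constant components: their brackets vanish, and
    [B p u v] is the whole covariant derivative of [v] along [u]. *)
Definition ctorsion B p u v : 'rV[R]_n := B p u v - B p v u.

Definition ccurv B p u v y : 'rV[R]_n :=
  dfam B p u v y - dfam B p v u y + B p u (B p v y) - B p v (B p u y).

Section Duality.
Context (O : set 'rV[R]_n) (oO : open O).
Context (G : 'rV[R]_n -> 'rV[R]_n -> 'rV[R]_n -> R) (B Bs : 'rV[R]_n -> 'rV[R]_n -> 'rV[R]_n -> 'rV[R]_n).
Hypothesis bG : forall p, bilin (G p).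
Hypotheses (sG : forall u v, smooth O (fun p => G p u v))
  (sB : forall u v, smooth O (fun p => B p u v)) (sBs : forall u v, smooth O (fun p => Bs p u v)).
Hypothesis dual : forall p u v w, O p ->
  dfam G p w u v = G p (Bs p w u) v + G p u (B p w v).

Let dG p u v : O p -> differentiable (fun q => G q u v) p.
Proof. exact: smooth_differentiable. Qed.
Let dB p u v : O p -> differentiable (fun q => B q u v) p.
Proof. exact: smooth_differentiable. Qed.
Let dBs p u v : O p -> differentiable (fun q => Bs q u v) p.
Proof. exact: smooth_differentiable. Qed.

(** Differentiate [G(a, y)] along [v] and then [u] by duality, and exchange the two. The second
    derivatives agree by [schwarz], the products [G(Bs v a, B u y) + G(Bs u a, B v y)] are
    symmetric, and what remains is the two curvatures. *)
Lemma ccurv_dual p u v a y : O p ->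
  G p (ccurv Bs p u v a) y = - G p a (ccurv B p u v y).
Proof.
move=> Op.
have second u' v' : 'D_u' ('D_v' (fun q => G q a y)) p =
    dfam G p u' (Bs p v' a) y + G p (dfam Bs p u' v' a) y +
    (dfam G p u' a (B p v' y) + G p a (dfam B p u' v' y)).
  have -> : 'D_u' ('D_v' (fun q => G q a y)) p =
      'D_u' ((fun q => G q (Bs q v' a) y) + (fun q => G q a (B q v' y))) p.
    apply: near_eq_derive; near=> q; apply: dual.
    by near: q; exact: open_nbhs_nbhs.
  have d1 : differentiable (fun q => G q (Bs q v' a) y) p.
    apply: (differentiable_bilin_family bG (fun u v => dG u v Op) (dBs v' a Op)).
    exact: differentiable_cst.
  have d2 : differentiable (fun q => G q a (B q v' y)) p.
    exact: (differentiable_bilin_family bG (fun u v => dG u v Op)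
      (differentiable_cst a p) (dB v' y Op)).
  rewrite (deriveD (diff_derivable d1) (diff_derivable d2)).
  rewrite (derive_bilin_family bG (fun u v => dG u v Op) u' (dBs v' a Op)
    (differentiable_cst y p)).
  rewrite (derive_bilin_family bG (fun u v => dG u v Op) u'
    (differentiable_cst a p) (dB v' y Op)).
  by rewrite /cst !derive_cst (bilin_0l (bG p)) (bilin_0r (bG p)) !addr0.
have := schwarz v u oO Op (sG a y).
move: (second u v) (second v u) => -> ->.
rewrite !dual // /ccurv !(bilinE (bG p)) => E.
lra.
Unshelve. all: by end_near. Qed.

Hypothesis tf : forall p u v, O p -> ctorsion Bs p u v = 0.

Lemma torsionless_dfam p w u v : O p -> dfam Bs p w u v = dfam Bs p w v u.
Proof.
move=> Op; apply: near_eq_derive; near=> q.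
apply/subr0_eq/tf; near: q; exact: open_nbhs_nbhs.
Unshelve. all: by end_near. Qed.

(** Once the symbols and their derivatives are symmetric in the lower arguments, every term of the
    cyclic sum occurs twice with opposite signs. *)
Lemma bianchi p u v w : O p ->
  ccurv Bs p u v w + ccurv Bs p v w u + ccurv Bs p w u v = 0.
Proof.
move=> Op; have C a b : Bs p a b = Bs p b a by apply/subr0_eq/tf.
rewrite /ccurv (torsionless_dfam u w v Op) (torsionless_dfam v w u Op)
  (torsionless_dfam w v u Op) (C w u) (C w v) (C v u).
move: (Bs p u (Bs p v w)) (Bs p v (Bs p u w)) (Bs p w (Bs p u v)).
move: (dfam Bs p _ _ _) (dfam Bs p _ _ _) (dfam Bs p _ _ _) => a b c d e f.
by apply/rowP => i; rewrite !mxE; ring.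
Qed.

(** [ccurv_dual] moves each curvature to the other argument, where the three terms form the cyclic
    sum of [bianchi] for [Bs]. The left-hand side is the curvature part of the derivative of the
    Kahler form. *)
Lemma bianchi_dual p u v w y : O p ->
  G p v (ccurv B p u w y) + G p w (ccurv B p v u y) + G p u (ccurv B p w v y) = 0.
Proof.
move=> Op; apply: oppr_inj; rewrite oppr0 !opprD -!ccurv_dual // -!(bilin_Dl (bG p)).
have -> : ccurv Bs p u w v + ccurv Bs p v u w + ccurv Bs p w v u =
    ccurv Bs p u w v + ccurv Bs p w v u + ccurv Bs p v u w by rewrite addrAC.
by rewrite bianchi // (bilin_0l (bG p)).
Qed.

End Duality.
End CoordinateCurvature.

(** * The natural structure in induced coordinates *)

Section TangentCoordinates.
Context {R : realType} {n : nat}.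
Context (G : 'rV[R]_n -> 'rV[R]_n -> 'rV[R]_n -> R) (B : 'rV[R]_n -> 'rV[R]_n -> 'rV[R]_n -> 'rV[R]_n).
Implicit Types (z w u v : 'rV[R]_(n + n)).

(* At [z = (x, y)], [kap z] computes the components of the vertical part of a
   tangent vector of [TM], and [chor z e] those of the horizontal lift of [e]. *)
Definition kap z u : 'rV[R]_n := rsubmx u + B (lsubmx z) (lsubmx u) (rsubmx z).

Definition csasaki z u v : R :=
  G (lsubmx z) (lsubmx u) (lsubmx v) + G (lsubmx z) (kap z u) (kap z v).

(** This is the vertical lift of [lsubmx u] minus the horizontal lift of [kap z u]; the latter
    brings the [B] term into the second block. *)
Definition cJ z u : 'rV[R]_(n + n) :=
  row_mx (- kap z u) (lsubmx u + B (lsubmx z) (kap z u) (rsubmx z)).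

Definition comega z u v : R :=
  G (lsubmx z) (lsubmx u) (kap z v) - G (lsubmx z) (kap z u) (lsubmx v).

Definition chor z (e : 'rV[R]_n) : 'rV[R]_(n + n) :=
  row_mx e (- B (lsubmx z) e (rsubmx z)).

(* The derivative of [kap] in the direction [w]; it only depends on the
   horizontal component of the argument. *)
Definition dkap z w (e : 'rV[R]_n) : 'rV[R]_n :=
  dfam B (lsubmx z) (lsubmx w) e (rsubmx z) + B (lsubmx z) e (rsubmx w).

Hypotheses (bG : forall p, bilin (G p)) (bB : forall p, bilin (B p)).

Lemma kap_linear z : linear (kap z).
Proof.
move=> k u v; rewrite /kap !linearP /= (bilin_Pl (bB _)).
by rewrite scalerDr addrACA.
Qed.

Lemma kap_chor z e : kap z (chor z e) = 0.
Proof. by rewrite /kap /chor row_mxKl row_mxKr addNr. Qed.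

Lemma kap_ver z e : kap z (row_mx 0 e) = e.
Proof. by rewrite /kap row_mxKl row_mxKr (bilin_0l (bB _)) addr0. Qed.

Lemma chor_kap z u : u = chor z (lsubmx u) + row_mx 0 (kap z u).
Proof.
rewrite /chor /kap -[LHS]hsubmxK; apply/rowP => j.
by rewrite add_row_mx addr0 addrCA addNr addr0.
Qed.

Lemma csasaki_bilin z : bilin (csasaki z).
Proof.
split=> [v|u] k a b; rewrite /csasaki kap_linear linearP.
  by rewrite !(bilin_Pl (bG _)) scalerDr addrACA.
by rewrite !(bilin_Pr (bG _)) scalerDr addrACA.
Qed.

Lemma comega_bilin z : bilin (comega z).
Proof.
split=> [v|u] k a b; rewrite /comega kap_linear linearP.
  by rewrite !(bilin_Pl (bG _)) scalerBr opprD; exact: addrACA.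
by rewrite !(bilin_Pr (bG _)) scalerBr opprD; exact: addrACA.
Qed.

Lemma cJ_linear z : linear (cJ z).
Proof.
move=> k u v; rewrite /cJ kap_linear [lsubmx _]linearP (bilin_Pl (bB _)).
rewrite scale_row_mx add_row_mx; congr row_mx; first by rewrite opprD scalerN.
by rewrite scalerDr addrACA.
Qed.

Lemma lsubmx_cJ z u : lsubmx (cJ z u) = - kap z u.
Proof. by rewrite /cJ row_mxKl. Qed.

Lemma kap_cJ z u : kap z (cJ z u) = lsubmx u.
Proof. by rewrite /kap /cJ row_mxKl row_mxKr (bilin_Nl (bB _)) addrK. Qed.

(** The pair [(lsubmx, kap z)] gives the horizontal and vertical components of a vector, and in it
    [cJ] is [(a, b) |-> (- b, a)]; identities between vectors are checked on these two
    components. *)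
Lemma kap_inj z u v : lsubmx u = lsubmx v -> kap z u = kap z v -> u = v.
Proof. by move=> e1 e2; rewrite (chor_kap z u) (chor_kap z v) e1 e2. Qed.

Lemma cJK z u : cJ z (cJ z u) = - u.
Proof.
apply: (@kap_inj z); first by rewrite lsubmx_cJ kap_cJ; exact/esym/linearN.
by rewrite kap_cJ lsubmx_cJ (linear_funN (kap_linear z)).
Qed.

Lemma lsubmx_continuous : continuous (@lsubmx R 1 n n).
Proof. by move=> ?; exact: continuous_lsubmx. Qed.

Lemma rsubmx_continuous : continuous (@rsubmx R 1 n n).
Proof. by move=> ?; exact: continuous_rsubmx. Qed.

Lemma derive_lsubmx z w : 'D_w lsubmx z = lsubmx w :> 'rV[R]_n.
Proof. exact: (derive_linear z w lsubmx_continuous). Qed.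

Lemma derive_rsubmx z w : 'D_w rsubmx z = rsubmx w :> 'rV[R]_n.
Proof. exact: (derive_linear z w rsubmx_continuous). Qed.

(** A family pulled back from the base is constant along the fibres, so only the horizontal
    component of the direction counts. *)
Lemma dfam_lsubmx {W : normedModType R} (C : 'rV[R]_n -> 'rV[R]_n -> 'rV[R]_n -> W) z w e f :
  differentiable (fun q => C q e f) (lsubmx z) ->
  dfam (fun z' : 'rV[R]_(n + n) => C (lsubmx z')) z w e f = dfam C (lsubmx z) (lsubmx w) e f.
Proof.
move=> dC; rewrite /dfam -(derive_lsubmx z w).
exact: (derive_comp w (differentiable_lsubmx z) dC).
Qed.

Section Point.
Context (z : 'rV[R]_(n + n)).
Hypotheses (dG : forall e f, differentiable (fun p => G p e f) (lsubmx z))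
  (dB : forall e f, differentiable (fun p => B p e f) (lsubmx z)).

Let dGz e f : differentiable (fun z' : 'rV[R]_(n + n) => G (lsubmx z') e f) z.
Proof. exact: (differentiable_comp (differentiable_lsubmx z) (dG e f)). Qed.

Let dBz e f : differentiable (fun z' : 'rV[R]_(n + n) => B (lsubmx z') e f) z.
Proof. exact: (differentiable_comp (differentiable_lsubmx z) (dB e f)). Qed.

Let derive_Bz w (X : 'rV[R]_(n + n) -> 'rV[R]_n) : differentiable X z ->
  'D_w (fun z' => B (lsubmx z') (X z') (rsubmx z')) z =
    dkap z w (X z) + B (lsubmx z) ('D_w X z) (rsubmx z).
Proof.
move=> dX; have := derive_bilin_family (fun z' => bB (lsubmx z')) dBz w dX (differentiable_rsubmx z).
by rewrite derive_rsubmx (dfam_lsubmx _ (dB _ _)) addrAC.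
Qed.

Let diff_Bz (X : 'rV[R]_(n + n) -> 'rV[R]_n) : differentiable X z ->
  differentiable (fun z' => B (lsubmx z') (X z') (rsubmx z')) z.
Proof.
move=> dX; exact: (differentiable_bilin_family (fun z' => bB (lsubmx z')) dBz dX (differentiable_rsubmx z)).
Qed.

Lemma differentiable_kap u : differentiable (kap^~ u) z.
Proof.
apply: (@differentiableD _ _ _ (cst (rsubmx u)) (fun z' => B (lsubmx z') (lsubmx u) (rsubmx z'))) => //.
exact: (diff_Bz (differentiable_cst (lsubmx u) z)).
Qed.

Lemma derive_kap w u : 'D_w (kap^~ u) z = dkap z w (lsubmx u).
Proof.
have d := diff_Bz (differentiable_cst (lsubmx u) z).
rewrite [LHS](deriveD (diff_derivable (differentiable_cst (rsubmx u) z)) (diff_derivable d)).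
rewrite (derive_Bz w (differentiable_cst (lsubmx u) z)) /cst !derive_cst.
by rewrite (bilin_0l (bB _)) addr0 add0r.
Qed.

Let derive_Gz w (X Y : 'rV[R]_(n + n) -> 'rV[R]_n) : differentiable X z -> differentiable Y z ->
  'D_w (fun z' => G (lsubmx z') (X z') (Y z')) z =
    dfam G (lsubmx z) (lsubmx w) (X z) (Y z) +
    G (lsubmx z) ('D_w X z) (Y z) + G (lsubmx z) (X z) ('D_w Y z).
Proof.
move=> dX dY; have := derive_bilin_family (fun z' => bG (lsubmx z')) dGz w dX dY.
by rewrite (dfam_lsubmx _ (dG _ _)).
Qed.

Let diff_Gz (X Y : 'rV[R]_(n + n) -> 'rV[R]_n) : differentiable X z -> differentiable Y z ->
  differentiable (fun z' => G (lsubmx z') (X z') (Y z')) z.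
Proof. by move=> dX dY; exact: (differentiable_bilin_family (fun z' => bG (lsubmx z')) dGz dX dY). Qed.

Lemma dfam_csasaki w u v : dfam csasaki z w u v =
  dfam G (lsubmx z) (lsubmx w) (lsubmx u) (lsubmx v) +
  dfam G (lsubmx z) (lsubmx w) (kap z u) (kap z v) +
  G (lsubmx z) (dkap z w (lsubmx u)) (kap z v) +
  G (lsubmx z) (kap z u) (dkap z w (lsubmx v)).
Proof.
have d := diff_Gz (differentiable_kap u) (differentiable_kap v).
rewrite [LHS](deriveD (diff_derivable (dGz (lsubmx u) (lsubmx v))) (diff_derivable d)).
rewrite (derive_Gz w (differentiable_kap u) (differentiable_kap v)) !derive_kap.
by rewrite -!addrA; congr (_ + _); exact: (dfam_lsubmx _ (dG (lsubmx u) (lsubmx v))).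
Qed.

Lemma differentiable_comega u v : differentiable (fun z' => comega z' u v) z.
Proof.
apply: (@differentiableB _ _ _ (fun z' => G (lsubmx z') (lsubmx u) (kap z' v))
  (fun z' => G (lsubmx z') (kap z' u) (lsubmx v))).
  exact: (diff_Gz (differentiable_cst _ _) (differentiable_kap v)).
exact: (diff_Gz (differentiable_kap u) (differentiable_cst _ _)).
Qed.

Lemma dfam_comega w u v : dfam comega z w u v =
  dfam G (lsubmx z) (lsubmx w) (lsubmx u) (kap z v) +
  G (lsubmx z) (lsubmx u) (dkap z w (lsubmx v)) -
  (dfam G (lsubmx z) (lsubmx w) (kap z u) (lsubmx v) +
  G (lsubmx z) (dkap z w (lsubmx u)) (lsubmx v)).
Proof.
have c1 := differentiable_cst (lsubmx u) z; have c2 := differentiable_cst (lsubmx v) z.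
have d1 := diff_Gz c1 (differentiable_kap v).
have d2 := diff_Gz (differentiable_kap u) c2.
rewrite [LHS](deriveB (diff_derivable d1) (diff_derivable d2)).
rewrite (derive_Gz w c1 (differentiable_kap v)) (derive_Gz w (differentiable_kap u) c2).
rewrite !derive_kap /cst !derive_cst (bilin_0l (bG _)) (bilin_0r (bG _)).
by rewrite !addr0.
Qed.

Lemma differentiable_cJ u : differentiable (cJ^~ u) z.
Proof.
have d1 := differentiableN (differentiable_kap u).
have d2 := differentiableD (differentiable_cst (lsubmx u) z) (diff_Bz (differentiable_kap u)).
exact: (differentiable_row_mx d1 d2).
Qed.

Lemma derive_cJ w u : 'D_w (cJ^~ u) z =
  row_mx (- dkap z w (lsubmx u))
    (dkap z w (kap z u) + B (lsubmx z) (dkap z w (lsubmx u)) (rsubmx z)).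
Proof.
have c1 := differentiable_cst (lsubmx u) z.
have d1 := differentiableN (differentiable_kap u).
have d2 := differentiableD c1 (diff_Bz (differentiable_kap u)).
rewrite [LHS](derive_row_mx w d1 d2); congr row_mx.
  by rewrite (deriveN (diff_derivable (differentiable_kap u))) derive_kap.
rewrite (deriveD (diff_derivable c1) (diff_derivable (diff_Bz (differentiable_kap u)))).
by rewrite derive_cst add0r (derive_Bz w (differentiable_kap u)) derive_kap.
Qed.

(** Writing the fibre component of [w] as [kap z w - B(w1, y)] separates the contribution of the
    horizontal part of [w], the source of curvature, from that of its vertical part. *)
Lemma dkapE w e : dkap z w e =
  dfam B (lsubmx z) (lsubmx w) e (rsubmx z) - B (lsubmx z) e (B (lsubmx z) (lsubmx w) (rsubmx z))
  + B (lsubmx z) e (kap z w).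
Proof. by rewrite /dkap /kap (bilin_Dr (bB _)) [B _ e (rsubmx w) + _]addrC addrA subrK. Qed.

End Point.
End TangentCoordinates.

(** After the multilinear rules have been applied, the values of the tensors are atoms; abstracting
    them leaves an identity for [ring]. *)
Ltac generalize3 F := repeat match goal with |- context [F ?a ?b ?c] =>
  generalize (F a b c); intro end.

Ltac generalize_dfam := repeat match goal with |- context [dfam ?F ?a ?b ?c ?d] =>
  generalize (dfam F a b c d); intro end.

(** * Derivative of the Kahler form and Nijenhuis tensor in coordinates *)

Section AlmostHermitianCoordinates.
Context {R : realType} {n : nat}.

(** The exterior derivative on fields with constant components, for which the bracket terms are
    absent. *)
Definition dform {m} (w : 'rV[R]_m -> 'rV[R]_m -> 'rV[R]_m -> R) z u v t : R :=
  dfam w z u v t - dfam w z v u t + dfam w z t u v.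

(* Obtained from the Nijenhuis tensor by taking fields with constant components. *)
Definition cnijenhuis {m} (J : 'rV[R]_m -> 'rV[R]_m -> 'rV[R]_m) z u v : 'rV[R]_m :=
  'D_(J z u) (J^~ v) z - 'D_(J z v) (J^~ u) z
  + J z ('D_v (J^~ u) z) - J z ('D_u (J^~ v) z).

Context (G : 'rV[R]_n -> 'rV[R]_n -> 'rV[R]_n -> R) (B Bs : 'rV[R]_n -> 'rV[R]_n -> 'rV[R]_n -> 'rV[R]_n).
Hypotheses (bG : forall p, bilin (G p)) (bB : forall p, bilin (B p)).
Hypothesis symG : forall p u v, G p u v = G p v u.
Context (z : 'rV[R]_(n + n)).
Let p := lsubmx z.
Let y := rsubmx z.
Hypotheses (dG : forall e f, differentiable (fun q => G q e f) p)
  (dB : forall e f, differentiable (fun q => B q e f) p).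
Implicit Types (u v w : 'rV[R]_(n + n)) (a b c : 'rV[R]_n).

(* [rho a b] is [dkap z (chor B z a) b]; antisymmetrizing it gives the curvature. *)
Let rho a b := dfam B p a b y - B p b (B p a y).

Let dkap_rho w a : dkap B z w a = rho (lsubmx w) a + B p a (kap B z w).
Proof. exact: dkapE. Qed.

Let rho_curv a b : rho a b = rho b a + ccurv B p a b y.
Proof.
rewrite /rho /ccurv; move: (dfam _ _ _ _ _) (dfam _ _ _ _ _) (B p a _) (B p b _) => A C D E.
by apply/rowP => i; rewrite !mxE; ring.
Qed.


Section Closed.
Hypothesis dual : forall a b c : 'rV[R]_n, dfam G p c a b = G p (Bs p c a) b + G p a (B p c b).

(** The derivative along [w] of [G(u1, kap v)], with the derivative of the metric eliminated by
    duality. By symmetry of [G], the other half of the Kahler form contributes the same expression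
    with [u] and [v] exchanged. *)
Let F w u v := G p (Bs p (lsubmx w) (lsubmx u)) (kap B z v) + (G p (lsubmx u) (B p (lsubmx w) (kap B z v)) +
  (G p (lsubmx u) (rho (lsubmx w) (lsubmx v)) + G p (lsubmx u) (B p (lsubmx v) (kap B z w)))).

Let dfam_F w u v : dfam (comega G B) z w u v = F w u v - F w v u.
Proof.
have symdG a b c : dfam G p a b c = dfam G p a c b.
  by rewrite /dfam; congr ('D_a _ p); apply/funext => q; exact: symG.
rewrite dfam_comega // -/p; congr (_ - _).
  by rewrite /F dual dkap_rho [G p _ (rho _ _ + _)](bilin_Dr (bG p)) !addrA.
by rewrite /F symdG dual [G p (dkap _ _ _ _) _]symG dkap_rho [G p _ (rho _ _ + _)](bilin_Dr (bG p)) !addrA.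
Qed.

(** Six values of [F] occur. Exchanging the first and third arguments of [F], the mixed terms [G(u1,
    B(w1, kap v)) + G(u1, B(v1, kap w))] are symmetric and cancel, while [rho] leaves a curvature;
    exchanging the first and second turns [Bs] into a torsion. *)
Lemma dform_comega u v w : dform (comega G B) z u v w =
  G p (ctorsion Bs p (lsubmx u) (lsubmx v)) (kap B z w) +
  G p (ctorsion Bs p (lsubmx v) (lsubmx w)) (kap B z u) +
  G p (ctorsion Bs p (lsubmx w) (lsubmx u)) (kap B z v) +
  (G p (lsubmx v) (ccurv B p (lsubmx u) (lsubmx w) y) +
   G p (lsubmx w) (ccurv B p (lsubmx v) (lsubmx u) y) +
   G p (lsubmx u) (ccurv B p (lsubmx w) (lsubmx v) y)).
Proof.
rewrite /dform !dfam_F /F /ctorsion.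
move: (kap B z u) (kap B z v) (kap B z w) => ku kv kw; rewrite !(bilin_Dl (bG p)) !(bilin_Nl (bG p)).
rewrite (rho_curv (lsubmx u) (lsubmx w)) (rho_curv (lsubmx v) (lsubmx u)).
rewrite (rho_curv (lsubmx w) (lsubmx v)) !(bilin_Dr (bG p)).
by generalize3 G; ring.
Qed.

End Closed.
Let rho_bilin : bilin rho.
Proof.
have bd a : bilin (dfam B p a) by exact: dfam_bilin.
have ld a b : linear (fun c => dfam B p c a b) by exact: dfam_linear.
split=> [b|b] k a a'; rewrite /rho.
  rewrite ld (bilin_Pl (bB p)) (bilin_Pr (bB p)).
  by generalize_dfam; generalize3 B => *; rewrite scalerBr opprD addrACA.
rewrite (bilin_Pl (bd _)) (bilin_Pl (bB p)).
by generalize_dfam; generalize3 B => *; rewrite scalerBr opprD addrACA.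
Qed.

Let lsubmxD (u v : 'rV[R]_(n + n)) : lsubmx (u + v) = lsubmx u + lsubmx v.
Proof. exact: linearD. Qed.

Let lsubmxN (u : 'rV[R]_(n + n)) : lsubmx (- u) = - lsubmx u.
Proof. exact: linearN. Qed.

Let lsubmx00 : lsubmx (0 : 'rV[R]_(n + n)) = 0 :> 'rV[R]_n.
Proof. exact: linear0. Qed.

Let lsubmx_dJ w u : lsubmx ('D_w ((cJ B)^~ u) z) = - (rho (lsubmx w) (lsubmx u) + B p (lsubmx u) (kap B z w)).
Proof. by rewrite derive_cJ // row_mxKl dkap_rho. Qed.

Let kap_dJ w u : kap B z ('D_w ((cJ B)^~ u) z) = rho (lsubmx w) (kap B z u) + B p (kap B z u) (kap B z w).
Proof.
rewrite derive_cJ // /kap row_mxKl row_mxKr (bilin_Nl (bB _)) addrK.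
exact: dkap_rho.
Qed.

(** The four derivatives of [cJ] each contribute one [rho]; these pair up with exchanged arguments,
    so each pair collapses to a curvature by [rho_curv], and the [B] terms pair up to torsions. The
    vertical component below works in the same way. *)
Let lsubmx_cnijenhuis u v : lsubmx (cnijenhuis (cJ B) z u v) =
  ctorsion B p (lsubmx u) (lsubmx v) - ctorsion B p (kap B z u) (kap B z v)
  + ccurv B p (kap B z u) (lsubmx v) y + ccurv B p (lsubmx u) (kap B z v) y.
Proof.
move: (lsubmx_dJ (cJ B z u) v) (lsubmx_dJ (cJ B z v) u) (kap_dJ v u) (kap_dJ u v).
rewrite /cnijenhuis.
move: ('D_(cJ B z u) ((cJ B)^~ v) z) ('D_(cJ B z v) ((cJ B)^~ u) z)
  ('D_v ((cJ B)^~ u) z) ('D_u ((cJ B)^~ v) z) => X1 X2 X3 X4.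
rewrite !(lsubmx_cJ, kap_cJ bB) => E1 E2 E3 E4.
rewrite !(lsubmxD, lsubmxN) !lsubmx_cJ E1 E2 E3 E4.
rewrite !(bilin_Nl rho_bilin) (rho_curv (kap B z u) (lsubmx v)) (rho_curv (lsubmx u) (kap B z v)).
rewrite /ctorsion.
move: (rho _ _) (rho _ _) (ccurv _ _ _ _ _) (ccurv _ _ _ _ _) => r1 r2 c1 c2.
move: (kap B z u) (kap B z v) => ku kv.
move: (B p (lsubmx v) (lsubmx u)) (B p (lsubmx u) (lsubmx v)) (B p ku kv) (B p kv ku) => b1 b2 b3 b4.
by apply/rowP => i; rewrite !mxE; ring.
Qed.

Let kap_cnijenhuis u v : kap B z (cnijenhuis (cJ B) z u v) =
  ccurv B p (lsubmx u) (lsubmx v) y - ccurv B p (kap B z u) (kap B z v) y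
  + ctorsion B p (kap B z v) (lsubmx u) + ctorsion B p (lsubmx v) (kap B z u).
Proof.
have lk := kap_linear bB z.
move: (kap_dJ (cJ B z u) v) (kap_dJ (cJ B z v) u) (lsubmx_dJ v u) (lsubmx_dJ u v).
rewrite /cnijenhuis.
move: ('D_(cJ B z u) ((cJ B)^~ v) z) ('D_(cJ B z v) ((cJ B)^~ u) z)
  ('D_v ((cJ B)^~ u) z) ('D_u ((cJ B)^~ v) z) => X1 X2 X3 X4.
rewrite !(lsubmx_cJ, kap_cJ bB) => E1 E2 E3 E4.
rewrite !(linear_funD lk) !(linear_funN lk) !(kap_cJ bB) E1 E2 E3 E4.
rewrite !(bilin_Nl rho_bilin) (rho_curv (lsubmx u) (lsubmx v)) (rho_curv (kap B z u) (kap B z v)).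
rewrite /ctorsion.
move: (rho _ _) (rho _ _) (ccurv _ _ _ _ _) (ccurv _ _ _ _ _) => r1 r2 c1 c2.
move: (kap B z u) (kap B z v) => ku kv.
move: (B p (lsubmx v) ku) (B p (lsubmx u) kv) (B p ku (lsubmx v)) (B p kv (lsubmx u)) => b1 b2 b3 b4.
by apply/rowP => i; rewrite !mxE; ring.
Qed.

Lemma cnijenhuis0 u v :
  (forall a b, ctorsion B p a b = 0) -> (forall a b, ccurv B p a b y = 0) ->
  cnijenhuis (cJ B) z u v = 0.
Proof.
move=> T0 C0; apply: (@kap_inj _ _ B z).
  by rewrite lsubmx_cnijenhuis !T0 !C0 lsubmx00 subr0 !addr0.
have -> : kap B z 0 = 0 by have := linear_fun0 (kap_linear bB z).
by rewrite kap_cnijenhuis !T0 !C0 subr0 !addr0.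
Qed.

Lemma cnijenhuis_chor a b : cnijenhuis (cJ B) z (chor B z a) (chor B z b) = 0 ->
  ctorsion B p a b = 0 /\ ccurv B p a b y = 0.
Proof.
have ccurv0 c : ccurv B p 0 c y = 0 /\ ccurv B p c 0 y = 0.
  have bd e : bilin (dfam B p e) by exact: dfam_bilin.
  have l0 e f : dfam B p 0 e f = 0 by exact: derive0.
  rewrite /ccurv l0 !(bilin_0l (bd _)) !(bilin_0l (bB p)) !(bilin_0r (bB p)).
  by rewrite !subr0 !addr0.
have kh c : kap B z (chor B z c) = 0 by exact: kap_chor.
have lh c : lsubmx (chor B z c) = c by rewrite row_mxKl.
move=> N0; split.
  move/(congr1 lsubmx): N0; rewrite lsubmx_cnijenhuis !kh !lh lsubmx00.
  by rewrite (ccurv0 _).1 (ccurv0 _).2 {2}/ctorsion subrr subr0 !addr0.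
move/(congr1 (kap B z)): N0; rewrite kap_cnijenhuis !kh !lh (linear_fun0 (kap_linear bB z)).
by rewrite (ccurv0 _).1 subr0 /ctorsion !(bilin_0l (bB p)) !(bilin_0r (bB p)) subr0 !addr0.
Qed.

End AlmostHermitianCoordinates.

(** * Ricci curvature of the Sasaki metric *)

Section Orthonormal.
Context {R : rcfType} {n : nat} (H : 'rV[R]_n -> 'rV[R]_n -> R).
Hypotheses (bH : bilin H) (symH : forall u v, H u v = H v u).

Definition orthonormal (e : 'I_n -> 'rV[R]_n) : Prop :=
  forall i j, H (e i) (e j) = (i == j)%:R.

Lemma orthonormal_frame : (forall u, u != 0 -> 0 < H u u) -> exists e, orthonormal e.
Proof.
move=> posH.
have step k : (k <= n)%N -> exists e : nat -> 'rV[R]_n,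
    forall i j, (i < k)%N -> (j < k)%N -> H (e i) (e j) = (i == j)%:R.
  elim: k => [|k IH] kn; first by exists (fun=> 0).
  have [e oe] := IH (ltnW kn).
  (* A row in the kernel of [A] is orthogonal to the [k] vectors already found; the kernel is
     nonzero because the rank is at most [k < n]. Normalizing such a row extends the family. *)
  pose A : 'M[R]_(n, k) := \matrix_(j, i) H 'e_j (e i).
  have : kermx A != 0.
    rewrite -mxrank_eq0 mxrank_ker -lt0n subn_gt0.
    exact: leq_ltn_trans (rank_leq_col A) kn.
  case/rowV0Pn => u /sub_kermxP uA u0.
  have Hu (i : nat) : (i < k)%N -> H u (e i) = 0.
    move=> ik; have <- : (u *m A) 0 (Ordinal ik) = 0 by rewrite uA mxE.
    rewrite {1}(row_sum_delta u) (bilin_suml bH) mxE.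
    by apply: eq_bigr => j _; rewrite (bilin_Zl bH) mxE.
  have c0 := posH u u0; pose c := Num.sqrt (H u u).
  have cN : c != 0 by rewrite gt_eqF // sqrtr_gt0.
  exists (fun i => if i == k then c^-1 *: u else e i) => i j.
  rewrite !ltnS [(i <= k)%N]leq_eqVlt [(j <= k)%N]leq_eqVlt.
  have [->|ik] /= := eqVneq i k; have [->|jk] /= := eqVneq j k.
  - move=> _ _; rewrite ?eqxx (bilin_Zl bH) (bilin_Zr bH) -[H u u]sqr_sqrtr ?ltW // -/c.
    by rewrite /GRing.scale /= expr2 mulKf // mulVf.
  - by move=> _ jk'; rewrite (bilin_Zl bH) Hu // scaler0.
  - by move=> ik' _; rewrite (bilin_Zr bH) symH Hu // scaler0 ?(negbTE ik).
  - exact: oe.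
have [e oe] := step n (leqnn n).
by exists (fun i => e i) => i j; rewrite oe.
Qed.

Context (e : 'I_n -> 'rV[R]_n) (oe : orthonormal e).

(** Orthonormality says [P *m Q = 1] for the matrix [P] of the frame and the matrix [Q] of the
    coefficient map; as both are square, [Q *m P = 1], which is the expansion. *)
Lemma parseval u : u = \sum_i H u (e i) *: e i.
Proof.
pose P : 'M[R]_n := \matrix_i e i.
pose Q : 'M[R]_n := \matrix_(i, j) H 'e_i (e j).
have HQ v j : H v (e j) = (v *m Q) 0 j.
  rewrite {1}(row_sum_delta v) (bilin_suml bH) !mxE; apply: eq_bigr => i _.
  by rewrite (bilin_Zl bH) !mxE.
have PQ : P *m Q = 1%:M.
  apply/matrixP => i j; rewrite [RHS]mxE -oe HQ.
  by rewrite -[LHS]/((P *m Q) i j) !mxE; apply: eq_bigr => l _; rewrite !mxE.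
have E : u = u *m Q *m P by rewrite -mulmxA (mulmx1C PQ) mulmx1.
rewrite {1}E mulmx_sum_row; apply: eq_bigr => i _.
by rewrite HQ rowK.
Qed.

Lemma trace_orthonormal (L : 'rV[R]_n -> 'rV[R]_n) : linear L ->
  \sum_i L 'e_i 0 i = \sum_i H (L (e i)) (e i).
Proof.
move=> lL; pose K u k := H (L u) (e k).
have lK k : linear (K^~ k).
  by move=> c u v; rewrite /K lL (bilin_Pl bH).
have -> : \sum_i L 'e_i 0 i = \sum_i \sum_k (e k) 0 i * K 'e_i k.
  apply: eq_bigr => i _; rewrite {1}(parseval (L 'e_i)) summxE.
  by apply: eq_bigr => k _; rewrite mxE mulrC.
rewrite exchange_big /=; apply: eq_bigr => k _.
rewrite -[RHS]/(K (e k) k) {2}(row_sum_delta (e k)).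
rewrite (linear_fun_sum (lK k)); apply: eq_bigr => i _.
by rewrite (linear_funZ (lK k)).
Qed.

Lemma trace_square_orthonormal (L L' : 'rV[R]_n -> 'rV[R]_n) : linear L -> linear L' ->
  \sum_i L (L' 'e_i) 0 i = \sum_i \sum_j H (L' (e i)) (e j) * H (L (e j)) (e i).
Proof.
move=> lL lL'; rewrite (@trace_orthonormal (L \o L')) /=; last first.
  by move=> c u v; rewrite /= lL' lL.
apply: eq_bigr => i _; rewrite {1}(parseval (L' (e i))).
rewrite (linear_fun_sum lL) (bilin_suml bH); apply: eq_bigr => j _.
by rewrite (linear_funZ lL) (bilin_Zl bH).
Qed.

End Orthonormal.

(** * Levi-Civita symbols and Ricci curvature on vertical vectors *)

Section SasakiRicci.
Context {R : realType} {n : nat} (O : set 'rV[R]_n) (oO : open O).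
Context (G : 'rV[R]_n -> 'rV[R]_n -> 'rV[R]_n -> R) (B : 'rV[R]_n -> 'rV[R]_n -> 'rV[R]_n -> 'rV[R]_n)
  (C : 'rV[R]_(n + n) -> 'rV[R]_(n + n) -> 'rV[R]_(n + n) -> 'rV[R]_(n + n)).
Hypotheses (bG : forall p, bilin (G p)) (bB : forall p, bilin (B p)) (bC : forall z, bilin (C z)).
Hypotheses (symG : forall p u v, G p u v = G p v u)
  (posG : forall p u, O p -> u != 0 -> 0 < G p u u).
Hypotheses (sG : forall u v, smooth O (fun p => G p u v))
  (sB : forall u v, smooth O (fun p => B p u v))
  (sC : forall u v, smooth (lsubmx @^-1` O) (fun z => C z u v)).
Hypotheses (symC : forall z u v, O (lsubmx z) -> C z u v = C z v u)
  (dualC : forall z u v w, O (lsubmx z) -> dfam (csasaki G B) z w u v =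
    csasaki G B z (C z w u) v + csasaki G B z u (C z w v)).

Let g := csasaki G B.
Let bg z : bilin (g z). Proof. exact: csasaki_bilin. Qed.

Let symg z u v : g z u v = g z v u.
Proof. by rewrite /g /csasaki symG [X in _ + X]symG. Qed.

Let dG p u v : O p -> differentiable (fun q => G q u v) p.
Proof. exact: smooth_differentiable. Qed.
Let dB p u v : O p -> differentiable (fun q => B q u v) p.
Proof. exact: smooth_differentiable. Qed.
Let dC z u v : O (lsubmx z) -> differentiable (fun z' => C z' u v) z.
Proof. by move=> Oz; exact: (smooth_differentiable (@sC u v)). Qed.

Let dfam_g0 p u v : dfam G p 0 u v = 0. Proof. exact: derive0. Qed.
Let dfam_B0 p u v : dfam B p 0 u v = 0. Proof. exact: derive0. Qed.

Let oz : open ((lsubmx : 'rV[R]_(n + n) -> 'rV[R]_n) @^-1` O).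
Proof. by apply: open_comp => // ? _; exact: continuous_lsubmx. Qed.

Let ver (v : 'rV[R]_n) : 'rV[R]_(n + n) := row_mx 0 v.

Let lver v : lsubmx (ver v) = 0. Proof. exact: row_mxKl. Qed.
Let kver z v : kap B z (ver v) = v. Proof. exact: kap_ver. Qed.
Let lhor z e : lsubmx (chor B z e) = e. Proof. exact: row_mxKl. Qed.
Let khor z e : kap B z (chor B z e) = 0. Proof. exact: kap_chor. Qed.

(** In an orthonormal frame of [G p] this is the trace of [G^-1 dG(a)], the derivative of
    [log det G] along [a]. *)
Let mtrace p (e : 'I_n -> 'rV[R]_n) a := \sum_i dfam G p a (e i) (e i).
(* Twice the horizontal-vertical and vertical-horizontal entries of the covariant
   derivative of the vertical field [v]; they do not depend on the fibre point. *)
Let mixhv p v a b := dfam G p a v b + G p (B p a v) b - G p (B p a b) v.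
Let mixvh p v a b := G p v (B p b a) + G p a (B p b v) - dfam G p b a v.

Section Point.
Context (z : 'rV[R]_(n + n)) (Oz : O (lsubmx z)).
Let p := lsubmx z.
Let y := rsubmx z.

(** The Koszul formula for constant components: symmetry of [C] and metricity, with no bracket
    terms. *)
Let koszul u v w : 2 * g z (C z u v) w = dfam g z u v w + dfam g z v u w - dfam g z w u v.
Proof.
rewrite !dualC // -!/g (symC v u Oz) (symC w u Oz) (symC w v Oz).
rewrite (symg z v (C z u w)) (symg z u (C z v w)).
by move: (g z (C z u v) w) (g z (C z u w) v) (g z (C z v w) u) => a b c; ring.
Qed.

Let bdG a : bilin (dfam G p a). Proof. by apply: dfam_bilin => // u v; exact: dG. Qed.
Let bdB a : bilin (dfam B p a). Proof. by apply: dfam_bilin => // u v; exact: dB. Qed.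

Let dgE w u v : dfam g z w u v =
  dfam G p (lsubmx w) (lsubmx u) (lsubmx v) + dfam G p (lsubmx w) (kap B z u) (kap B z v) +
  G p (dkap B z w (lsubmx u)) (kap B z v) + G p (kap B z u) (dkap B z w (lsubmx v)).
Proof. by apply: dfam_csasaki => // a b; [exact: dG|exact: dB]. Qed.

Let dkap0 w : dkap B z w 0 = 0.
Proof. by rewrite /dkap (bilin_0l (bdB _)) (bilin_0l (bB _)) addr0. Qed.

Let dkap_ver v e : dkap B z (ver v) e = B p e v.
Proof. by rewrite /dkap lver dfam_B0 add0r /ver row_mxKr. Qed.

Context (e : 'I_n -> 'rV[R]_n) (oe : orthonormal (G p) e).

Definition sasaki_frame (i : 'I_(n + n)) : 'rV[R]_(n + n) :=
  match fintype.split i with inl j => chor B z (e j) | inr j => row_mx 0 (e j) end.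

Let framel i : sasaki_frame (lshift n i) = chor B z (e i).
Proof. by rewrite /sasaki_frame (unsplitK (inl i : 'I_n + 'I_n)%type). Qed.

Let framer i : sasaki_frame (rshift n i) = ver (e i).
Proof. by rewrite /sasaki_frame (unsplitK (inr i : 'I_n + 'I_n)%type). Qed.

Let gE u v : g z u v = G p (lsubmx u) (lsubmx v) + G p (kap B z u) (kap B z v).
Proof. by []. Qed.

Lemma orthonormal_sasaki_frame : orthonormal (g z) sasaki_frame.
Proof.
move=> i j; case: (split_ordP i) => i' ->; case: (split_ordP j) => j' ->;
  rewrite ?framel ?framer gE ?lver ?lhor ?kver ?khor.
- by rewrite (bilin_0l (bG p)) addr0 oe (inj_eq (@lshift_inj _ _)).
- by rewrite (bilin_0l (bG p)) (bilin_0r (bG p)) addr0 eq_lrshift.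
- by rewrite (bilin_0l (bG p)) (bilin_0r (bG p)) addr0 eq_rlshift.
- by rewrite (bilin_0l (bG p)) add0r oe (inj_eq (@rshift_inj _ _)).
Qed.

(* The trace is the logarithmic derivative of the Riemannian density of [TM], which
   is [det G] and hence constant along the fibres. *)
Lemma trace_levi_civita u :
  \sum_i C z 'e_i u 0 i = mtrace (lsubmx z) e (lsubmx u).
Proof.
rewrite -/p.
rewrite (trace_orthonormal (bg z) orthonormal_sasaki_frame ((bC z).1 u)).
(* By symmetry of [C] and metricity this is half the derivative of [g(b, b)] along [u]. The
   horizontal and the vertical halves of the frame then give half of [mtrace] each. *)
have S b : g z (C z b u) b = dfam g z u b b / 2.
  rewrite dualC // -!/g (symC u b Oz) [g z b _]symg.
  by move: (g z _ b) => a; lra.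
rewrite big_split_ord /=.
rewrite (eq_bigr (fun i => dfam G p (lsubmx u) (e i) (e i) / 2)); last first.
  move=> i _; rewrite framel S dgE lhor khor.
  by rewrite (bilin_0l (bdG _)) (bilin_0l (bG _)) (bilin_0r (bG _)) !addr0.
rewrite [X in _ + X](eq_bigr (fun i => dfam G p (lsubmx u) (e i) (e i) / 2)); last first.
  move=> i _; rewrite framer S dgE lver kver dkap0.
  by rewrite (bilin_0l (bdG _)) (bilin_0l (bG _)) (bilin_0r (bG _)) !addr0 add0r.
rewrite -mulr_suml -/(mtrace p e (lsubmx u)); lra.
Qed.

Lemma trace_vertical v : \sum_i C z 'e_i (ver v) 0 i = 0.
Proof.
by rewrite trace_levi_civita lver /mtrace big1.
Qed.

Context (v : 'rV[R]_n).
Let V := ver v.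

(** The matrix of the covariant derivative of the constant vertical field [V], whose four blocks are
    computed next. *)
Let beta w w' : 2 * g z (C z w V) w' =
  dfam G p (lsubmx w) v (kap B z w') + G p v (dkap B z w (lsubmx w')) +
  G p (B p (lsubmx w) v) (kap B z w') + G p (kap B z w) (B p (lsubmx w') v) -
  dfam G p (lsubmx w') (kap B z w) v - G p (dkap B z w' (lsubmx w)) v.
Proof.
rewrite koszul !dgE /V !lver !kver !dkap0 !dkap_ver dfam_g0 dfam_g0.
rewrite !(bilin_0l (bdG _), bilin_0r (bdG _), bilin_0l (bG _), bilin_0r (bG _)).
by rewrite !(addr0, add0r) opprD !addrA.
Qed.

Let mhv := mixhv p v.
Let mvh := mixvh p v.

Let half (r t : R) : 2 * r = t -> r = t / 2.
Proof. by move=> <-; field. Qed.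

(** On horizontal lifts only the two [dkap] terms of [beta] survive; their difference is
    antisymmetrized in [a] and [b], hence a curvature. No other block involves the fibre point. *)
Let beta_hh a b : g z (C z (chor B z a) V) (chor B z b) = G p v (ccurv B p a b y) / 2.
Proof.
apply: half; rewrite beta !lhor !khor !(bilin_0l (bdG _), bilin_0r (bdG _), bilin_0l (bG _), bilin_0r (bG _)).
rewrite [G p (dkap _ _ _ _) v]symG !(addr0, add0r, subr0) !dkapE // !lhor !khor !(bilin_0r (bB _)) !addr0.
rewrite -(bilin_Nr (bG p)) -(bilin_Dr (bG p)) /ccurv -/p -/y; congr (G p v _).
generalize_dfam; generalize3 B => *; apply/rowP => i; rewrite !mxE; ring.
Qed.

Let beta_hv a b : g z (C z (chor B z a) V) (ver b) = mhv a b / 2.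
Proof.
apply: half; rewrite beta !lhor !khor !lver !kver dkap0 dkap_ver dfam_g0.
rewrite !(bilin_0l (bdG _), bilin_0r (bdG _), bilin_0l (bG _), bilin_0r (bG _)).
by rewrite !(addr0, add0r, subr0).
Qed.

Let beta_vh a b : g z (C z (ver a) V) (chor B z b) = mvh a b / 2.
Proof.
apply: half; rewrite beta !lhor !khor !lver !kver dkap0 dkap_ver dfam_g0.
rewrite !(bilin_0l (bdG _), bilin_0r (bdG _), bilin_0l (bG _), bilin_0r (bG _)).
by rewrite !(addr0, add0r, subr0).
Qed.

Let beta_vv a b : g z (C z (ver a) V) (ver b) = 0.
Proof.
rewrite -[RHS](mul0r 2^-1); apply: half; rewrite beta !kver !lver !dkap0 !dfam_g0.
by rewrite !(bilin_0l (bB _), bilin_0l (bG _), bilin_0r (bG _)) !(addr0, subr0).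
Qed.

Let F i j := g z (C z (sasaki_frame i) V) (sasaki_frame j) *
  g z (C z (sasaki_frame j) V) (sasaki_frame i).

(** The trace of the square is the sum of the products of opposite entries. The horizontal block is
    antisymmetric and gives minus squares over 4, the two mixed blocks give equal sums over 4, and
    the vertical block vanishes. *)
Lemma trace_square_vertical : \sum_i C z (ver v) (C z 'e_i (ver v)) 0 i =
  (\sum_i \sum_j mixhv (lsubmx z) v (e i) (e j) * mixvh (lsubmx z) v (e j) (e i)) / 2 -
  (\sum_i \sum_j G (lsubmx z) v (ccurv B (lsubmx z) (e i) (e j) (rsubmx z)) ^+ 2) / 4.
Proof.
rewrite -/p -/y -/V -/mhv -/mvh.
rewrite (trace_square_orthonormal (bg z) orthonormal_sasaki_frame ((bC z).2 V) ((bC z).1 V)).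
have -> : \sum_i \sum_j g z (C z (sasaki_frame i) V) (sasaki_frame j) *
    g z (C z V (sasaki_frame j)) (sasaki_frame i) =
    \sum_i \sum_j F i j.
  by apply: eq_bigr => i _; apply: eq_bigr => j _; rewrite (symC V _ Oz).
have ccurvC a b : ccurv B p b a y = - ccurv B p a b y.
  rewrite /ccurv; generalize_dfam; generalize3 B => *.
  by apply/rowP => i; rewrite !mxE; ring.
rewrite big_split_ord /=.
under eq_bigr => i _ do rewrite big_split_ord /=.
under [X in _ + X]eq_bigr => i _ do rewrite big_split_ord /=.
rewrite !big_split /=.
have -> : \sum_i \sum_j F (lshift n i) (lshift n j) =
    - ((\sum_i \sum_j G p v (ccurv B p (e i) (e j) y) ^+ 2) / 4).
  rewrite mulr_suml -sumrN; apply: eq_bigr => i _.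
  rewrite mulr_suml -sumrN; apply: eq_bigr => j _.
  rewrite /F !framel !beta_hh (ccurvC (e i) (e j)) (bilin_Nr (bG _)).
  by move: (G p v _) => a; field.
have -> : \sum_i \sum_j F (lshift n i) (rshift n j) =
    (\sum_i \sum_j mhv (e i) (e j) * mvh (e j) (e i)) / 4.
  rewrite mulr_suml; apply: eq_bigr => i _; rewrite mulr_suml; apply: eq_bigr => j _.
  rewrite /F framel framer beta_hv beta_vh.
  by move: (mhv _ _) (mvh _ _) => a b; field.
have -> : \sum_i \sum_j F (rshift n i) (lshift n j) =
    (\sum_i \sum_j mhv (e i) (e j) * mvh (e j) (e i)) / 4.
  rewrite exchange_big mulr_suml; apply: eq_bigr => i _; rewrite mulr_suml; apply: eq_bigr => j _.
  rewrite /F framel framer beta_hv beta_vh.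
  by move: (mhv _ _) (mvh _ _) => a b; field.
have -> : \sum_i \sum_j F (rshift n i) (rshift n j) = 0.
  by rewrite big1 // => i _; rewrite big1 // => j _; rewrite /F !framer beta_vv mul0r.
by move: (\sum_i _) (\sum_i _) => a b; field.
Qed.

(** The right-hand side depends on [z] and [w] only through [lsubmx]: therefore [nabla_V V] is
    horizontal, and its projection to the base is the same along each fibre. *)
Lemma levi_civita_vertical w :
  g z (C z (ver v) (ver v)) w = G (lsubmx z) v (B (lsubmx z) (lsubmx w) v) - dfam G (lsubmx z) (lsubmx w) v v / 2.
Proof.
rewrite -/p; have := koszul (ver v) (ver v) w.
rewrite !dgE !lver !kver !dkap0 !dkap_ver !dfam_g0.
rewrite !(bilin_0l (bdG _), bilin_0r (bdG _), bilin_0l (bG _), bilin_0r (bG _)).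
by move: (g z _ w) (G p v _) (dfam _ _ _ _ _) => a b c; lra.
Qed.

Lemma kap_levi_civita_vertical : kap B z (C z (ver v) (ver v)) = 0.
Proof.
(* Testing against the vertical vector with the vertical part of [W] itself gives
   [G(kap W, kap W) = 0]. *)
set W := C z (ver v) (ver v); have := levi_civita_vertical (ver (kap B z W)).
rewrite -/W -/p gE lver kver dfam_g0 (bilin_0l (bB _)) !(bilin_0r (bG _)) add0r mul0r subr0 => E.
by apply/eqP/negPn/negP => W0; have := posG Oz W0; rewrite -/p E ltxx.
Qed.

End Point.

(** The projection of [nabla_V V] to the base; its value at the zero vector represents the whole
    fibre. *)
Let sp v q : 'rV[R]_n := lsubmx (C (row_mx q 0) (ver v) (ver v)).

Let levi_civita_horizontal v z : O (lsubmx z) -> C z (ver v) (ver v) = chor B z (sp v (lsubmx z)).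
Proof.
move=> Oz; set W := C z _ _; set p := lsubmx z.
suff E : lsubmx W = sp v p.
  by rewrite {1}(chor_kap B z W) kap_levi_civita_vertical // row_mx0 addr0 E.
have Op : O (lsubmx (row_mx p (0 : 'rV[R]_n))) by rewrite row_mxKl.
have := levi_civita_vertical Op v (chor B (row_mx p 0) (lsubmx W - sp v p)).
have := levi_civita_vertical Oz v (chor B z (lsubmx W - sp v p)).
rewrite -/W -/p !lhor row_mxKl -/p => <-.
rewrite /g /csasaki !lhor !khor !(bilin_0r (bG _)) !addr0 row_mxKl -/p -/(sp v p) => /esym/eqP.
rewrite -subr_eq0 -(bilin_Nl (bG p)) -(bilin_Dl (bG p)) => /eqP G0.
by apply/subr0_eq/eqP/negPn/negP => W0; have := posG Oz W0; rewrite -/p G0 ltxx.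
Qed.

Let differentiable_sp v p : O p -> differentiable (sp v) p.
Proof.
move=> Op; have dr : differentiable (fun q : 'rV[R]_n => row_mx q (0 : 'rV[R]_n)) p.
  exact: (@differentiable_row_mx _ _ _ _ id (cst 0)).
have Op' : O (lsubmx (row_mx p (0 : 'rV[R]_n))) by rewrite row_mxKl.
have dCp := differentiable_comp dr (dC (ver v) (ver v) Op').
exact: (differentiable_comp dCp (differentiable_lsubmx _)).
Qed.

(** Near [z] the field [nabla_V V] is [(sp, - B(sp, y))]. The second block is linear in [y], so its
    divergence along the fibre is minus the trace of [B(sp, .)], and [y] disappears. *)
Let divergence v z : O (lsubmx z) ->
  \sum_i dfam C z 'e_i (ver v) (ver v) 0 i =
  \sum_i 'D_'e_i (sp v) (lsubmx z) 0 i - \sum_i B (lsubmx z) (sp v (lsubmx z)) 'e_i 0 i.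
Proof.
move=> Oz; set p := lsubmx z.
have dsz : differentiable (fun z' : 'rV[R]_(n + n) => sp v (lsubmx z')) z.
  exact: (differentiable_comp (differentiable_lsubmx z) (differentiable_sp v Oz)).
have dBz a b : differentiable (fun z' : 'rV[R]_(n + n) => B (lsubmx z') a b) z.
  exact: (differentiable_comp (differentiable_lsubmx z) (dB a b Oz)).
have dBs : differentiable (fun z' : 'rV[R]_(n + n) => B (lsubmx z') (sp v (lsubmx z')) (rsubmx z')) z.
  exact: (differentiable_bilin_family (fun z' => bB (lsubmx z')) dBz dsz (differentiable_rsubmx z)).
have E w : dfam C z w (ver v) (ver v) = row_mx ('D_(lsubmx w) (sp v) p)
   (- (dfam B p (lsubmx w) (sp v p) (rsubmx z) +
       B p ('D_(lsubmx w) (sp v) p) (rsubmx z) + B p (sp v p) (rsubmx w))).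
  have -> : dfam C z w (ver v) (ver v) = 'D_w (fun z' => row_mx (sp v (lsubmx z'))
      (- B (lsubmx z') (sp v (lsubmx z')) (rsubmx z'))) z.
    apply: near_eq_derive; near=> z'; apply: levi_civita_horizontal.
    by near: z'; apply: (open_nbhs_nbhs (conj oz Oz)).
  have Ds : 'D_w (fun z' : 'rV[R]_(n + n) => sp v (lsubmx z')) z = 'D_(lsubmx w) (sp v) p.
    by rewrite -(derive_lsubmx z w); exact: (derive_comp w (differentiable_lsubmx z) (differentiable_sp v Oz)).
  rewrite (derive_row_mx w dsz (differentiableN dBs)) Ds.
  rewrite (deriveN (diff_derivable dBs)).
  rewrite (derive_bilin_family (fun z' => bB (lsubmx z')) dBz w dsz (differentiable_rsubmx z)).
  by rewrite Ds derive_rsubmx (dfam_lsubmx _ (dB _ _ Oz)).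
have e1 i : lsubmx ('e_(lshift n i) : 'rV[R]_(n + n)) = 'e_i :> 'rV[R]_n.
  by apply/rowP => j; rewrite !mxE (inj_eq (@lshift_inj _ _)).
have e2 i : lsubmx ('e_(rshift n i) : 'rV[R]_(n + n)) = 0 :> 'rV[R]_n.
  by apply/rowP => j; rewrite !mxE eq_lrshift andbF.
have e3 i : rsubmx ('e_(rshift n i) : 'rV[R]_(n + n)) = 'e_i :> 'rV[R]_n.
  by apply/rowP => j; rewrite !mxE (inj_eq (@rshift_inj _ _)).
rewrite big_split_ord -sumrN /=; congr (_ + _); apply: eq_bigr => i _.
  by rewrite E e1 row_mxEl.
rewrite E e2 e3 row_mxEr.
have D0 : 'D_0 (sp v) p = 0 by exact: derive0.
by rewrite D0 dfam_B0 (bilin_0l (bB _)) !add0r mxE.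
Unshelve. all: by end_near. Qed.

Let derive_trace_vertical v z : O (lsubmx z) ->
  \sum_i dfam C z (ver v) 'e_i (ver v) 0 i = 0.
Proof.
move=> Oz.
have dCi i : differentiable (fun z' => C z' 'e_i (ver v) 0 i : R) z.
  exact: (differentiable_comp (dC 'e_i (ver v) Oz) (differentiable_coord _ 0 i)).
have -> : \sum_i dfam C z (ver v) 'e_i (ver v) 0 i =
    'D_(ver v) (fun z' => \sum_i C z' 'e_i (ver v) 0 i) z.
  rewrite derive_sumf //; apply: eq_bigr => i _.
  by rewrite /dfam (derive_mx (diff_derivable (dC 'e_i (ver v) Oz))) mxE.
rewrite -[RHS](derive_cst (0 : R) z (ver v)); apply: near_eq_derive; near=> z'.
have Oz' : O (lsubmx z') by near: z'; apply: (open_nbhs_nbhs (conj oz Oz)).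
(* The frame is chosen separately at each nearby point; it does not occur in the trace, so the
   choice may depend on the point in any way. *)
have [e oe] := orthonormal_frame (bG _) (symG _) (fun u => posG Oz').
exact: trace_vertical oe _.
Unshelve. all: by end_near. Qed.

(** The constant stays existential because only its independence of [y] will be used. *)
Lemma ricci_vertical p (v : 'rV[R]_n) e : O p -> orthonormal (G p) e -> exists c, forall y : 'rV[R]_n,
  \sum_i ccurv C (row_mx p y) 'e_i (row_mx 0 v) (row_mx 0 v) 0 i =
  c + (\sum_i \sum_j G p v (ccurv B p (e i) (e j) y) ^+ 2) / 4.
Proof.
move=> Op oe.
(* Coordinate divergence of [nabla_V V], its correction by the density, and the mixed blocks; the
   term [V(div V)] is zero. *)
exists (\sum_i 'D_'e_i (sp v) p 0 i - \sum_i B p (sp v p) 'e_i 0 i + mtrace p e (sp v p)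
  - (\sum_i \sum_j mixhv p v (e i) (e j) * mixvh p v (e j) (e i)) / 2) => y.
have Oz : O (lsubmx (row_mx p y)) by rewrite row_mxKl.
have oez : orthonormal (G (lsubmx (row_mx p y))) e by rewrite row_mxKl.
have cE i : ccurv C (row_mx p y) 'e_i (ver v) (ver v) 0 i =
    dfam C (row_mx p y) 'e_i (ver v) (ver v) 0 i - dfam C (row_mx p y) (ver v) 'e_i (ver v) 0 i
    + C (row_mx p y) 'e_i (C (row_mx p y) (ver v) (ver v)) 0 i
    - C (row_mx p y) (ver v) (C (row_mx p y) 'e_i (ver v)) 0 i.
  by rewrite /ccurv !mxE.
rewrite (eq_bigr _ (fun i _ => cE i)).
rewrite !big_split /= !sumrN.
rewrite (divergence v Oz) (derive_trace_vertical v Oz) (trace_levi_civita Oz oez).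
rewrite (trace_square_vertical Oz oez) levi_civita_horizontal // lhor !row_mxKl row_mxKr.
by move: (\sum_i _) (\sum_i _) (mtrace _ _ _) (\sum_i _) (\sum_i _) => *; ring.
Qed.

(* Subtracting the values at [y] and at [0] leaves a sum of squares. *)
Theorem einstein_flat p lam : O p ->
  (forall y v, \sum_i ccurv C (row_mx p y) 'e_i (row_mx 0 v) (row_mx 0 v) 0 i = lam * G p v v) ->
  forall a b y, ccurv B p a b y = 0.
Proof.
move=> Op ein; have [e oe] := orthonormal_frame (bG _) (symG _) (fun u => posG Op).
have dBp u v := dB u v Op.
have bd a : bilin (dfam B p a) by exact: dfam_bilin.
have bK y : bilin (fun a b => ccurv B p a b y).
  split=> [b|a] k u u'; rewrite /ccurv (dfam_linear dBp) !(bilin_Pl (bd _), bilin_Pl (bB _), bilin_Pr (bB _)).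
    by generalize_dfam; generalize3 B => *; apply/rowP => i; rewrite !mxE; ring.
  by generalize_dfam; generalize3 B => *; apply/rowP => i; rewrite !mxE; ring.
have lK a b : ccurv B p a b 0 = 0.
  by rewrite /ccurv !(bilin_0r (bd _), bilin_0r (bB _)) !(subr0, addr0).
have K0 v i j y : G p v (ccurv B p (e i) (e j) y) = 0.
  have [c Hc] := ricci_vertical v Op oe.
  have S0 : \sum_i \sum_j G p v (ccurv B p (e i) (e j) y) ^+ 2 = 0.
    have := Hc y; have := Hc 0; rewrite !ein [X in _ = _ + X / _ -> _]big1; last first.
      by move=> k _; rewrite big1 // => l _; rewrite lK (bilin_0r (bG _)) expr0n.
    by move: (\sum_i _) => S; lra.
  have nn k l : 0 <= G p v (ccurv B p (e k) (e l) y) ^+ 2 by exact: sqr_ge0.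
  move/psumr_eq0P : S0 => /(_ (fun k _ => sumr_ge0 _ (fun l _ => nn k l)))/(_ i isT).
  by move/psumr_eq0P => /(_ (fun l _ => nn i l))/(_ j isT)/eqP; rewrite sqrf_eq0 => /eqP.
(* [K0] holds for every [v], in particular for the curvature vector itself. *)
have Kij i j y : ccurv B p (e i) (e j) y = 0.
  apply/eqP/negPn/negP => N0; have := posG Op N0.
  by rewrite {1}K0 ltxx.
move=> a b y; rewrite (parseval (bG p) oe a) (parseval (bG p) oe b).
rewrite (bilin_suml (bK y)) big1 // => i _; rewrite (bilin_sumr (bK y)) big1 // => j _.
by rewrite (bilin_Zl (bK y)) (bilin_Zr (bK y)) Kij !scaler0.
Qed.

End SasakiRicci.

(** * From charts to the manifold *)

Section ManifoldCharts.
Context {R : realType} {n : nat} {M : manifold R n}.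
Implicit Types (a b c : chart_index M) (x : M) (U : set M) (p : 'rV[R]_n).
Let MP := manifoldP M.

Definition chart_codom a : set 'rV[R]_n := coord_dom a (chart_dom a).

Lemma open_chart_codom a : open (chart_codom a).
Proof. exact: domain_open. Qed.

Lemma open_coord_dom a U : mopen U -> open (coord_dom a U).
Proof. exact. Qed.

Lemma chart_codom_chart a x : chart_dom a x -> chart_codom a (chart a x).
Proof. by move=> ax; exists x. Qed.

Lemma coord_dom_chart a U x : chart_dom a x -> U x -> coord_dom a U (chart a x).
Proof. by move=> ax Ux; exists x. Qed.

Lemma coord_dom_sub a U : coord_dom a U `<=` chart_codom a.
Proof. by move=> _ [x [ax _] <-]; exists x. Qed.

Lemma chart_invK a p : chart_codom a p -> chart a (chart_inv a p) = p.
Proof. by case/coord_domP. Qed.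

Lemma chart_dom_inv a p : chart_codom a p -> chart_dom a (chart_inv a p).
Proof. by case/coord_domP. Qed.

Lemma mopenI U U' : mopen U -> mopen U' -> mopen (U `&` U').
Proof.
move=> oU oU' a; have -> : coord_dom a (U `&` U') = coord_dom a U `&` coord_dom a U'.
  apply/seteqP; split=> [_ [x [ax [Ux U'x]] <-]|_ [[x [ax Ux] <-] [x' [ax' Ux'] E]]].
    by split; exists x.
  have xx : x' = x by rewrite -(chartK MP ax') E (chartK MP ax).
  by exists x => //; split => //; split => //; rewrite -xx.
exact: openI.
Qed.

Lemma components_linear a x : chart_dom a x -> linear (@components _ _ M a x).
Proof. by move=> ax; apply: change_frame_linear => //; exact: domain_chart_at. Qed.

Lemma tangent_of_linear a x : chart_dom a x -> linear (@tangent_of _ _ M a x).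
Proof. by move=> ax; apply: change_frame_linear => //; exact: domain_chart_at. Qed.

Lemma components_chart_at x (v : tangent x) : components (chart_at x) v = v.
Proof. by apply: change_frame_id; exact: domain_chart_at. Qed.

Lemma components_change a b x (v : tangent x) : chart_dom a x -> chart_dom b x ->
  components b v = change_frame a b x (components a v).
Proof.
by move=> ax bx; rewrite /components change_frame_comp //; exact: domain_chart_at.
Qed.

Lemma components_inj a x (v w : tangent x) : chart_dom a x ->
  components a v = components a w -> v = w.
Proof. by move=> ax E; rewrite -(componentsK v ax) E componentsK. Qed.

Lemma transition_chart a b x : chart_dom a x -> transition a b (chart a x) = chart b x.
Proof. by move=> ax; rewrite /transition /= (chartK MP). Qed.

Lemma smooth_transition_sub a b U : U `<=` chart_dom b ->
  smooth (coord_dom a U) (transition a b).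
Proof.
move=> UB; apply: smooth_sub (transition_smooth MP a b) => _ [x [ax Ux] <-].
by exists x => //; split => //; exact: UB.
Qed.

(** For [u = 'e_i] this is the coordinate field. These fields serve as local frames and as test
    fields: any vector at a point of the chart is a value of one of them. *)
Definition cframe a (u : 'rV[R]_n) : vector_field M := fun x => tangent_of a x u.

Lemma field_in_chart_cframe a u p : chart_codom a p -> field_in_chart a (cframe a u) p = u.
Proof. by move=> /chart_dom_inv ap; rewrite /field_in_chart /cframe tangent_ofK. Qed.

Lemma field_in_chart_chart a (X : vector_field M) x : chart_dom a x ->
  field_in_chart a X (chart a x) = components a (X x).
Proof. by move=> ax; rewrite /field_in_chart (chartK MP). Qed.

Section Change.
Context (a b : chart_index M) (U : set M) (oU : mopen U) (Ua : U `<=` chart_dom a).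

Let tU p : coord_dom b U p -> coord_dom a U (transition b a p).
Proof. by move=> [x [bx Ux] <-]; rewrite transition_chart //; exists x => //; split => //; exact: Ua. Qed.

Let smooth_back {W : normedModType R} (F : 'rV[R]_n -> W) :
  smooth (coord_dom a U) F -> smooth (coord_dom b U) (F \o transition b a).
Proof.
move=> sF; apply: (@smooth_comp R 'rV[R]_n W n (coord_dom b U) (coord_dom a U) (transition b a) F) => //.
exact: smooth_transition_sub.
Qed.

(** The components in [b] are those in [a] multiplied by the derivative of the transition, both read
    through the inverse transition. Smoothness may thus be checked in one chart containing [U]. *)
Lemma smooth_field_change (X : vector_field M) :
  smooth (coord_dom a U) (field_in_chart a X) -> smooth (coord_dom b U) (field_in_chart b X).
Proof.
move=> sX.
have sD i : smooth (coord_dom b U) ('D_('e_i) (transition a b) \o transition b a).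
  have -> : coord_dom b U = coord_dom b (U `&` chart_dom b).
    by apply/seteqP; split=> [_ [x [bx Ux] <-]|_ [x [bx [Ux _]] <-]]; exists x.
  apply: (@smooth_comp _ _ _ _ _ (coord_dom a (U `&` chart_dom b))).
  - by apply: mopenI => //; exact: domain_open.
  - move=> _ [x [bx [Ux _]] <-]; rewrite transition_chart //.
    by exists x => //; split => //; exact: Ua.
  - by apply: smooth_transition_sub => x [Ux _]; exact: Ua.
  - by apply: smooth_derive; apply: smooth_transition_sub => x [].
apply: (@smooth_eq _ _ _ _ (fun p => \sum_(i < n)
    ((field_in_chart a X \o transition b a) p 0 i : R) *:
    ('D_('e_i) (transition a b) \o transition b a) p)); first exact: oU.
  move=> _ [x [bx Ux] <-]; have ax := Ua Ux.
  rewrite field_in_chart_chart // (components_change _ ax bx) /= transition_chart //.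
  rewrite field_in_chart_chart //.
  exact/esym/(linear_row_expand (components a (X x)) (change_frame_linear ax bx)).
have ob := (@open_coord_dom b U oU).
apply: (smooth_sum ob) => i; apply: (smooth_scale ob _ (sD i)).
exact: (smooth_coord i ob (smooth_back sX)).
Qed.

Lemma smooth_function_change (f : M -> R) :
  smooth (coord_dom a U) (f \o chart_inv a) -> smooth (coord_dom b U) (f \o chart_inv b).
Proof.
move=> sf; apply: smooth_eq (smooth_back sf); first exact: oU.
move=> _ [x [bx Ux] <-] /=; rewrite transition_chart // !(chartK MP) //.
exact: Ua.
Qed.

End Change.

Lemma smooth_field_chart a U (X : vector_field M) : mopen U -> U `<=` chart_dom a ->
  smooth (coord_dom a U) (field_in_chart a X) -> smooth_field U X.
Proof. by move=> oU Ua sX b; exact: smooth_field_change sX. Qed.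

Lemma smooth_function_chart a U (f : M -> R) : mopen U -> U `<=` chart_dom a ->
  smooth (coord_dom a U) (f \o chart_inv a) -> smooth_function U f.
Proof. by move=> oU Ua sf b; exact: smooth_function_change sf. Qed.

Lemma smooth_cframe a u : smooth_field (chart_dom a) (cframe a u).
Proof.
apply: (@smooth_field_chart a) => //; first exact: domain_open.
apply: (@smooth_eq _ _ _ (chart_codom a) (cst u)); last exact: smooth_cst.
  exact: open_chart_codom.
by move=> p ap; rewrite field_in_chart_cframe.
Qed.

Lemma smooth_field_sub U U' (X : vector_field M) : U' `<=` U -> smooth_field U X -> smooth_field U' X.
Proof.
move=> UU sX a; apply: smooth_sub (sX a) => _ [x [ax Ux] <-].
by exists x => //; split => //; exact: UU.
Qed.

(** The chain rule through the transition from [chart_at x], the chart in which [field_derive] is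
    defined. *)
Lemma field_derive_chart a (X : vector_field M) (f : M -> R) x : chart_dom a x ->
  differentiable (f \o chart_inv a) (chart a x) ->
  field_derive X f x = 'D_(components a (X x)) (f \o chart_inv a) (chart a x).
Proof.
move=> ax df; rewrite /field_derive /components /change_frame.
have bx := domain_chart_at MP x; set b := chart_at x in bx *.
have dt := change_frame_differentiable bx ax.
rewrite -(transition_chart a bx) in df *.
rewrite -(derive_comp (X x) dt df); apply: near_eq_derive; near=> p.
have : coord_dom b (chart_dom a) p.
  near: p; apply: open_nbhs_nbhs; split; first exact: domain_open.
  by exists x.
move=> [y [by_ ay] <-]; rewrite /= transition_chart // !(chartK MP) //.
Unshelve. all: by end_near. Qed.

(** Passing from [chart_at x] to [a], each derivative of components acquires a second derivative of
    the transition; by its symmetry this cancels in the difference. *)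
Lemma lie_bracket_chart a U (X Y : vector_field M) x : mopen U ->
  smooth_field U X -> smooth_field U Y -> U x -> chart_dom a x ->
  components a (lie_bracket X Y x) =
  'D_(components a (X x)) (field_in_chart a Y) (chart a x) -
  'D_(components a (Y x)) (field_in_chart a X) (chart a x).
Proof.
move=> oU sX sY Ux ax; have bx := domain_chart_at MP x.
rewrite /lie_bracket; set b := chart_at x in bx *; set p := chart b x.
pose V := coord_dom b (U `&` chart_dom a).
have oV : open V by apply: mopenI => //; exact: domain_open.
have Vp : V p by exists x.
pose phi := transition b a.
have sphi : smooth V phi by apply: smooth_transition_sub => y [].
have dphi q : V q -> differentiable phi q by exact: smooth_differentiable.
(* Equal to ['D_u phi q] on [V], but linear in [u] at every [q], as [derive_linear_family]
   requires. *)
pose A q (u : 'rV[R]_n) : 'rV[R]_n := \sum_i u 0 i *: 'D_('e_i) phi q.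
have lA q : linear (A q).
  move=> k u v; rewrite /A scaler_sumr -big_split; apply: eq_bigr => i _.
  by rewrite !mxE scalerDl scalerA.
have AE q u : V q -> A q u = 'D_u phi q.
  by move=> /dphi dq; rewrite (linear_row_expand u (derive_dir_linear dq)).
have dA u : differentiable (fun q => A q u) p.
  apply: differentiable_sumf => i; apply: differentiable_scale => //.
  exact: smooth_differentiable (smooth_derive _ sphi) Vp.
have DA u v : 'D_u (fun q => A q v) p = 'D_u ('D_v phi) p.
  by apply: near_eq_derive; near=> q; apply: AE; near: q; exact: open_nbhs_nbhs.
have sZ (Z : vector_field M) c : smooth_field U Z -> chart_dom c x ->
    differentiable (field_in_chart c Z) (chart c x).
  by move=> s cx; exact: (smooth_differentiable (s c) (coord_dom_chart cx Ux)).
have key (Z Z' : vector_field M) : smooth_field U Z -> smooth_field U Z' ->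
    'D_(components a (Z x)) (field_in_chart a Z') (chart a x) =
    'D_(Z x) ('D_(Z' x) phi) p + A p ('D_(Z x) (field_in_chart b Z') p).
  move=> sZ1 sZ2.
  have N q : V q -> (field_in_chart a Z' \o phi) q = A q (field_in_chart b Z' q).
    move=> Vq; rewrite (AE q _ Vq); case: (Vq) => y [by_ [Uy ay]] yq.
    have pa : phi q = chart a y by rewrite -yq; exact: transition_chart.
    rewrite /= pa (field_in_chart_chart _ ay) -yq (field_in_chart_chart _ by_).
    exact: components_change.
  have EZ : field_in_chart b Z' p = Z' x.
    exact: (etrans (field_in_chart_chart Z' bx) (components_chart_at (Z' x))).
  have dZ : differentiable (field_in_chart a Z') (phi p).
    by rewrite [phi p](transition_chart a bx); exact: sZ.
  have D1 := derive_comp (Z x) (dphi _ Vp) dZ.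
  have D2 := @near_eq_derive _ _ _ (field_in_chart a Z' \o phi)
    (fun q => A q (field_in_chart b Z' q)) p (Z x) (filterS N (open_nbhs_nbhs (conj oV Vp))).
  have {}D2 := D2 (nbhs_filter p).
  have D3 := derive_linear_family lA dA (sZ _ _ sZ2 bx) (Z x).
  rewrite EZ DA in D3; rewrite -(transition_chart a bx).
  exact: (etrans (esym D1) (etrans D2 D3)).
have K1 := key _ _ sX sY; have K2 := key _ _ sY sX.
have S : 'D_(X x) ('D_(Y x) phi) p = 'D_(Y x) ('D_(X x) phi) p := schwarz_row _ _ oV Vp sphi.
rewrite S in K1; apply: (etrans _ (esym (congr2 (fun s t => s - t) K1 K2))).
have F w : components a (w : tangent x) = A p w := esym (AE p w Vp).
rewrite F; clear K1 K2 S.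
rewrite /=; generalize ('D_(X x) (field_in_chart b Y) p) ('D_(Y x) (field_in_chart b X) p)
  ('D_(Y x) ('D_(X x) phi) p) => w1 w2 T.
by rewrite (linear_funD (lA p)) (linear_funN (lA p)) opprD addrACA subrr add0r.
Unshelve. all: by end_near. Qed.

Lemma smooth_lie_bracket U (X Y : vector_field M) : mopen U ->
  smooth_field U X -> smooth_field U Y -> smooth_field U (lie_bracket X Y).
Proof.
move=> oU sX sY a; have oa := (@open_coord_dom a U oU).
pose A (Z : vector_field M) p (u : 'rV[R]_n) : 'rV[R]_n := \sum_i u 0 i *: 'D_('e_i) (field_in_chart a Z) p.
have lA Z p : linear (A Z p).
  move=> k u v; rewrite /A scaler_sumr -big_split; apply: eq_bigr => i _.
  by rewrite !mxE scalerDl scalerA.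
have sA Z u : smooth_field U Z -> smooth (coord_dom a U) (fun p => A Z p u).
  move=> sZ; apply: (smooth_sum oa) => i.
  exact: (smooth_scale oa (@smooth_cst _ _ _ _ (u 0 i)) (smooth_derive _ (sZ a))).
have sAA Z Z' : smooth_field U Z -> smooth_field U Z' ->
    smooth (coord_dom a U) (fun p => A Z' p (field_in_chart a Z p)).
  by move=> s1 s2; exact: (smooth_linear_family oa (lA Z') (fun u => sA Z' u s2) (s1 a)).
have sN : smooth (coord_dom a U) (fun p => (-1 : R) *: A X p (field_in_chart a Y p)).
  by apply: (smooth_scale oa _ (sAA _ _ sY sX)); exact: smooth_cst.
apply: (smooth_eq oa _ (smoothD oa (sAA _ _ sX sY) sN)) => _ [x [ax Ux] <-].
rewrite field_in_chart_chart // (lie_bracket_chart oU sX sY Ux ax) -!field_in_chart_chart //.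
have E Z u : smooth_field U Z -> 'D_u (field_in_chart a Z) (chart a x) = A Z (chart a x) u.
  move=> sZ; apply: (linear_row_expand u (derive_dir_linear _)).
  exact: (smooth_differentiable (sZ a) (coord_dom_chart ax Ux)).
rewrite (E _ _ sX) (E _ _ sY) -[X in _ = _ + X]scaleN1r.
by [].
Qed.

End ManifoldCharts.

Arguments open_coord_dom {R n M} a {U}.
Arguments open_chart_codom {R n M} a.
Arguments smooth_cframe {R n M} a u.

(** * Smooth fields and functions on an open set *)

Section SmoothFields.
Context {R : realType} {n : nat} {M : manifold R n}.
Implicit Types (a b c : chart_index M) (x : M) (U : set M) (X Y Z : vector_field M) (f : M -> R).
Let MP := manifoldP M.

Lemma smooth_fieldP U f X Y : mopen U -> smooth_function U f ->
  smooth_field U X -> smooth_field U Y -> smooth_field U (fun y => f y *: X y + Y y).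
Proof.
move=> oU sf sX sY a; have oa := open_coord_dom a oU.
apply: (smooth_eq oa _ (smoothD oa (smooth_scale oa (sf a) (sX a)) (sY a))).
move=> _ [x [ax Ux] <-]; rewrite [RHS]field_in_chart_chart //.
rewrite (components_linear ax) -!field_in_chart_chart //.
by rewrite -[LHS]/(f (chart_inv a (chart a x)) *: _ + _) (chartK MP).
Qed.


Lemma smooth_function_cst U (k : R) : smooth_function U (fun=> k).
Proof. by move=> a; exact: smooth_cst. Qed.

Lemma smooth_fieldZ U f X : mopen U -> smooth_function U f -> smooth_field U X ->
  smooth_field U (fun y => f y *: X y).
Proof.
move=> oU sf sX a; have oa := open_coord_dom a oU.
apply: (smooth_eq oa _ (smooth_scale oa (sf a) (sX a))).
move=> _ [x [ax Ux] <-]; rewrite [RHS]field_in_chart_chart //.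
rewrite (linear_funZ (components_linear ax)) -field_in_chart_chart //=.
by rewrite (chartK MP).
Qed.

Lemma smooth_field0 U : mopen U -> smooth_field U ((fun=> 0) : vector_field M).
Proof.
move=> oU a; have oa := open_coord_dom a oU.
apply: (smooth_eq oa _ (@smooth_cst _ _ _ _ 0)).
move=> _ [x [ax Ux] <-]; rewrite [RHS]field_in_chart_chart //.
by rewrite (linear_fun0 (components_linear ax)).
Qed.

Lemma smooth_fieldD U X Y : mopen U -> smooth_field U X -> smooth_field U Y ->
  smooth_field U (fun y => X y + Y y).
Proof.
move=> oU sX sY a; have oa := open_coord_dom a oU.
apply: (smooth_eq oa _ (smoothD oa (sX a) (sY a))).
move=> _ [x [ax Ux] <-]; rewrite [RHS]field_in_chart_chart //.
by rewrite (linear_funD (components_linear ax)) -!field_in_chart_chart.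
Qed.

Lemma smooth_fieldB U X Y : mopen U -> smooth_field U X -> smooth_field U Y ->
  smooth_field U (fun y => X y - Y y).
Proof.
move=> oU sX sY; have := smooth_fieldP oU (@smooth_function_cst U (-1)) sY sX.
by congr smooth_field; apply/funext => x; rewrite scaleN1r addrC.
Qed.

Lemma smooth_field_sum U k (F : 'I_k -> vector_field M) : mopen U ->
  (forall i, smooth_field U (F i)) -> smooth_field U (fun y => \sum_(i < k) F i y).
Proof.
move=> oU; elim: k F => [|k IH] F sF.
  have := smooth_field0 oU; congr smooth_field.
  by apply/funext => y; rewrite big_ord0.
have := smooth_fieldD oU (IH (fun i => F (widen_ord (leqnSn k) i)) (fun i => sF _)) (sF ord_max).
by congr smooth_field; apply/funext => y; rewrite big_ord_recr.
Qed.

Definition zero_on U x : R := if pselect (U x) is left _ then 0 else 1.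

Lemma zero_onE U x : U x -> zero_on U x = 0.
Proof. by rewrite /zero_on; case: pselect. Qed.

Lemma smooth_zero_on U : mopen U -> smooth_function U (zero_on U).
Proof.
move=> oU a; apply: (@smooth_eq _ _ _ _ (cst 0)); last exact: smooth_cst.
  exact: oU.
by move=> _ [x [ax Ux] <-] /=; rewrite (chartK MP) // zero_onE.
Qed.

End SmoothFields.

(** * Locality of connections and Christoffel symbols *)

Section Connections.
Context {R : realType} {n : nat} {M : manifold R n}.
Context (D : vector_field M -> vector_field M -> vector_field M) (hD : affine_connection D).
Implicit Types (a b c : chart_index M) (x : M) (U : set M) (X Y Z : vector_field M) (f : M -> R).
Let MP := manifoldP M.

Section OnOpen.
Context {U : set M} (oU : mopen U).

Lemma connection_0l Y x : smooth_field U Y -> U x -> D (fun=> 0) Y x = 0.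
Proof.
move=> sY Ux; have s0 := smooth_field0 oU.
have := connection_linear hD oU (@smooth_function_cst _ _ M U 1) s0 s0 sY Ux.
have -> : (fun y => 1 *: 0 + 0) = (fun=> 0) :> vector_field M.
  by apply/funext => y; rewrite scaler0 addr0.
by rewrite scale1r => E; apply: (@addrI _ (D (fun=> 0) Y x)); rewrite -E addr0.
Qed.

(* An affine connection is local although the fields are arbitrary off [U]: a
   field vanishing on [U] is its own product by the indicator of the complement. *)
Lemma connection_eql X X' Y x : smooth_field U X -> smooth_field U X' -> smooth_field U Y ->
  (forall y, U y -> X y = X' y) -> U x -> D X Y x = D X' Y x.
Proof.
move=> sX sX' sY XX Ux; have sZ := smooth_fieldB oU sX sX'; set Z := (fun y => _) in sZ.
have Z0 : D Z Y x = 0.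
  have := connection_linear hD oU (smooth_zero_on oU) sZ (smooth_field0 oU) sY Ux.
  rewrite zero_onE // scale0r add0r connection_0l // => <-; congr (D _ Y x).
  apply/funext => y; rewrite addr0 /zero_on; case: pselect => [Uy|_]; last by rewrite scale1r.
  by rewrite /Z XX // subrr scaler0.
have := connection_linear hD oU (@smooth_function_cst _ _ M U 1) sX' sZ sY Ux.
rewrite scale1r Z0 addr0 => <-; congr (D _ Y x).
by apply/funext => y; rewrite scale1r /Z addrC subrK.
Qed.

Lemma connection_eqr X Y Y' x : smooth_field U X -> smooth_field U Y -> smooth_field U Y' ->
  (forall y, U y -> Y y = Y' y) -> U x -> D X Y x = D X Y' x.
Proof.
move=> sX sY sY' YY Ux; have sZ := smooth_fieldB oU sY sY'; set Z := (fun y => _) in sZ.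
have Z0 : D X Z x = 0.
  have := connection_leibniz hD oU (smooth_zero_on oU) sX sZ Ux.
  rewrite zero_onE // scale0r addr0 {2}/Z YY // subrr scaler0 => <-; congr (D X _ x).
  apply/funext => y; rewrite /zero_on; case: pselect => [Uy|_]; last by rewrite scale1r.
  by rewrite /Z YY // subrr scaler0.
have := connection_additive hD oU sX sY' sZ Ux.
rewrite Z0 addr0 => <-; congr (D X _ x).
by apply/funext => y; rewrite /Z addrC subrK.
Qed.

Lemma connection_suml k (f : 'I_k -> M -> R) (X : 'I_k -> vector_field M) Y x :
  (forall i, smooth_function U (f i)) -> (forall i, smooth_field U (X i)) ->
  smooth_field U Y -> U x ->
  D (fun y => \sum_(i < k) f i y *: X i y) Y x = \sum_(i < k) f i x *: D (X i) Y x.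
Proof.
move=> sf sX sY Ux; elim: k f X sf sX => [|k IH] f X sf sX.
  have -> : (fun y => \sum_(i < 0) f i y *: X i y) = (fun=> 0) :> vector_field M.
    by apply/funext => y; rewrite big_ord0.
  by rewrite big_ord0 connection_0l.
have S := IH (fun i => f (lift ord0 i)) (fun i => X (lift ord0 i)) (fun i => sf _) (fun i => sX _).
have sR := smooth_field_sum oU (fun i : 'I_k => smooth_fieldZ oU (sf (lift ord0 i)) (sX (lift ord0 i))).
have L := connection_linear hD oU (sf ord0) (sX ord0) sR sY Ux.
rewrite big_ord_recl -S -L; congr (D _ Y x).
by apply/funext => y; rewrite big_ord_recl.
Qed.

Lemma connection_sumr k X (Y : 'I_k -> vector_field M) x :
  smooth_field U X -> (forall i, smooth_field U (Y i)) -> U x ->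
  D X (fun y => \sum_(i < k) Y i y) x = \sum_(i < k) D X (Y i) x.
Proof.
move=> sX sY Ux; elim: k Y sY => [|k IH] Y sY.
  rewrite big_ord0; have s0 := smooth_field0 oU.
  have := connection_additive hD oU sX s0 s0 Ux.
  have -> : (fun y => 0 + 0) = (fun=> 0) :> vector_field M by apply/funext => y; rewrite addr0.
  have -> : (fun y => \sum_(i < 0) Y i y) = (fun=> 0) :> vector_field M by apply/funext => y; rewrite big_ord0.
  by move=> E; apply: (@addrI _ (D X (fun=> 0) x)); rewrite -E addr0.
have S := IH (fun i => Y (lift ord0 i)) (fun i => sY _).
have sR := smooth_field_sum oU (fun i : 'I_k => sY (lift ord0 i)).
have L := connection_additive hD oU sX (sY ord0) sR Ux.
rewrite big_ord_recl -S -L; congr (D X _ x).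
by apply/funext => y; rewrite big_ord_recl.
Qed.

End OnOpen.

(** The Christoffel symbols as a bilinear map. Expanding in the coordinate frame makes it bilinear
    at every [p], also off the image of the chart, where [D] applied to frames with components [u]
    and [v] is uncontrolled. *)
Definition gamma a (p u v : 'rV[R]_n) : 'rV[R]_n :=
  \sum_(i < n) u 0 i *: (\sum_(j < n) v 0 j *:
    components a (D (cframe a 'e_i) (cframe a 'e_j) (chart_inv a p))).

Lemma gamma_bilin a p : bilin (gamma a p).
Proof.
split=> [v|u] k w w'; rewrite /gamma scaler_sumr -big_split; apply: eq_bigr => i _.
  by rewrite !mxE scalerDl scalerA.
rewrite /= scalerA [k * _]mulrC -scalerA -scalerDr; congr (_ *: _).
rewrite scaler_sumr -big_split; apply: eq_bigr => j _.
by rewrite !mxE scalerDl scalerA.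
Qed.

Lemma smooth_gamma a u v : smooth (chart_codom a) (fun p => gamma a p u v).
Proof.
have oa := open_chart_codom a.
apply: (smooth_sum oa) => i; apply: (smooth_scale oa); first exact: smooth_cst.
apply: (smooth_sum oa) => j; apply: (smooth_scale oa); first exact: smooth_cst.
have ma : mopen (chart_dom a) by exact: domain_open.
exact: (connection_smooth hD ma (smooth_cframe a 'e_i) (smooth_cframe a 'e_j)).
Qed.

Lemma field_frame_expand a X x : chart_dom a x ->
  X x = \sum_(i < n) (components a (X x) 0 i : R) *: cframe a 'e_i x.
Proof.
move=> ax; rewrite -{1}(componentsK (X x) ax).
exact: (linear_row_expand (components a (X x)) (tangent_of_linear ax)).
Qed.

Lemma smooth_component a U X i : mopen U -> U `<=` chart_dom a -> smooth_field U X ->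
  smooth_function U (fun x => components a (X x) 0 i : R).
Proof.
move=> oU Ua sX; apply: (smooth_function_chart oU Ua).
apply: (smooth_eq (open_coord_dom a oU) _ (smooth_coord i (open_coord_dom a oU) (sX a))).
by move=> _ [x [ax Ux] <-].
Qed.

(** Both fields are expanded in the coordinate frame. They agree with their expansions only on the
    chart domain, so locality of [D] is what permits the replacement. *)
Lemma components_connection a U X Y x : mopen U -> smooth_field U X -> smooth_field U Y ->
  U x -> chart_dom a x ->
  components a (D X Y x) = 'D_(components a (X x)) (field_in_chart a Y) (chart a x)
    + gamma a (chart a x) (components a (X x)) (components a (Y x)).
Proof.
move=> oU sX sY Ux ax.
pose V := U `&` chart_dom a.
have oV : mopen V by apply: mopenI => //; exact: domain_open.
have {}sX : smooth_field V X by apply: smooth_field_sub sX => y [].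
have {}sY : smooth_field V Y by apply: smooth_field_sub sY => y [].
have Va : V `<=` chart_dom a by move=> y [].
have Vx : V x by [].
have sE i : smooth_field V (cframe a 'e_i) := smooth_field_sub Va (smooth_cframe a 'e_i).
have sXi i := smooth_component i oV Va sX.
have sYi i := smooth_component i oV Va sY.
have E1 : D X Y x = \sum_(i < n) (components a (X x) 0 i : R) *: D (cframe a 'e_i) Y x.
  have sS := smooth_field_sum oV (fun i => smooth_fieldZ oV (sXi i) (sE i)).
  have L1 := connection_eql oV sX sS sY (fun y Vy => field_frame_expand X (Va y Vy)) Vx.
  exact: (etrans L1 (connection_suml oV sXi sE sY Vx)).
have dYa := smooth_differentiable (sY a) (coord_dom_chart ax Vx).
have dY i : 'D_('e_i) (field_in_chart a Y) (chart a x) =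
    \sum_(j < n) 'D_('e_i) (fun p => field_in_chart a Y p 0 j : R) (chart a x) *: 'e_j.
  rewrite {1}(row_sum_delta ('D_('e_i) (field_in_chart a Y) (chart a x))).
  by apply: eq_bigr => j _; rewrite (derive_mx (diff_derivable dYa)) mxE.
have F i j : field_derive (cframe a 'e_i) (fun y => components a (Y y) 0 j : R) x =
    'D_('e_i) (fun p => field_in_chart a Y p 0 j : R) (chart a x).
  have dYj := smooth_differentiable (sYi j a) (coord_dom_chart ax Vx).
  by rewrite (field_derive_chart _ ax dYj) (tangent_ofK _ ax).
have E2 i : components a (D (cframe a 'e_i) Y x) = 'D_('e_i) (field_in_chart a Y) (chart a x) +
    \sum_(j < n) (components a (Y x) 0 j : R) *:
      components a (D (cframe a 'e_i) (cframe a 'e_j) x).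
  have sYE j := smooth_fieldZ oV (sYi j) (sE j).
  have sSY := smooth_field_sum oV sYE.
  have L1 := connection_eqr oV (sE i) sY sSY (fun y Vy => field_frame_expand Y (Va y Vy)) Vx.
  have L2 := connection_sumr oV (sE i) sYE Vx.
  have L3 j := connection_leibniz hD oV (sYi j) (sE i) (sE j) Vx.
  rewrite (etrans L1 L2) (eq_bigr _ (fun j _ => L3 j)).
  rewrite (linear_fun_sum (components_linear ax)) dY -big_split.
  apply: eq_bigr => j _; rewrite (linear_funD (components_linear ax)).
  rewrite !(linear_funZ (components_linear ax)) F.
  by congr (_ *: _ + _); exact: tangent_ofK.
rewrite E1 (linear_fun_sum (components_linear ax)) (linear_row_expand _ (derive_dir_linear dYa)).
rewrite /gamma -big_split; apply: eq_bigr => i _.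
rewrite (linear_funZ (components_linear ax)) E2 scalerDr.
by rewrite (chartK MP).
Qed.

End Connections.

Section Jacobian.
Context {R : realType} {V : normedModType R} {k : nat}.

(* Agrees with [fun w => 'D_w f p] where [f] is differentiable, but is linear in
   [w] at every point. *)
Definition jacobian_map (f : 'rV[R]_k -> V) (p w : 'rV[R]_k) : V :=
  \sum_(i < k) w 0 i *: 'D_('e_i) f p.

Lemma jacobian_map_linear f p : linear (jacobian_map f p).
Proof.
move=> c u v; rewrite /jacobian_map scaler_sumr -big_split; apply: eq_bigr => i _.
by rewrite !mxE scalerDl scalerA.
Qed.

Lemma jacobian_mapE f p w : differentiable f p -> jacobian_map f p w = 'D_w f p.
Proof. by move=> df; rewrite (linear_row_expand w (derive_dir_linear df)). Qed.

Lemma smooth_jacobian_map (U : set 'rV[R]_k) (f : 'rV[R]_k -> V) w : open U -> smooth U f ->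
  smooth U (fun p => jacobian_map f p w).
Proof.
move=> oU sf; apply: (smooth_sum oU) => i.
exact: (smooth_scale oU (@smooth_cst _ _ _ _ (w 0 i)) (smooth_derive _ sf)).
Qed.

(** Both the point and the direction of the inner derivative move; this is the form in which an
    iterated covariant derivative differentiates [Z]. *)
Lemma derive_moving_direction (U : set 'rV[R]_k) (f : 'rV[R]_k -> V)
    (X : 'rV[R]_k -> 'rV[R]_k) p u :
  open U -> U p -> smooth U f -> smooth U X ->
  'D_u (fun q => 'D_(X q) f q) p = 'D_u ('D_(X p) f) p + 'D_('D_u X p) f p.
Proof.
move=> oU Up sf sX.
have df q : U q -> differentiable f q by exact: smooth_differentiable.
have N1 : {near p, (fun q => 'D_(X q) f q) =1 (fun q => jacobian_map f q (X q))}.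
  by apply: filterS (open_nbhs_nbhs (conj oU Up)) => q Uq; rewrite jacobian_mapE //; exact: df.
have N2 : {near p, (fun q => jacobian_map f q (X p)) =1 (fun q => 'D_(X p) f q)}.
  by apply: filterS (open_nbhs_nbhs (conj oU Up)) => q Uq; rewrite jacobian_mapE //; exact: df.
rewrite (near_eq_derive u N1) -(near_eq_derive u N2) -(jacobian_mapE _ (df _ Up)).
apply: (derive_linear_family (jacobian_map_linear f)).
  by move=> w; exact: (smooth_differentiable (smooth_jacobian_map w oU sf) Up).
exact: (smooth_differentiable sX Up).
Qed.

End Jacobian.

Ltac generalize_derive := repeat match goal with
  | |- context [@derive ?R ?V ?W ?f ?a ?v] => generalize (@derive R V W f a v); intro end.

(** * Torsion and curvature in a chart *)

Section CurvatureInCharts.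
Context {R : realType} {n : nat} {M : manifold R n}.
Context (D : vector_field M -> vector_field M -> vector_field M) (hD : affine_connection D).
Implicit Types (a : chart_index M) (x : M) (U : set M) (X Y Z : vector_field M).
Let MP := manifoldP M.

Lemma derive_field_cframe a u w x : chart_dom a x ->
  'D_w (field_in_chart a (cframe a u)) (chart a x) = 0.
Proof.
move=> ax; have N : {near chart a x, field_in_chart a (cframe a u) =1 cst u}.
  have O := open_nbhs_nbhs (conj (open_chart_codom a) (chart_codom_chart ax)).
  by apply: filterS O => q aq; exact: field_in_chart_cframe.
exact: (etrans (near_eq_derive w N) (derive_cst u (chart a x) w)).
Qed.

Lemma gamma_frame a u v x : chart_dom a x ->
  components a (D (cframe a u) (cframe a v) x) = gamma D a (chart a x) u v.
Proof.
move=> ax; rewrite (components_connection hD (domain_open MP a) (smooth_cframe a u) (smooth_cframe a v) ax ax).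
rewrite !(tangent_ofK _ ax).
by rewrite derive_field_cframe // add0r.
Qed.

Section Fields.
Context (U : set M) (oU : mopen U) (X Y : vector_field M)
  (sX : smooth_field U X) (sY : smooth_field U Y) (x : M) (Ux : U x).
Let a := chart_at x.
Let p := chart a x.
Let ax : chart_dom a x. Proof. exact: domain_chart_at. Qed.
Let oa : open (coord_dom a U). Proof. exact: open_coord_dom. Qed.
Let Up : coord_dom a U p. Proof. exact: coord_dom_chart. Qed.

Let at_p Z : field_in_chart a Z p = Z x.
Proof. exact: (etrans (field_in_chart_chart Z ax) (components_chart_at (Z x))). Qed.

Let connection_at Z W : smooth_field U Z -> smooth_field U W ->
  D Z W x = 'D_(Z x) (field_in_chart a W) p + gamma D a p (Z x) (W x).
Proof.
move=> sZ sW; have := components_connection hD oU sZ sW Ux ax.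
by rewrite !components_chart_at.
Qed.

Lemma torsion_gamma : 
  torsion D X Y x = ctorsion (gamma D (chart_at x)) (chart (chart_at x) x) (X x) (Y x).
Proof.
rewrite -/a -/p.
have L : lie_bracket X Y x = 'D_(X x) (field_in_chart a Y) p - 'D_(Y x) (field_in_chart a X) p by [].
rewrite /torsion (connection_at sX sY) (connection_at sY sX) L /ctorsion.
generalize ('D_(X x) (field_in_chart a Y) p) ('D_(Y x) (field_in_chart a X) p).
generalize (gamma D a p (X x) (Y x)) (gamma D a p (Y x) (X x)) => A B C E.
by rewrite opprD addrACA [C - E + _]addrC addrK.
Qed.

(** In [second], the second derivatives of [Z] and the terms where [gamma] meets a first derivative
    of [Z] become symmetric and cancel on exchanging [X] and [Y]; the derivatives of the components
    of [X] and [Y] are absorbed by the bracket term. *)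
Lemma curvature_gamma Z : smooth_field U Z ->
  curvature D X Y Z x = ccurv (gamma D (chart_at x)) (chart (chart_at x) x) (X x) (Y x) (Z x).
Proof.
rewrite -/a -/p => sZ.
have bg := gamma_bilin D a.
have dg u v q : coord_dom a U q -> differentiable (fun q => gamma D a q u v) q.
  by move=> /coord_dom_sub aq; exact: (smooth_differentiable (smooth_gamma hD u v) aq).
have second V W : smooth_field U V -> smooth_field U W ->
    D V (D W Z) x =
    'D_(V x) ('D_(W x) (field_in_chart a Z)) p
    + 'D_('D_(V x) (field_in_chart a W) p) (field_in_chart a Z) p
    + (dfam (gamma D a) p (V x) (W x) (Z x) + gamma D a p ('D_(V x) (field_in_chart a W) p) (Z x)
       + gamma D a p (W x) ('D_(V x) (field_in_chart a Z) p))
    + (gamma D a p (V x) ('D_(W x) (field_in_chart a Z) p) + gamma D a p (V x) (gamma D a p (W x) (Z x))).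
  move=> sV sW; have sDWZ := connection_smooth hD oU sW sZ.
  rewrite (connection_at sV sDWZ) (connection_at sW sZ) (bilin_Dr (bg p)); congr (_ + _).
  have dW := smooth_differentiable (sW a) Up; have dZ := smooth_differentiable (sZ a) Up.
  pose f1 q := 'D_(field_in_chart a W q) (field_in_chart a Z) q.
  pose f2 q := gamma D a q (field_in_chart a W q) (field_in_chart a Z q).
  have N : {near p, field_in_chart a (D W Z) =1 f1 + f2}.
    apply: filterS (open_nbhs_nbhs (conj oa Up)) => _ [y [ay Uy] <-].
    rewrite (field_in_chart_chart _ ay) (components_connection hD oU sW sZ Uy ay).
    by rewrite -[RHS]/(f1 _ + f2 _) /f1 /f2 !(field_in_chart_chart _ ay).
  have d2 : differentiable f2 p := differentiable_bilin_family bg (fun u v => dg u v p Up) dW dZ.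
  have d1 : differentiable f1 p.
    have N1 : {near p, (fun q => jacobian_map (field_in_chart a Z) q (field_in_chart a W q)) =1 f1}.
      apply: filterS (open_nbhs_nbhs (conj oa Up)) => q Uq.
      exact: (jacobian_mapE _ (smooth_differentiable (sZ a) Uq)).
    apply: (near_eq_differentiable N1).
    apply: (differentiable_linear_family (jacobian_map_linear (field_in_chart a Z)) _ dW).
    by move=> w; exact: (smooth_differentiable (smooth_jacobian_map w oa (sZ a)) Up).
  have E1 := derive_moving_direction (V x) oa Up (sZ a) (sW a).
  have E2 := derive_bilin_family bg (fun u v => dg u v p Up) (V x) dW dZ.
  rewrite !at_p in E1 E2.
  exact: (etrans (near_eq_derive (V x) N)
    (etrans (deriveD (diff_derivable d1) (diff_derivable d2)) (congr2 _ E1 E2))).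
have sL := smooth_lie_bracket oU sX sY.
have S : 'D_(Y x) ('D_(X x) (field_in_chart a Z)) p = 'D_(X x) ('D_(Y x) (field_in_chart a Z)) p.
  exact: (schwarz_row _ _ oa Up (sZ a)).
have dZ := smooth_differentiable (sZ a) Up.
have KL : 'D_(lie_bracket X Y x) (field_in_chart a Z) p =
    'D_('D_(X x) (field_in_chart a Y) p) (field_in_chart a Z) p -
    'D_('D_(Y x) (field_in_chart a X) p) (field_in_chart a Z) p.
  have L := linear_funD (derive_dir_linear dZ) ('D_(X x) (field_in_chart a Y) p)
    (- 'D_(Y x) (field_in_chart a X) p).
  by apply: (etrans L); congr (_ + _); exact: (linear_funN (derive_dir_linear dZ)).
have KG : gamma D a p (lie_bracket X Y x) (Z x) =
    gamma D a p ('D_(X x) (field_in_chart a Y) p) (Z x) -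
    gamma D a p ('D_(Y x) (field_in_chart a X) p) (Z x).
  have L := bilin_Dl (bg p) ('D_(X x) (field_in_chart a Y) p)
    (- 'D_(Y x) (field_in_chart a X) p) (Z x).
  by apply: (etrans L); congr (_ + _); exact: (bilin_Nl (bg p)).
rewrite /curvature; have K1 := second _ _ sX sY; have K2 := second _ _ sY sX.
have K3 := etrans (connection_at sL sZ) (congr2 _ KL KG).
apply: (etrans (congr2 _ (congr2 (fun s t => s - t) K1 K2) (congr1 -%R K3))).
move: S; clear; rewrite /ccurv /= => S.
match goal with S : ?s = ?t |- _ => move: S; generalize s t; intros ? ? -> end.
generalize_derive.
generalize_dfam; intros.
repeat match goal with |- context [gamma D a p ?u ?v] => generalize (gamma D a p u v); intro end.
by apply/rowP => i; rewrite !mxE; ring.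
Qed.

End Fields.

(** The vanishing is stated on the whole image of every chart, not just at [x] in [chart_at x],
    since the Bianchi identity differentiates it. *)
Lemma torsion_freeP : torsion_free D <->
  forall a p u v, chart_codom a p -> ctorsion (gamma D a) p u v = 0.
Proof.
split=> [tf a _ u v [x [ax _] <-]|c0 U X Y oU sX sY x Ux]; last first.
  by rewrite (torsion_gamma oU sX sY Ux) c0 //; exact/chart_codom_chart/domain_chart_at.
have T0 := tf _ _ _ (domain_open MP a) (smooth_cframe a u) (smooth_cframe a v) x ax.
have E w w' : D (cframe a w) (cframe a w') x = tangent_of a x (gamma D a (chart a x) w w').
  by rewrite -(gamma_frame w w' ax) componentsK.
have B0 : components a (lie_bracket (cframe a u) (cframe a v) x) = 0.
  apply: (etrans (lie_bracket_chart (domain_open MP a) (smooth_cframe a u) (smooth_cframe a v) ax ax)).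
  apply: (etrans _ (subrr 0)).
  exact: (congr2 (fun s t => s - t) (derive_field_cframe _ _ ax) (derive_field_cframe _ _ ax)).
move/(congr1 (@components _ _ M a x)): T0; rewrite /torsion (linear_fun0 (components_linear ax)).
rewrite !(linear_funD (components_linear ax)) !(linear_funN (components_linear ax)) B0 subr0.
by rewrite !gamma_frame.
Qed.

Lemma curvature_free_gamma x u v w : curvature_free D ->
  ccurv (gamma D (chart_at x)) (chart (chart_at x) x) u v w = 0.
Proof.
move=> cf; have ax := domain_chart_at MP x; set a := chart_at x in ax *.
have s t := smooth_cframe a t.
have := cf _ _ _ _ (domain_open MP a) (s u) (s v) (s w) x ax.
rewrite (curvature_gamma (domain_open MP a) (s u) (s v) ax (s w)) -/a.
have E t : cframe a t x = t by rewrite -[LHS]components_chart_at tangent_ofK.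
by rewrite !E.
Qed.

End CurvatureInCharts.

(** * Metrics and duality in a chart *)

Section MetricInCharts.
Context {R : realType} {n : nat} {M : manifold R n}.
Context (g : covariant_tensor2 M) (hg : riemannian_metric g).
Implicit Types (a : chart_index M) (x : M) (U : set M).
Let MP := manifoldP M.

Lemma metric_bilin x : bilin (@g x).
Proof.
split=> [v|u] k w w'; first exact: (Defs.metric_linear hg).
by rewrite !(Defs.metric_sym hg u) (Defs.metric_linear hg).
Qed.

Definition metric_in_chart a (p u v : 'rV[R]_n) : R :=
  \sum_(i < n) u 0 i *: (\sum_(j < n) v 0 j *:
    g (cframe a 'e_i (chart_inv a p)) (cframe a 'e_j (chart_inv a p))).

Lemma metric_in_chart_bilin a p : bilin (metric_in_chart a p).
Proof.
split=> [v|u] k w w'; rewrite /metric_in_chart scaler_sumr -big_split; apply: eq_bigr => i _.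
  by rewrite !mxE scalerDl scalerA.
rewrite /= scalerA [k * _]mulrC -scalerA -scalerDr; congr (_ *: _).
rewrite scaler_sumr -big_split; apply: eq_bigr => j _.
by rewrite !mxE scalerDl scalerA.
Qed.

Lemma metric_in_chart_sym a p u v : metric_in_chart a p u v = metric_in_chart a p v u.
Proof.
rewrite /metric_in_chart; under eq_bigr => i _ do rewrite scaler_sumr.
rewrite exchange_big; apply: eq_bigr => j _ /=; rewrite scaler_sumr; apply: eq_bigr => i _.
by rewrite !scalerA [v 0 j * _]mulrC (Defs.metric_sym hg).
Qed.

Lemma smooth_metric_in_chart a u v : smooth (chart_codom a) (fun p => metric_in_chart a p u v).
Proof.
have oa := open_chart_codom a.
apply: (smooth_sum oa) => i; apply: (smooth_scale oa); first exact: smooth_cst.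
apply: (smooth_sum oa) => j; apply: (smooth_scale oa); first exact: smooth_cst.
exact: (Defs.metric_smooth hg (domain_open MP a) (smooth_cframe a 'e_i) (smooth_cframe a 'e_j)).
Qed.

Lemma metric_in_chartE a x (u v : tangent x) : chart_dom a x ->
  g u v = metric_in_chart a (chart a x) (components a u) (components a v).
Proof.
move=> ax; have E (w : tangent x) : w = \sum_(i < n) (components a w 0 i : R) *: cframe a 'e_i x.
  rewrite -{1}(componentsK w ax).
  exact: (linear_row_expand (components a w) (tangent_of_linear ax)).
rewrite {1}(E u) {1}(E v) (bilin_suml (metric_bilin x)) /metric_in_chart (chartK MP) //.
apply: eq_bigr => i _; rewrite (bilin_Zl (metric_bilin x)) (bilin_sumr (metric_bilin x)).
congr (_ *: _); apply: eq_bigr => j _; exact: (bilin_Zr (metric_bilin x)).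
Qed.

Lemma metric_in_chart_pos a p u : chart_codom a p -> u != 0 -> 0 < metric_in_chart a p u u.
Proof.
move=> [x [ax _] <-] u0; rewrite -(tangent_ofK u ax) -metric_in_chartE //.
apply: (Defs.metric_pos hg); apply: contra_neq u0 => E.
by rewrite -(tangent_ofK u ax) E (linear_fun0 (components_linear ax)).
Qed.

Section Dual.
Context (D Dstar : vector_field M -> vector_field M -> vector_field M).
Hypotheses (hD : affine_connection D) (hDs : affine_connection Dstar)
  (hdual : dual_connection g D Dstar).

Lemma metric_in_chart_dual a p u v w : chart_codom a p ->
  dfam (metric_in_chart a) p w u v =
  metric_in_chart a p (gamma Dstar a p w u) v + metric_in_chart a p u (gamma D a p w v).
Proof.
move=> [x [ax _] <-].
have mdom := domain_open MP a.
have := hdual mdom (smooth_cframe a u) (smooth_cframe a v) (smooth_cframe a w) ax.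
have gE q : chart_codom a q -> (tensor_eval g (cframe a u) (cframe a v) \o chart_inv a) q =
    metric_in_chart a q u v.
  move=> [y [ay _] <-]; rewrite /= (chartK MP) // /tensor_eval (metric_in_chartE _ _ ay).
  by rewrite !(tangent_ofK _ ay).
have N : {near chart a x, (tensor_eval g (cframe a u) (cframe a v) \o chart_inv a) =1
    (fun q => metric_in_chart a q u v)}.
  apply: filterS (open_nbhs_nbhs (conj (open_chart_codom a) (chart_codom_chart ax))).
  exact: gE.
have d : differentiable (tensor_eval g (cframe a u) (cframe a v) \o chart_inv a) (chart a x).
  have sg := Defs.metric_smooth hg mdom (smooth_cframe a u) (smooth_cframe a v).
  exact: (smooth_differentiable (sg a) (chart_codom_chart ax)).
have E1 := field_derive_chart (cframe a w) ax d.
have cw : components a (cframe a w x) = w by exact: tangent_ofK.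
rewrite cw in E1; move=> H.
apply: (etrans (esym (near_eq_derive w N))); apply: (etrans (esym E1)); apply: (etrans H).
rewrite !(metric_in_chartE _ _ ax) (gamma_frame hDs _ _ ax) (gamma_frame hD _ _ ax).
by congr (metric_in_chart _ _ _ _ + metric_in_chart _ _ _ _); exact: tangent_ofK.
Qed.

(** By [ccurv_dual], the curvature of [Dstar] paired with itself is minus a pairing with the
    curvature of [D], hence zero; positivity concludes. *)
Lemma ccurv_gamma_dual a p : chart_codom a p ->
  (forall u v w, ccurv (gamma D a) p u v w = 0) ->
  forall u v w, ccurv (gamma Dstar a) p u v w = 0.
Proof.
move=> ap c0 u v w.
have E := ccurv_dual (open_chart_codom a) (metric_in_chart_bilin a)
  (@smooth_metric_in_chart a) (@smooth_gamma _ _ _ _ hD a) (@smooth_gamma _ _ _ _ hDs a)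
  (@metric_in_chart_dual a) u v w (ccurv (gamma Dstar a) p u v w) ap.
apply/eqP/negPn/negP => N0; have := metric_in_chart_pos ap N0.
by rewrite E c0 (bilin_0r (metric_in_chart_bilin a p)) oppr0 ltxx.
Qed.

End Dual.
End MetricInCharts.

(** * Exterior derivative and Nijenhuis tensor in a chart *)

Section TensorsInCharts.
Context {R : realType} {n : nat} {M : manifold R n}.
Context (U : set M) (X Y Z : vector_field M)
  (sX : smooth_field U X) (sY : smooth_field U Y) (sZ : smooth_field U Z) (x : M) (Ux : U x).
Let MP := manifoldP M.
Let a := chart_at x.
Let p := chart a x.
Let ax : chart_dom a x. Proof. exact: domain_chart_at. Qed.
Let Np : nbhs p (chart_codom a).
Proof. exact: (open_nbhs_nbhs (conj (open_chart_codom a) (chart_codom_chart ax))). Qed.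

Let at_p (V : vector_field M) : field_in_chart a V p = V x.
Proof. exact: (etrans (field_in_chart_chart V ax) (components_chart_at (V x))). Qed.

Let diff_p (V : vector_field M) : smooth_field U V -> differentiable (field_in_chart a V) p.
Proof. by move=> sV; exact: (smooth_differentiable (sV a) (coord_dom_chart ax Ux)). Qed.

Let bracketE (V W : vector_field M) : lie_bracket V W x =
  'D_(V x) (field_in_chart a W) p - 'D_(W x) (field_in_chart a V) p.
Proof. by []. Qed.

(** Tensoriality: the derivatives of the components of the three fields cancel against the bracket
    terms, leaving the derivatives of the coefficients of the form. *)
Lemma exterior_derivative2_chart (w : covariant_tensor2 M)
    (W : 'rV[R]_n -> 'rV[R]_n -> 'rV[R]_n -> R) :
  (forall q, bilin (W q)) -> (forall q u v, W q u v = - W q v u) ->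
  (forall u v, differentiable (fun q => W q u v) (chart (chart_at x) x)) ->
  (forall y (u v : tangent y), chart_dom (chart_at x) y -> w y u v =
     W (chart (chart_at x) y) (components (chart_at x) u) (components (chart_at x) v)) ->
  exterior_derivative2 w X Y Z x = dform W (chart (chart_at x) x) (X x) (Y x) (Z x).
Proof.
rewrite -/a -/p => bW aW dW wE.
have wx (u v : tangent x) : w x u v = W p u v by rewrite (wE _ _ _ ax) !components_chart_at.
have D (V V' V'' : vector_field M) : smooth_field U V' -> smooth_field U V'' ->
    field_derive V (tensor_eval w V' V'') x =
    dfam W p (V x) (V' x) (V'' x) + W p ('D_(V x) (field_in_chart a V') p) (V'' x)
    + W p (V' x) ('D_(V x) (field_in_chart a V'') p).
  move=> s' s''.
  have N : {near p, (tensor_eval w V' V'' \o chart_inv a) =1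
      (fun q => W q (field_in_chart a V' q) (field_in_chart a V'' q))}.
    apply: filterS Np => q aq; have aq' := chart_dom_inv aq.
    by rewrite /= /tensor_eval (wE _ _ _ aq') chart_invK.
  have E := derive_bilin_family bW dW (V x) (diff_p s') (diff_p s'').
  rewrite !at_p in E; exact: (etrans (near_eq_derive (V x) N) E).
have L (V V' V'' : vector_field M) : tensor_eval w (lie_bracket V V') V'' x =
    W p ('D_(V x) (field_in_chart a V') p) (V'' x) - W p ('D_(V' x) (field_in_chart a V) p) (V'' x).
  apply: (etrans (wx _ _)); rewrite -(bilin_Nl (bW p)).
  exact: (bilin_Dl (bW p) ('D_(V x) (field_in_chart a V') p) (- 'D_(V' x) (field_in_chart a V) p)).
rewrite /exterior_derivative2.
move: (D X _ _ sY sZ) (D Y _ _ sX sZ) (D Z _ _ sX sY) (L X Y Z) (L X Z Y) (L Y Z X); rewrite /dform.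
generalize (field_derive X (tensor_eval w Y Z) x) (field_derive Y (tensor_eval w X Z) x)
  (field_derive Z (tensor_eval w X Y) x) (tensor_eval w (lie_bracket X Y) Z x)
  (tensor_eval w (lie_bracket X Z) Y x) (tensor_eval w (lie_bracket Y Z) X x).
generalize ('D_(X x) (field_in_chart a Y) p) ('D_(Y x) (field_in_chart a X) p)
  ('D_(X x) (field_in_chart a Z) p) ('D_(Z x) (field_in_chart a X) p)
  ('D_(Y x) (field_in_chart a Z) p) ('D_(Z x) (field_in_chart a Y) p) => d1 d2 d3 d4 d5 d6.
(* Antisymmetry moves the differentiated field to the first slot, where the bracket terms have
   it. *)
rewrite (aW p (Y x) d3) (aW p (X x) d5) (aW p (X x) d6).
generalize (dfam W p (X x) (Y x) (Z x)) (dfam W p (Y x) (X x) (Z x)) (dfam W p (Z x) (X x) (Y x)).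
generalize (W p d1 (Z x)) (W p d2 (Z x)) (W p d3 (Y x)) (W p d4 (Y x)) (W p d5 (X x)) (W p d6 (X x)).
by move=> ? ? ? ? ? ? ? ? ? ? ? ? ? ? ? -> -> -> -> -> ->; ring.
Qed.

(** Derivatives of components along [J X] and [J Y] cancel between the first bracket and the next
    two; those along [X] and [Y] reach the last bracket through [J J = -1]. Only derivatives of [Jc]
    remain. *)
Lemma nijenhuis_chart (J : endomorphism_field M) (Jc : 'rV[R]_n -> 'rV[R]_n -> 'rV[R]_n) :
  (forall q, linear (Jc q)) ->
  (forall u, Jc (chart (chart_at x) x) (Jc (chart (chart_at x) x) u) = - u) ->
  (forall u, differentiable (Jc^~ u) (chart (chart_at x) x)) ->
  (forall y (u : tangent y), chart_dom (chart_at x) y ->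
     components (chart_at x) (J y u) = Jc (chart (chart_at x) y) (components (chart_at x) u)) ->
  nijenhuis J X Y x = cnijenhuis Jc (chart (chart_at x) x) (X x) (Y x).
Proof.
rewrite -/a -/p => lJ JJ dJ JE.
have Jx (u : tangent x) : J x u = Jc p u by rewrite -[LHS]components_chart_at (JE _ _ ax) !components_chart_at.
have D (V : vector_field M) w : smooth_field U V ->
    'D_w (field_in_chart a (endo_eval J V)) p =
    'D_w (Jc^~ (V x)) p + Jc p ('D_w (field_in_chart a V) p).
  move=> sV.
  have N : {near p, field_in_chart a (endo_eval J V) =1 (fun q => Jc q (field_in_chart a V q))}.
    apply: filterS Np => q aq; have aq' := chart_dom_inv aq.
    by rewrite /field_in_chart /endo_eval (JE _ _ aq') chart_invK.
  have E := derive_linear_family lJ dJ (diff_p sV) w.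
  rewrite at_p in E; exact: (etrans (near_eq_derive w N) E).
have B1 : lie_bracket (endo_eval J X) (endo_eval J Y) x =
    ('D_(Jc p (X x)) (Jc^~ (Y x)) p + Jc p ('D_(Jc p (X x)) (field_in_chart a Y) p)) -
    ('D_(Jc p (Y x)) (Jc^~ (X x)) p + Jc p ('D_(Jc p (Y x)) (field_in_chart a X) p)).
  by apply: (etrans (bracketE _ _)); rewrite /endo_eval !Jx; exact: (congr2 _ (D _ _ sY) (congr1 -%R (D _ _ sX))).
have B2 : J x (lie_bracket (endo_eval J X) Y x) =
    Jc p ('D_(Jc p (X x)) (field_in_chart a Y) p) -
    (Jc p ('D_(Y x) (Jc^~ (X x)) p) - 'D_(Y x) (field_in_chart a X) p).
  rewrite Jx bracketE /endo_eval Jx (linear_funD (lJ p)) (linear_funN (lJ p)); congr (_ - _).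
  by apply: (etrans (congr1 (Jc p) (D _ _ sX))); rewrite (linear_funD (lJ p)) JJ.
have B3 : J x (lie_bracket X (endo_eval J Y) x) =
    (Jc p ('D_(X x) (Jc^~ (Y x)) p) - 'D_(X x) (field_in_chart a Y) p) -
    Jc p ('D_(Jc p (Y x)) (field_in_chart a X) p).
  rewrite Jx bracketE /endo_eval Jx (linear_funD (lJ p)) (linear_funN (lJ p)); congr (_ - _).
  by apply: (etrans (congr1 (Jc p) (D _ _ sY))); rewrite (linear_funD (lJ p)) JJ.
move: B1 B2 B3 (bracketE X Y); rewrite /nijenhuis /cnijenhuis.
generalize (lie_bracket (endo_eval J X) (endo_eval J Y) x) (J x (lie_bracket (endo_eval J X) Y x))
  (J x (lie_bracket X (endo_eval J Y) x)) (lie_bracket X Y x).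
generalize (Jc p ('D_(Jc p (X x)) (field_in_chart a Y) p)) (Jc p ('D_(Jc p (Y x)) (field_in_chart a X) p)).
generalize (Jc p ('D_(Y x) (Jc^~ (X x)) p)) (Jc p ('D_(X x) (Jc^~ (Y x)) p)).
generalize ('D_(Jc p (X x)) (Jc^~ (Y x)) p) ('D_(Jc p (Y x)) (Jc^~ (X x)) p).
generalize ('D_(Y x) (field_in_chart a X) p) ('D_(X x) (field_in_chart a Y) p).
clear; move=> A1 A2 A3 A4 A5 A6 A7 A8 A9 A10 A11 A12 -> -> -> ->.
by apply/rowP => i; rewrite !mxE; ring.
Qed.

End TensorsInCharts.

(** * The tangent bundle *)

Section SmoothTangentCoordinates.
Context {R : realType} {n : nat} (O : set 'rV[R]_n) (oO : open O).
Context (G : 'rV[R]_n -> 'rV[R]_n -> 'rV[R]_n -> R) (B : 'rV[R]_n -> 'rV[R]_n -> 'rV[R]_n -> 'rV[R]_n).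
Hypotheses (bG : forall p, bilin (G p)) (bB : forall p, bilin (B p)).
Hypotheses (sG : forall u v, smooth O (fun p => G p u v)) (sB : forall u v, smooth O (fun p => B p u v)).

Let Oz : set 'rV[R]_(n + n) := lsubmx @^-1` O.

Lemma open_lsubmx_preimage : open Oz.
Proof. by apply: open_comp => // ? _; exact: continuous_lsubmx. Qed.

Let smooth_l {W : normedModType R} (f : 'rV[R]_n -> W) :
  smooth O f -> smooth Oz (f \o lsubmx).
Proof. by move=> sf; apply: smooth_comp_linear => //; exact: lsubmx_continuous. Qed.

Let srsub : smooth Oz (rsubmx : 'rV[R]_(n + n) -> 'rV[R]_n).
Proof. by apply: smooth_linear; exact: rsubmx_continuous. Qed.

Let smooth_Bz (X : 'rV[R]_(n + n) -> 'rV[R]_n) : smooth Oz X ->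
  smooth Oz (fun z => B (lsubmx z) (X z) (rsubmx z)).
Proof.
move=> sX; apply: (@smooth_bilin_family _ _ _ _ _ (fun z : 'rV[R]_(n + n) => B (lsubmx z)) _ Oz X rsubmx open_lsubmx_preimage _ sX srsub).
- by move=> z; exact: bB.
- by move=> u v; exact: (smooth_l (sB u v)).
Qed.

Lemma smooth_kap u : smooth Oz (fun z => kap B z u).
Proof.
apply: (smoothD open_lsubmx_preimage (@smooth_cst _ _ _ _ (rsubmx u))).
exact: (smooth_Bz (@smooth_cst _ _ _ _ (lsubmx u))).
Qed.

Lemma smooth_csasaki u v : smooth Oz (fun z => csasaki G B z u v).
Proof.
apply: (smoothD open_lsubmx_preimage (smooth_l (sG (lsubmx u) (lsubmx v)))).
apply: (@smooth_bilin_family _ _ _ _ _ (fun z : 'rV[R]_(n + n) => G (lsubmx z)) _ Oz _ _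
  open_lsubmx_preimage _ (smooth_kap u) (smooth_kap v)).
- by move=> z; exact: bG.
- by move=> a b; exact: (smooth_l (sG a b)).
Qed.

Lemma smooth_cJ u : smooth Oz (fun z => cJ B z u).
Proof.
have oz := open_lsubmx_preimage; apply: (smooth_row_mx oz).
  apply: (@smooth_eq _ _ _ Oz (fun z => (-1 : R) *: kap B z u)) => //.
    by move=> z _; rewrite scaleN1r.
  by apply: (smooth_scale oz _ (smooth_kap u)); exact: smooth_cst.
exact: (smoothD oz (@smooth_cst _ _ _ _ (lsubmx u)) (smooth_Bz (smooth_kap u))).
Qed.

End SmoothTangentCoordinates.

(** * Change of induced coordinates *)

Section TangentBundleCharts.
Context {R : realType} {n : nat} {M : manifold R n}.
Notation T := (tangent_bundle M).
Implicit Types (a b : chart_index M) (xi : T).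
Let MP := manifoldP M.

Lemma tangent_chart_codom a : @chart_codom _ _ T a = lsubmx @^-1` (@chart_codom _ _ M a).
Proof. exact: (tangent_bundle_coord_dom (M := M) a (chart_dom a)). Qed.

Lemma lsubmx_tangent_chart a xi : lsubmx (@chart _ _ T a xi) = chart a (projT1 xi).
Proof. exact: row_mxKl. Qed.

Lemma rsubmx_tangent_chart a xi : rsubmx (@chart _ _ T a xi) = components a (projT2 xi).
Proof. exact: row_mxKr. Qed.

(** The transition of TM sends [(x, y)] to [tau x] and the derivative of [tau] at [x] along [y].
    Differentiating it produces the second derivative of [tau], which a horizontal lift has to
    compensate. *)
Lemma tangent_components a xi (z1 z2 : 'rV[R]_n) : chart_dom a (projT1 xi) ->
  let b := chart_at (projT1 xi) in let p := chart b (projT1 xi) in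
  @components _ _ T a xi (row_mx z1 z2) =
  row_mx ('D_z1 (transition b a) p)
    ('D_z1 ('D_(projT2 xi) (transition b a)) p + 'D_z2 (transition b a) p).
Proof.
case: xi => x v /= ax; have bx := domain_chart_at MP x; set b := chart_at x in bx *.
set p := chart b x; pose tau := transition b a.
have ob : open (coord_dom b (chart_dom a)) by exact: domain_open.
have bp : coord_dom b (chart_dom a) p by exists x.
have st : smooth (coord_dom b (chart_dom a)) tau by exact: (transition_smooth MP).
have dt q : coord_dom b (chart_dom a) q -> differentiable tau q by exact: smooth_differentiable.
pose F (z : 'rV[R]_(n + n)) := row_mx (tau (lsubmx z)) (jacobian_map tau (lsubmx z) (rsubmx z)).
have zE : @chart _ _ T b (existT _ x v) = row_mx p v.
  by rewrite -[LHS]/(row_mx _ (components b v)) components_chart_at.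
have N : {near row_mx p v, @transition _ _ T b a =1 F}.
  have ozl : open ((lsubmx : 'rV[R]_(n + n) -> 'rV[R]_n) @^-1` coord_dom b (chart_dom a)).
    exact: open_lsubmx_preimage.
  have bz : coord_dom b (chart_dom a) (lsubmx (row_mx p v)) by rewrite row_mxKl.
  apply: filterS (open_nbhs_nbhs (conj ozl bz)) => z [y [by_ ay] yz].
  rewrite /F -yz (jacobian_mapE _ (dt _ (coord_dom_chart by_ ay))).
  rewrite -[LHS]/(row_mx (chart a (chart_inv b (lsubmx z)))
    (components a (tangent_of b (chart_inv b (lsubmx z)) (rsubmx z)))).
  rewrite -yz (chartK MP by_) (components_tangent_of _ by_ ay).
  by rewrite [tau _](transition_chart a by_).
have dl := differentiable_lsubmx (row_mx p v); have dr := differentiable_rsubmx (row_mx p v).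
have bp' : coord_dom b (chart_dom a) (lsubmx (row_mx p v)) by rewrite row_mxKl.
have d1 : differentiable (fun z : 'rV[R]_(n + n) => tau (lsubmx z)) (row_mx p v).
  exact: (differentiable_comp dl (dt _ bp')).
have dj w : differentiable (fun z : 'rV[R]_(n + n) => jacobian_map tau (lsubmx z) w) (row_mx p v).
  have dj1 := smooth_differentiable (smooth_jacobian_map w ob st) bp'.
  exact: (differentiable_comp dl dj1).
have lj (z : 'rV[R]_(n + n)) := jacobian_map_linear tau (lsubmx z).
have d2 := differentiable_linear_family lj dj dr.
have E1 : 'D_(row_mx z1 z2) (fun z : 'rV[R]_(n + n) => tau (lsubmx z)) (row_mx p v) = 'D_z1 tau p.
  have E := derive_comp (row_mx z1 z2) dl (dt _ bp').
  by rewrite derive_lsubmx !row_mxKl in E.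
have E2 : 'D_(row_mx z1 z2) (fun z : 'rV[R]_(n + n) => jacobian_map tau (lsubmx z) v) (row_mx p v) =
    'D_z1 ('D_v tau) p.
  have E := derive_comp (row_mx z1 z2) dl (smooth_differentiable (smooth_jacobian_map v ob st) bp').
  rewrite derive_lsubmx !row_mxKl in E; apply: (etrans E).
  apply: near_eq_derive; apply: filterS (open_nbhs_nbhs (conj ob bp)) => q bq.
  exact: (jacobian_mapE _ (dt _ bq)).
have E3 := derive_linear_family lj dj dr (row_mx z1 z2).
rewrite derive_rsubmx !row_mxKr row_mxKl (jacobian_mapE _ (dt _ bp)) in E3.
rewrite -[LHS]/('D_(row_mx z1 z2) (@transition _ _ T b a) (@chart _ _ T b (existT _ x v))) zE.
apply: (etrans (near_eq_derive (row_mx z1 z2) N)).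
apply: (etrans (derive_row_mx (row_mx z1 z2) d1 d2)).
exact: (congr2 _ E1 (etrans E3 (congr2 _ E2 erefl))).
Qed.

End TangentBundleCharts.

Lemma comega_antisym {R : realType} {n : nat} (G : 'rV[R]_n -> 'rV[R]_n -> 'rV[R]_n -> R)
    (B : 'rV[R]_n -> 'rV[R]_n -> 'rV[R]_n -> 'rV[R]_n) z u v :
  (forall p u v, G p u v = G p v u) -> comega G B z u v = - comega G B z v u.
Proof. by move=> symG; rewrite /comega opprB symG [X in _ - X]symG. Qed.

Lemma csasaki_sym {R : realType} {n : nat} (G : 'rV[R]_n -> 'rV[R]_n -> 'rV[R]_n -> R)
    (B : 'rV[R]_n -> 'rV[R]_n -> 'rV[R]_n -> 'rV[R]_n) z u v :
  (forall p u v, G p u v = G p v u) -> csasaki G B z u v = csasaki G B z v u.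
Proof. by move=> symG; rewrite /csasaki symG [X in _ + X]symG. Qed.

Lemma csasaki_cJ {R : realType} {n : nat} (G : 'rV[R]_n -> 'rV[R]_n -> 'rV[R]_n -> R)
    (B : 'rV[R]_n -> 'rV[R]_n -> 'rV[R]_n -> 'rV[R]_n) z u v :
  (forall p, bilin (G p)) -> (forall p, bilin (B p)) ->
  csasaki G B z (cJ B z u) (cJ B z v) = csasaki G B z u v.
Proof.
move=> bG bB; rewrite /csasaki !lsubmx_cJ !(kap_cJ bB) (bilin_Nl (bG _)) (bilin_Nr (bG _)) opprK.
exact: addrC.
Qed.

(** * The natural structure in an arbitrary chart *)

Section NaturalStructureInCharts.
Context {R : realType} {n : nat} {M : manifold R n}.
Notation T := (tangent_bundle M).
Context (g : covariant_tensor2 M) (hg : riemannian_metric g)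
  (D : vector_field M -> vector_field M -> vector_field M) (hD : affine_connection D).
Implicit Types (a b : chart_index M) (xi : T).
Let MP := manifoldP M.

Let bB a p : bilin (gamma D a p) := gamma_bilin D a p.

Lemma horizontal_liftE xi (X : tangent (projT1 xi)) :
  let b := chart_at (projT1 xi) in
  horizontal_lift D X = row_mx (X : 'rV[R]_n) (- gamma D b (chart b (projT1 xi)) X (projT2 xi)).
Proof.
move=> b; rewrite /horizontal_lift; congr (row_mx _ (- _)).
apply/rowP => k; rewrite mxE /gamma (chartK MP); last exact: domain_chart_at.
rewrite summxE; apply: eq_bigr => i _; rewrite mxE summxE mulr_sumr; apply: eq_bigr => j _.
rewrite mxE components_chart_at /christoffel -/b.
by rewrite -mulrA [LHS]mulrC -mulrA.
Qed.

(** The horizontal lift is defined in [chart_at x]; that it has the same form in [a] is the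
    transformation law of the Christoffel symbols. The law comes from computing [D] of one pair of
    frame fields in both charts. *)
Lemma components_horizontal_lift a xi (X : tangent (projT1 xi)) : chart_dom a (projT1 xi) ->
  @components _ _ T a xi (horizontal_lift D X) = chor (gamma D a) (@chart _ _ T a xi) (components a X).
Proof.
case: xi X => x v /= X ax; rewrite horizontal_liftE /= tangent_components //=.
have bx := domain_chart_at MP x; set b := chart_at x in bx *; set p := chart b x.
set tau := transition b a.
have dt := change_frame_differentiable bx ax; rewrite -/tau -/p in dt.
have lt := derive_dir_linear dt.
rewrite /chor row_mxKl row_mxKr; congr row_mx.
rewrite (linear_funN lt).
have cX : cframe b X x = X by rewrite -[LHS]components_chart_at tangent_ofK.
have cv : cframe b v x = v by rewrite -[LHS]components_chart_at tangent_ofK.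
have E := components_connection hD (domain_open MP b) (smooth_cframe b X) (smooth_cframe b v) bx ax.
rewrite cX cv in E.
have E1 : D (cframe b X) (cframe b v) x = gamma D b p X v.
  by rewrite -(gamma_frame hD X v bx) components_chart_at.
(* In [a], a field with constant components in [b] reads, along [tau], as ['D_v tau]; its derivative
   is the second derivative of the transition found in [tangent_components]. *)
have E2 : 'D_(components a X) (field_in_chart a (cframe b v)) (chart a x) = 'D_X ('D_v tau) p.
  have oV : open (coord_dom b (chart_dom a)) by exact: domain_open.
  have df : differentiable (field_in_chart a (cframe b v)) (tau p).
    rewrite [tau p](transition_chart a bx).
    exact: (smooth_differentiable (smooth_cframe b v a) (coord_dom_chart ax bx)).
  have C := derive_comp X dt df; rewrite [tau p](transition_chart a bx) in C.
  apply: (etrans (esym C)); apply: near_eq_derive.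
  apply: filterS (open_nbhs_nbhs (conj oV (coord_dom_chart bx ax))) => _ [y [by_ ay] <-].
  rewrite /= [tau _](transition_chart a by_) (field_in_chart_chart _ ay).
  exact: components_tangent_of.
rewrite E1 E2 in E.
have E' : 'D_(gamma D b p X v) tau p = components a (gamma D b p X v : tangent x) by [].
by rewrite E' E opprD addNKr.
Qed.

Lemma components_vertical_lift a xi (X : tangent (projT1 xi)) : chart_dom a (projT1 xi) ->
  @components _ _ T a xi (vertical_lift X) = row_mx 0 (components a X).
Proof.
move=> ax; rewrite /vertical_lift tangent_components //.
have D0 (W : normedModType R) (f : 'rV[R]_n -> W) q : 'D_0 f q = 0 by exact: derive0.
by rewrite !D0 add0r.
Qed.

Section AtPoint.
Context (a : chart_index M) (xi : T) (ax : chart_dom a (projT1 xi)).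

Let lT : linear (@components _ _ T a xi).
Proof. exact: (@components_linear _ _ T a xi ax). Qed.

(** The splitting into lifts read in [a]. Applying [lsubmx] and [kap] to it identifies them with the
    horizontal and vertical parts in every chart. *)
Lemma components_decomposition (z : tangent xi) : @components _ _ T a xi z =
  chor (gamma D a) (@chart _ _ T a xi) (components a (horizontal_part z)) +
  row_mx 0 (components a (vertical_part D z)).
Proof.
rewrite {1}(lift_decomposition D z) (linear_funD lT).
by rewrite components_horizontal_lift // components_vertical_lift.
Qed.

Lemma components_horizontal_part (z : tangent xi) :
  components a (horizontal_part z) = lsubmx (@components _ _ T a xi z).
Proof.
rewrite components_decomposition /chor add_row_mx.
by rewrite row_mxKl addr0.
Qed.

Lemma components_vertical_part (z : tangent xi) :
  components a (vertical_part D z) = kap (gamma D a) (@chart _ _ T a xi) (@components _ _ T a xi z).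
Proof.
rewrite components_decomposition (linear_funD (kap_linear (gamma_bilin D a) _)).
by rewrite kap_chor (kap_ver (gamma_bilin D a)) add0r.
Qed.

Lemma sasaki_in_chart (z w : tangent xi) : sasaki_metric g D xi z w =
  csasaki (metric_in_chart g a) (gamma D a) (@chart _ _ T a xi)
    (@components _ _ T a xi z) (@components _ _ T a xi w).
Proof.
rewrite /sasaki_metric !(metric_in_chartE hg _ _ ax) /csasaki lsubmx_tangent_chart.
by rewrite !components_horizontal_part !components_vertical_part.
Qed.

Lemma natural_J_in_chart (z : tangent xi) : @components _ _ T a xi (natural_J D xi z) =
  cJ (gamma D a) (@chart _ _ T a xi) (@components _ _ T a xi z).
Proof.
rewrite /natural_J (linear_funD lT) (linear_funN lT).
rewrite components_horizontal_lift // components_vertical_lift //.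
rewrite components_horizontal_part components_vertical_part /chor /cJ.
by rewrite opp_row_mx add_row_mx opprK add0r.
Qed.

Lemma kahler_form_in_chart (z w : tangent xi) :
  kahler_form (natural_J D) (sasaki_metric g D) z w =
  comega (metric_in_chart g a) (gamma D a) (@chart _ _ T a xi)
    (@components _ _ T a xi z) (@components _ _ T a xi w).
Proof.
rewrite /kahler_form sasaki_in_chart natural_J_in_chart /csasaki /comega.
rewrite lsubmx_cJ (kap_cJ (gamma_bilin D a)) (bilin_Nl (metric_in_chart_bilin g a _)).
exact: addrC.
Qed.

End AtPoint.

Lemma natural_almost_hermitian : almost_hermitian (natural_J D) (sasaki_metric g D).
Proof.
have dom xi : chart_dom (chart_at (projT1 xi)) (projT1 xi) by exact: domain_chart_at.
have bG a p : bilin (metric_in_chart g a p) := metric_in_chart_bilin g a p.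
have bg a := csasaki_bilin (bG a) (bB a).
have lc xi : linear (@components _ _ T (chart_at (projT1 xi)) xi).
  exact: (@components_linear _ _ T _ xi (dom xi)).
have inj xi : injective (@components _ _ T (chart_at (projT1 xi)) xi).
  by move=> u v; exact: (@components_inj _ _ T _ xi u v (dom xi)).
have co a (U : set T) : @coord_dom _ _ T a U `<=` lsubmx @^-1` (@chart_codom _ _ M a).
  by rewrite -tangent_chart_codom; exact: (@coord_dom_sub _ _ T a U).
have mh : riemannian_metric (sasaki_metric g D).
  split.
  - move=> xi k u v w; rewrite !(sasaki_in_chart (dom xi)) (lc xi).
    exact: (bilin_Pl (bg _ _)).
  - move=> xi u v; rewrite !(sasaki_in_chart (dom xi)).
    by apply: csasaki_sym => p u' v'; exact: metric_in_chart_sym.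
  - move=> xi u u0; rewrite (sasaki_in_chart (dom xi)) /csasaki.
    set z := @chart _ _ T _ xi; set uc := @components _ _ T _ xi u.
    have pc : @chart_codom _ _ M (chart_at (projT1 xi)) (lsubmx z).
      by rewrite lsubmx_tangent_chart; exact: chart_codom_chart.
    have nn v : 0 <= metric_in_chart g (chart_at (projT1 xi)) (lsubmx z) v v.
      have [->|v0] := eqVneq v 0; first by rewrite (bilin_0l (bG _ _)).
      exact/ltW/(metric_in_chart_pos hg pc v0).
    (* One of the two nonnegative terms is positive: if the horizontal component vanishes, the
       vertical one cannot, by [kap_inj]. *)
    have [l0|l0] := eqVneq (lsubmx uc) 0; last first.
      by apply: ltr_wpDr; [exact: nn|exact: (metric_in_chart_pos hg pc l0)].
    apply: ltr_wpDl; first exact: nn.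
    apply: (metric_in_chart_pos hg pc); apply: contra_neq u0 => k0.
    apply: (inj xi); rewrite -/uc (linear_fun0 (lc xi)).
    apply: (@kap_inj _ _ (gamma D (chart_at (projT1 xi))) z).
      by rewrite l0; exact/esym/linear0.
    by rewrite k0 (linear_fun0 (kap_linear (bB _) _)).
  - move=> U X Y oU sX sY a.
    have oa := open_coord_dom (M := T) a oU.
    apply: (@smooth_eq _ _ _ _ (fun z => csasaki (metric_in_chart g a) (gamma D a) z
      (@field_in_chart _ _ T a X z) (@field_in_chart _ _ T a Y z))) => //.
      move=> _ [xi [axi Uxi] <-]; have axi' : @chart_dom _ _ M a (projT1 xi) := axi.
      rewrite !(field_in_chart_chart (M := T) _ axi) -(sasaki_in_chart axi').
      exact: (congr1 (tensor_eval (sasaki_metric g D) X Y) (esym (chartK (manifoldP T) axi))).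
    apply: (smooth_bilin_family (bg a) oa _ (sX a) (sY a)) => u v.
    apply: (smooth_sub (@co a U)); apply: smooth_csasaki => //.
    + exact: open_chart_codom.
    + exact: smooth_metric_in_chart.
    + exact: smooth_gamma.
split; first exact: mh.
- move=> xi k u v; apply: (inj xi); have E w := natural_J_in_chart (dom xi) w.
  apply: (etrans (E _)); apply: (etrans (congr1 (cJ _ _) (lc xi k u v))).
  apply: (etrans (cJ_linear (bB _) _ _ _ _)); apply: (etrans _ (esym (lc xi k _ _))).
  exact: (congr2 (fun s t => k *: s + t) (esym (E u)) (esym (E v))).
- move=> U X oU sX a.
  have oa := open_coord_dom (M := T) a oU.
  apply: (@smooth_eq _ _ _ _ (fun z => cJ (gamma D a) z (@field_in_chart _ _ T a X z))) => //.
    move=> _ [xi [axi Uxi] <-]; have axi' : @chart_dom _ _ M a (projT1 xi) := axi.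
    by rewrite !(field_in_chart_chart (M := T) _ axi) /endo_eval natural_J_in_chart.
  apply: (smooth_linear_family oa (cJ_linear (bB a)) _ (sX a)) => u.
  apply: (smooth_sub (@co a U)); apply: smooth_cJ => //.
  + exact: open_chart_codom.
  + exact: smooth_gamma.
- move=> xi u; apply: (inj xi); have E w := natural_J_in_chart (dom xi) w.
  apply: (etrans (E _)); apply: (etrans (congr1 (cJ _ _) (E u))).
  apply: (etrans (cJK (bB _) _ _)); exact: (esym (linear_funN (lc xi) u)).
- move=> xi u v; have E w := natural_J_in_chart (dom xi) w.
  have S w w' := sasaki_in_chart (dom xi) w w'.
  apply: (etrans (S _ _)); apply: (etrans (congr2 (csasaki _ _ _) (E u) (E v))).
  exact: (etrans (@csasaki_cJ _ _ _ _ _ _ _ (bG _) (bB _)) (esym (S u v))).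
Qed.

End NaturalStructureInCharts.

(** * Closedness, integrability and the Einstein condition *)

Section NaturalStructureTheorem.
Context {R : realType} {n : nat} {M : manifold R n}.
Notation T := (tangent_bundle M).
Context (g : covariant_tensor2 M) (hg : riemannian_metric g)
  (D Dstar : vector_field M -> vector_field M -> vector_field M)
  (hD : affine_connection D) (hDs : affine_connection Dstar) (hdual : dual_connection g D Dstar).
Implicit Types (a b : chart_index M) (xi : T) (x : M).
Let MP := manifoldP M.

Let bG a p : bilin (metric_in_chart g a p) := metric_in_chart_bilin g a p.
Let bB a p : bilin (gamma D a p) := gamma_bilin D a p.

Let Omega := kahler_form (natural_J D) (sasaki_metric g D).

Section AtPoint.
Context (xi : T).
Let x := projT1 xi.
Let a := chart_at x.
Let z : 'rV[R]_(n + n) := @chart _ _ T a xi.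
Let ax : chart_dom a x. Proof. exact: domain_chart_at. Qed.

Let codom_z : @chart_codom _ _ M a (lsubmx z).
Proof. by rewrite lsubmx_tangent_chart; exact: chart_codom_chart. Qed.

Let dG u v : differentiable (fun q => metric_in_chart g a q u v) (lsubmx z).
Proof. exact: (smooth_differentiable (smooth_metric_in_chart hg u v) codom_z). Qed.

Let dB u v : differentiable (fun q => gamma D a q u v) (lsubmx z).
Proof. exact: (smooth_differentiable (smooth_gamma hD u v) codom_z). Qed.

Lemma exterior_derivative_kahler_form (U : set T) (X Y Z : vector_field T) : mopen U ->
  smooth_field U X -> smooth_field U Y -> smooth_field U Z -> U xi ->
  exterior_derivative2 Omega X Y Z xi =
  dform (comega (metric_in_chart g a) (gamma D a)) z (X xi) (Y xi) (Z xi).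
Proof.
move=> oU sX sY sZ Uxi; apply: (exterior_derivative2_chart sX sY sZ Uxi).
- exact: (comega_bilin (bG a) (bB a)).
- by move=> q u v; apply: comega_antisym => *; exact: metric_in_chart_sym.
- by move=> u v; exact: (differentiable_comega (bG a) (bB a) dG dB).
- by move=> eta u v ae; exact: (kahler_form_in_chart hg hD ae).
Qed.

Lemma nijenhuis_natural_J (U : set T) (X Y : vector_field T) : mopen U ->
  smooth_field U X -> smooth_field U Y -> U xi ->
  nijenhuis (natural_J D) X Y xi = cnijenhuis (cJ (gamma D a)) z (X xi) (Y xi).
Proof.
move=> oU sX sY Uxi; apply: (nijenhuis_chart sX sY Uxi).
- exact: (cJ_linear (bB a)).
- by move=> u; exact: (cJK (bB a)).
- by move=> u; exact: (differentiable_cJ (bB a) dB).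
- by move=> eta u ae; exact: (natural_J_in_chart hD ae).
Qed.

Lemma cframe_chart_at u : @cframe _ _ T a u xi = u.
Proof.
rewrite -[LHS](components_chart_at (M := T)).
exact: (@tangent_ofK _ _ T a xi u ax).
Qed.

End AtPoint.

Lemma closed_kahler_formP : closed_form2 Omega <-> torsion_free Dstar.
Proof.
split=> [cl U X Y oU sX sY x Ux|tf U X Y Z oU sX sY sZ xi Uxi]; last first.
  have ax := domain_chart_at MP (projT1 xi); set a := chart_at _ in ax.
  have codom : @chart_codom _ _ M a (lsubmx (@chart _ _ T a xi)).
    by rewrite lsubmx_tangent_chart; exact: chart_codom_chart.
  rewrite (exterior_derivative_kahler_form oU sX sY sZ Uxi).
  have T0 p u v : chart_codom a p -> ctorsion (gamma Dstar a) p u v = 0.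
    by move=> ap; exact: (torsion_freeP hDs).1.
  rewrite (dform_comega (bG a) (bB a) (@metric_in_chart_sym _ _ _ _ hg a) _ _
    (Bs := gamma Dstar a)); first last.
  - by move=> u v w; exact: (metric_in_chart_dual hg hD hDs hdual).
  - by move=> u v; exact: (smooth_differentiable (smooth_gamma hD u v) codom).
  - by move=> u v; exact: (smooth_differentiable (smooth_metric_in_chart hg u v) codom).
  rewrite !T0 // !(bilin_0l (bG _ _)) !add0r.
  exact: (bianchi_dual (open_chart_codom a) (bG a) (@smooth_metric_in_chart _ _ _ _ hg a)
    (@smooth_gamma _ _ _ _ hD a) (@smooth_gamma _ _ _ _ hDs a)
    (@metric_in_chart_dual _ _ _ _ hg _ _ hD hDs hdual a) T0 _ _ _ _ codom).
rewrite (torsion_gamma hDs oU sX sY Ux).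
have ax := domain_chart_at MP x; set a := chart_at x in ax *; set p := chart a x.
pose xi : T := existT _ x (0 : 'rV[R]_n).
pose z : 'rV[R]_(n + n) := @chart _ _ T a xi.
have lz : lsubmx z = p by exact: lsubmx_tangent_chart.
have rz : rsubmx z = 0 by rewrite rsubmx_tangent_chart (linear_fun0 (components_linear ax)).
have codom : chart_codom a p by exact: chart_codom_chart.
have axi : @chart_dom _ _ T a xi := ax.
have key u v w : metric_in_chart g a p (ctorsion (gamma Dstar a) p u v) w = 0.
  have sf t := smooth_cframe (M := T) a t.
  have mT : mopen (@chart_dom _ _ T a) by exact: (domain_open (manifoldP T)).
  (* With two horizontal lifts and one vertical vector, the only torsion term left is
     [G(Tstar(u, v), w)]; the curvature terms vanish at the zero vector. *)
  pose hu := chor (gamma D a) z u; pose hv := chor (gamma D a) z v; pose vw : 'rV[R]_(n + n) := row_mx 0 w.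
  have := cl _ _ _ _ mT (sf hu) (sf hv) (sf vw) xi axi.
  rewrite (exterior_derivative_kahler_form mT (sf hu) (sf hv) (sf vw) axi) -/a -/z.
  rewrite !(@cframe_chart_at xi).
  rewrite (dform_comega (bG a) (bB a) (@metric_in_chart_sym _ _ _ _ hg a) _ _
    (Bs := gamma Dstar a)); first last.
  - by move=> ? ? ?; apply: (metric_in_chart_dual hg hD hDs hdual); rewrite lz.
  - by move=> ? ?; apply: (smooth_differentiable (smooth_gamma hD _ _)); rewrite lz.
  - by move=> ? ?; apply: (smooth_differentiable (smooth_metric_in_chart hg _ _)); rewrite lz.
  have c0 s t : ccurv (gamma D a) (lsubmx z) s t (rsubmx z) = 0.
    have bd r : bilin (dfam (gamma D a) (lsubmx z) r).
      apply: (dfam_bilin (bB a)) => ? ?.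
      by apply: (smooth_differentiable (smooth_gamma hD _ _)); rewrite lz.
    by rewrite rz /ccurv !(bilin_0r (bd _), bilin_0r (bB _ _)) !subr0 addr0.
  rewrite !c0 /hu /hv /vw !kap_chor (kap_ver (bB a)) !(bilin_0r (bG _ _)) !addr0 lz.
  by rewrite !row_mxKl.
apply/eqP/negPn/negP => T0; have := metric_in_chart_pos hg codom T0.
by rewrite key ltxx.
Qed.

Lemma integrable_natural_J : torsion_free D -> curvature_free D ->
  integrable_structure (natural_J D).
Proof.
move=> tf cf U X Y oU sX sY xi Uxi.
rewrite (nijenhuis_natural_J oU sX sY Uxi).
have ax := domain_chart_at MP (projT1 xi); set a := chart_at _ in ax *.
have codom : @chart_codom _ _ M a (lsubmx (@chart _ _ T a xi)).
  by rewrite lsubmx_tangent_chart; exact: chart_codom_chart.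
apply: (cnijenhuis0 (bB a)) => [e f|u v|u v].
- exact: (smooth_differentiable (smooth_gamma hD e f) codom).
- exact: ((torsion_freeP hD).1 tf).
- by rewrite lsubmx_tangent_chart; exact: (curvature_free_gamma hD).
Qed.

(** The curvature is given in coordinates because [ccurv_gamma_dual] transfers it to [Dstar] in that
    form. *)
Lemma integrable_natural_J_flat : integrable_structure (natural_J D) ->
  torsion_free D /\ forall x u v y,
    ccurv (gamma D (chart_at x)) (chart (chart_at x) x) u v y = 0.
Proof.
move=> int.
(* The point [xi] of the fibre is free, so the last argument [y] of the curvature is arbitrary. *)
have key x y u v : ctorsion (gamma D (chart_at x)) (chart (chart_at x) x) u v = 0 /\
    ccurv (gamma D (chart_at x)) (chart (chart_at x) x) u v y = 0.
  have ax := domain_chart_at MP x; set a := chart_at x in ax *; set p := chart a x.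
  pose xi : T := existT _ x y.
  pose z : 'rV[R]_(n + n) := @chart _ _ T a xi.
  have lz : lsubmx z = p by exact: lsubmx_tangent_chart.
  have rz : rsubmx z = y by rewrite rsubmx_tangent_chart components_chart_at.
  have axi : @chart_dom _ _ T a xi := ax.
  have sf t := smooth_cframe (M := T) a t.
  have mT : mopen (@chart_dom _ _ T a) by exact: (domain_open (manifoldP T)).
  have := int _ _ _ mT (sf (chor (gamma D a) z u)) (sf (chor (gamma D a) z v)) xi axi.
  rewrite (nijenhuis_natural_J mT (sf _) (sf _) axi) -/a -/z !(@cframe_chart_at xi).
  rewrite -lz -rz; apply: (cnijenhuis_chor (bB a)) => e f; rewrite lz.
  exact: (smooth_differentiable (smooth_gamma hD e f) (chart_codom_chart ax)).
split=> [U X Y oU sX sY x Ux|x u v y]; last exact: (key x y u v).2.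
by rewrite (torsion_gamma hD oU sX sY Ux) (key x 0 _ _).1.
Qed.

Lemma einstein_curvature_free : einstein (sasaki_metric g D) -> curvature_free D.
Proof.
move=> [L [[hL tL dL] [lam ein]]] U X Y Z oU sX sY sZ x Ux.
rewrite (curvature_gamma hD oU sX sY Ux sZ).
have ax := domain_chart_at MP x; set a := chart_at x in ax *; set p := chart a x.
have codom : chart_codom a p by exact: chart_codom_chart.
have hh := hermitian_metric (natural_almost_hermitian hg hD).
(* The frame expansion of the Sasaki metric on TM agrees with its explicit formula over the whole
   chart, so that the two may also be differentiated interchangeably. *)
have hE z u v : chart_codom a (lsubmx z) ->
    metric_in_chart (sasaki_metric g D) a z u v = csasaki (metric_in_chart g a) (gamma D a) z u v.
  move=> az; have : @chart_codom _ _ T a z by rewrite tangent_chart_codom.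
  move=> [xi [axi _] <-]; have axi' : @chart_dom _ _ M a (projT1 xi) := axi.
  have [tu tv] := (@tangent_ofK _ _ T a xi u axi, @tangent_ofK _ _ T a xi v axi).
  have S := sasaki_in_chart hg hD axi' (@tangent_of _ _ T a xi u) (@tangent_of _ _ T a xi v).
  have H := @metric_in_chartE _ _ T _ hh a xi (@tangent_of _ _ T a xi u) (@tangent_of _ _ T a xi v) axi.
  exact: (etrans (esym (etrans H (congr2 (metric_in_chart _ _ _) tu tv)))
    (etrans S (congr2 (csasaki _ _ _) tu tv))).
have oz := open_lsubmx_preimage (open_chart_codom a).
apply: (@einstein_flat _ _ _ (open_chart_codom a) (metric_in_chart g a) (gamma D a) (gamma L a)
  (bG a) (bB a) (gamma_bilin L a) (@metric_in_chart_sym _ _ _ _ hg a) _ _ _ _ _ _ _ lam codom).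
- by move=> q u aq u0; exact: metric_in_chart_pos.
- exact: smooth_metric_in_chart.
- exact: smooth_gamma.
- by move=> u v; rewrite -tangent_chart_codom; exact: smooth_gamma.
- move=> z u v az; apply/subr0_eq; apply: (torsion_freeP hL).1 => //.
  by rewrite tangent_chart_codom.
- move=> z u v w az; rewrite -!hE //.
  have N : {near z, (fun q => csasaki (metric_in_chart g a) (gamma D a) q u v) =1
      (fun q => metric_in_chart (sasaki_metric g D) a q u v)}.
    by apply: filterS (open_nbhs_nbhs (conj oz az)) => q aq; rewrite hE.
  apply: (etrans (near_eq_derive w N)); apply: (metric_in_chart_dual hh hL hL dL).
  by rewrite tangent_chart_codom.
(* The Einstein equation at [(x, y)] on the constant vertical field [(0, v)]: its squared length is
   [G(v, v)] at every point of the fibre, and [lam] is common to all of them. *)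
- move=> y v; pose xi : T := existT _ x y.
  have axi : @chart_dom _ _ T a xi := ax.
  have mT : mopen (@chart_dom _ _ T a) by exact: (domain_open (manifoldP T)).
  have sf t := smooth_cframe (M := T) a t.
  have zE : @chart _ _ T a xi = row_mx p y.
    by rewrite -[LHS]/(row_mx _ (components a (y : tangent x))) components_chart_at.
  pose V : 'rV[R]_(n + n) := row_mx 0 v.
  have eV t : @cframe _ _ T a t xi = t := @cframe_chart_at xi t.
  have K i := curvature_gamma hL mT (sf 'e_i) (sf V) axi (sf V).
  have cc (C : 'rV[R]_(n + n) -> 'rV[R]_(n + n) -> 'rV[R]_(n + n) -> 'rV[R]_(n + n)) q q' u u' w w' :
    q = q' -> u = u' -> w = w' -> ccurv C q u w w = ccurv C q' u' w' w' by move=> -> -> ->.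
  have K' i := etrans (K i) (cc (gamma L a) _ _ _ _ _ _ zE (eV 'e_i) (eV V)).
  have S := @sasaki_in_chart _ _ _ _ hg _ hD a xi ax (V : tangent xi) (V : tangent xi).
  have cV : @components _ _ T a xi V = V := @components_chart_at _ _ T xi V.
  have S' : csasaki (metric_in_chart g a) (gamma D a) (@chart _ _ T a xi) V V = metric_in_chart g a p v v.
    by rewrite zE /csasaki /V !row_mxKl (kap_ver (bB a)) (bilin_0l (bG _ _)) add0r.
  have S1 := etrans S (etrans (congr2 (csasaki _ _ _) cV cV) S').
  have E := ein _ _ _ mT (sf V) (sf V) xi axi.
  have S0 := congr2 (@sasaki_metric _ _ _ g D xi) (eV V) (eV V).
  apply: (etrans _ (etrans E (congr1 ( *%R lam) (etrans S0 S1)))).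
  by apply: eq_bigr => i _; exact: (congr1 (fun m : 'rV[R]_(n + n) => m 0 i) (esym (K' i))).
Qed.

End NaturalStructureTheorem.

Theorem theorem1p1 (R : realType) (n : nat) (M : manifold R n)
    (g : covariant_tensor2 M)
    (D Dstar : vector_field M -> vector_field M -> vector_field M)
    (hg : riemannian_metric g) (hD : affine_connection D)
    (hDstar : affine_connection Dstar) (hdual : dual_connection g D Dstar) :
  [/\ almost_kahler (natural_J D) (sasaki_metric g D) <-> torsion_free Dstar,
      kahler (natural_J D) (sasaki_metric g D) <->
        flat_connection D /\ flat_connection Dstar
    & einstein (sasaki_metric g D) -> curvature_free D].
Proof.
have AH := natural_almost_hermitian hg hD.
have AK := closed_kahler_formP hg hD hDstar hdual.
split; last exact: einstein_curvature_free.
  by split=> [[_ /AK]|/AK]; [|split].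
(* Closedness gives the torsion of [Dstar], integrability the torsion and curvature of [D]; the
   curvature of [Dstar] follows from that of [D] by duality. *)
split=> [[[_ /AK tfs] /(integrable_natural_J_flat hD)[tf c0]]|[[tf cf] [tfs _]]]; last first.
  by split; [split=> //; exact/AK|exact: integrable_natural_J].
split; split=> // U X Y Z oU sX sY sZ x Ux.
  by rewrite (curvature_gamma hD oU sX sY Ux sZ) c0.
rewrite (curvature_gamma hDstar oU sX sY Ux sZ).
apply: (ccurv_gamma_dual hg hD hDstar hdual) => [|u v w]; last exact: c0.
exact/chart_codom_chart/domain_chart_at/manifoldP.
Qed.
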